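(* Let $\gamma_1,\gamma_2>0$ satisfy $$\gamma_1>\tfrac14,\qquad \gamma_1\Big(27\,\frac{\ln(\ln 27)}{\ln 27}-26\,\frac{\ln(\ln 28)}{\ln 28}\Big)<\gamma_2\Big(\frac{2}{\ln2}-\frac1{\ln3}\Big)<\frac{1-2\gamma_1}{1+2\gamma_1}.$$ Let $\eta_1:\mathbb{R}\to\mathbb{R}$ be the even function whose graph over $[0,\infty)$ is the polygonal line connecting successively the points $$(0,1),\ \Big(1,\gamma_1\Big(27\,\frac{\ln(\ln 27)}{\ln 27}-26\,\frac{\ln(\ln 28)}{\ln 28}\Big)\Big),\ \Big(28,\gamma_1\frac{\ln(\ln28)}{\ln28}\Big),\ \Big(29,\gamma_1\frac{\ln(\ln29)}{\ln29}\Big),\ldots,$$ and let $\eta_2:\mathbb{R}\to\mathbb{R}$ be the even function whose graph over $[0,\infty)$ is the polygonal line connecting successively the points $$(0,1),\ \Big(1,\gamma_2\Big(\frac2{\ln2}-\frac1{\ln3}\Big)\Big),\ \Big(3,\frac{\gamma_2}{\ln3}\Big),\ \Big(4,\frac{\gamma_2}{\ln4}\Big),\ldots.$$ Then $r_{ij}=\eta_1(i)\eta_2(j)$, $(i,j)\in\mathbb{Z}^2$, is a covariance function on $\mathbb{Z}^2$. Moreover, if $\{X_{(i,j)}:(i,j)\in\mathbb{Z}^2\}$ is a stationary Gaussian random field with mean zero, unit variance and $E X_{(i,j)}X_{(0,0)}=r_{ij}$, then the standard normal distribution function $\Phi$ is a sectorial phantom distribution function for $\{X_{(i,j)}\}$,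 while $\{X_{(i,j)}\}$ admits no (global) phantom distribution function.
   Context: $\mathbb{N}=\{1,2,\ldots\}$; $\le$ on $\mathbb{Z}^2$ is the coordinatewise partial order. For $\mathbf n\in\mathbb{N}^2$, $M_{\mathbf n}=\max\{X_{\mathbf k}:(1,1)\le\mathbf k\le\mathbf n\}$ and $\mathbf n^*=n_1n_2$. $\mathbf n\to\boldsymbol\infty$ means that both coordinates tend to infinity. A distribution function $G$ is a (global) phantom distribution function for $\{X_{\mathbf n}\}$ if $\sup_{x\in\mathbb{R}}|P(M_{\mathbf n}\le x)-G(x)^{\mathbf n^*}|\to0$ as $\mathbf n\to\boldsymbol\infty$. A monotone curve in $\mathbb{N}^2$ is a map $\boldsymbol\psi:\mathbb{N}\to\mathbb{N}^2$ such that $\boldsymbol\psi(n)\to\boldsymbol\infty$, $\boldsymbol\psi(n)\le\boldsymbol\psi(n+1)$ and $\boldsymbol\psi(n)\ne\boldsymbol\psi(n+1)$ for all $n$, and $\boldsymbol\psi(n)^*/\boldsymbol\psi(n+1)^*\to1$. A distribution function $G$ is a phantom distribution function along $\boldsymbol\psi$ if $\sup_{x\in\mathbb{R}}|P(M_{\boldsymbol\psi(n)}\le x)-G(x)^{\boldsymbol\psi(n)^*}|\to0$ as $n\to\infty$. $G$ is a sectorial phantom distribution function if it is a phantom distribution function along every monotone curve $\boldsymbol\varphi$ for which there is $C\ge1$ with $\boldsymbol\varphi(n)\in\bigcup_{j\in\mathbb{N}}[C^{-1}j,Cj]^2$ for all but finitely many $n$. *)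

(* Defs.v *)
From HB Require Import structures.
From mathcomp Require Import all_boot all_order all_algebra.
From mathcomp Require Import all_classical all_reals all_analysis.
Set Implicit Arguments.
Unset Strict Implicit.
Unset Printing Implicit Defensive.
Import Order.TTheory GRing.Theory Num.Theory.
Import numFieldNormedType.Exports.
Local Open Scope classical_set_scope.
Local Open Scope ring_scope.

Definition planar_segment (R : realType) (p q : R * R) : set (R * R) :=
  [set (line_path p.1 q.1 t, line_path p.2 q.2 t) | t in `[0, 1]].

Definition even_polygonal (R : realType) (p : nat -> R * R) (f : R -> R) : Prop :=
  (forall x, f (- x) = f x) /\
  [set z : R * R | 0 <= z.1 /\ z.2 = f z.1] = \bigcup_k planar_segment (p k) (p k.+1).

Definition lnln_ratio (R : realType) (x : R) : R := ln (ln x) / ln x.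

(* the vertices (0, _), (1, _), (28, _), (29, _), ... *)
Definition nodes1 (R : realType) (g1 : R) (k : nat) : R * R :=
  match k with
  | 0%N => (0, 1)
  | 1%N => (1, g1 * (27 * lnln_ratio 27 - 26 * lnln_ratio 28))
  | _ => ((26 + k)%:R, g1 * lnln_ratio (26 + k)%:R)
  end.

(* the vertices (0, _), (1, _), (3, _), (4, _), ... *)
Definition nodes2 (R : realType) (g2 : R) (k : nat) : R * R :=
  match k with
  | 0%N => (0, 1)
  | 1%N => (1, g2 * (2 / ln 2 - 1 / ln 3))
  | _ => (k.+1%:R, g2 / ln k.+1%:R)
  end.

(* [r] is the covariance function of some second-order random field on Z^2
   that is stationary in the wide sense. *)
Definition covariance_function (R : realType) (r : int * int -> R) : Prop :=
  exists (d : measure_display) (T : measurableType d) (P : probability T R)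
         (Y : int * int -> {RV P >-> R}),
    [/\ forall k, (Y k : T -> R) \in Lfun P 2%:E,
        forall k, ('E_P[Y k] = 'E_P[Y (0, 0)%R])%E &
        forall k l, covariance P (Y k) (Y l) = (r (k - l))%:E].

Definition strictly_stationary (d : measure_display) (T : measurableType d)
    (R : realType) (P : probability T R) (X : int * int -> {RV P >-> R}) : Prop :=
  forall (n : nat) (k : n.-tuple (int * int)%type) (h : int * int)
    (A : set (n.-tuple R)), measurable A ->
  P [set w | A [tuple X (tnth k i + h) w | i < n]] =
  P [set w | A [tuple X (tnth k i) w | i < n]].

(* [normal_prob m 0] is not a point mass in the library, hence the case split. *)
Definition normally_distributed (d : measure_display) (T : measurableType d)
    (R : realType) (P : probability T R) (Y : T -> R) : Prop :=
  exists m s : R, 0 <= s /\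
    forall A : set R, measurable A ->
      P (Y @^-1` A) = if s == 0 then \d_m A else normal_prob m s A.

Definition gaussian_field (d : measure_display) (T : measurableType d)
    (R : realType) (P : probability T R) (X : int * int -> {RV P >-> R}) : Prop :=
  forall (n : nat) (a : 'I_n -> R) (k : 'I_n -> int * int),
    normally_distributed P (fun w => \sum_(i < n) a i * X (k i) w).

Definition standard_normal_df (R : realType) (x : R) : R :=
  fine (normal_prob 0 1 `]-oo, x]).

Definition distribution_function (R : realType) (G : R -> R) : Prop :=
  [/\ {homo G : x y / x <= y}, right_continuous G,
      G x @[x --> -oo] --> (0 : R) & G x @[x --> +oo] --> (1 : R)].

(* Meaningful for n >= (1, 1), in which case the default value X (1, 1) of the
   iterated maxima is one of the variables of the maximum. *)
Definition field_max (T : Type) (R : realType) (X : int * int -> T -> R)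
    (n : nat * nat) (w : T) : R :=
  \big[Num.max/X (1, 1) w]_(1 <= i < n.1.+1)
    \big[Num.max/X (1, 1) w]_(1 <= j < n.2.+1) X (i%:Z, j%:Z) w.

Definition phantom_distance (d : measure_display) (T : measurableType d)
    (R : realType) (P : probability T R) (X : int * int -> T -> R) (G : R -> R)
    (n : nat * nat) : R :=
  sup (range (fun x : R =>
    `| fine (P [set w | field_max X n w <= x]) - G x ^+ (n.1 * n.2) |)).

Definition phantom_df (d : measure_display) (T : measurableType d)
    (R : realType) (P : probability T R) (X : int * int -> T -> R) (G : R -> R) :
    Prop :=
  distribution_function G /\
  phantom_distance P X G n @[n --> filter_prod \oo \oo] --> (0 : R).

(* Curves are indexed by n >= 1; the value psi 0 is irrelevant. *)
Definition monotone_curve (R : realType) (psi : nat -> nat * nat) : Prop :=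
  [/\ forall n, (0 < n)%N -> (0 < (psi n).1)%N /\ (0 < (psi n).2)%N,
      psi n @[n --> \oo] --> filter_prod \oo \oo,
      forall n, (0 < n)%N ->
        ((psi n).1 <= (psi n.+1).1)%N /\ ((psi n).2 <= (psi n.+1).2)%N,
      forall n, (0 < n)%N -> psi n <> psi n.+1 &
      ((psi n).1 * (psi n).2)%:R / ((psi n.+1).1 * (psi n.+1).2)%:R
        @[n --> \oo] --> (1 : R)].

Definition phantom_df_along (d : measure_display) (T : measurableType d)
    (R : realType) (P : probability T R) (X : int * int -> T -> R)
    (psi : nat -> nat * nat) (G : R -> R) : Prop :=
  distribution_function G /\
  phantom_distance P X G (psi n) @[n --> \oo] --> (0 : R).

Definition sectorial_curve (R : realType) (psi : nat -> nat * nat) : Prop :=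
  exists C : R, 1 <= C /\
    \forall n \near \oo, exists j : nat, (0 < j)%N /\
      C^-1 * j%:R <= (psi n).1%:R <= C * j%:R /\
      C^-1 * j%:R <= (psi n).2%:R <= C * j%:R.

Definition sectorial_phantom_df (d : measure_display) (T : measurableType d)
    (R : realType) (P : probability T R) (X : int * int -> T -> R) (G : R -> R) :
    Prop :=
  distribution_function G /\
  forall psi : nat -> nat * nat,
    monotone_curve R psi -> sectorial_curve R psi -> phantom_df_along P X psi G.

(* Main.v *)
(** Covariance: both factors are convex null sequences with value 1 at 0, hence by Polya
    mixtures of triangles; the product of two independent stationary processes
    sqrt 2 cos (n theta + phi) has covariance r.

    Sectorial phantom: as r >= 0, decoupling one variable at a time gives
    0 <= P(M <= u) - Phi(u)^N <= sum of Cov(1[X_k <= u], 1[X_l <= u]) over pairs. In a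
    sector the pairs that are close in one coordinate number only N^(3/2 + o(1)), which
    is compensated by eta2 1 < 1/3, and for the others r(k - l) <= eta1 m eta2 m is
    o(1 / ln N).

    No phantom: the boxes (qp, qp) and (q^2, p^2) have the same number N of points.
    Choose u with N (1 - Phi u) = 15. On the first box, P(M <= u) is close to
    Phi(u)^N <= 1/16. On the second one, with p fixed and q -> oo, all variables are
    correlated with the average W of q variables of the first row, at mutual distance q;
    the squared correlation times ln N tends to infinity, because eta1(n) ln n does. On
    the event W <= 0 exceedances of u are therefore negligible, so that
    P(M <= u) >= 1/4. *)
Require Import Defs.
From HB Require Import structures.
From mathcomp Require Import all_boot all_order all_algebra.
From mathcomp Require Import all_classical all_reals all_analysis.
From mathcomp Require Import measurable_realfun.
From mathcomp Require Import zify ring lra.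
Set Implicit Arguments.
Unset Strict Implicit.
Unset Printing Implicit Defensive.
Import Order.TTheory GRing.Theory Num.Theory.
Import numFieldNormedType.Exports.
Local Open Scope classical_set_scope.
Local Open Scope ring_scope.

(** * Expectations of bounded measurable functions *)

(** No joint density and no regular conditional law occurs: the only Gaussian input is the law of
    single linear combinations. Replacing one variable by an independent one preserves their
    characteristic functions; a Cramer-Wold argument, based on Gaussian smoothing of indicators,
    carries this over to boxes, and the new variable is then a parameter to condition on.

    The hypotheses on gamma_1 and gamma_2 enter as follows. gamma_1 > 1/4 turns the last inequality
    into eta2 1 < 1/3, the bound that near pairs require. Nearness means distance at most m, about
    N^delta, in one coordinate; then ln m is comparable to ln N, and eta1 m eta2 m ln N tends to 0
    because eta2 n ln n is bounded and eta1 tends to 0.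

    In a long box the factor ln ln in eta1 is decisive: the average W has variance at most 2 eta1 q,
    and covariance at least eta1(q^2) eta2(p^2) with every variable. As eta1 q <= 2 eta1(q^2), the
    squared correlation is at least eta1 q times a positive constant depending on p; hence p is
    fixed before q tends to infinity. *)

Definition bmeas (R : realType) d (T : measurableType d) (f : T -> R) :=
  measurable_fun setT f /\ exists M : R, forall x, `|f x| <= M :> R.

Definition Ex (R : realType) d (T : measurableType d) (P : probability T R)
  (f : T -> R) : R := \int[P]_w f w.

Section bmeas.
Context (R : realType) d (T : measurableType d).
Implicit Types (f g : T -> R).

Lemma bmeasD f g : bmeas f -> bmeas g -> bmeas (fun x => f x + g x).
Proof.
move=> [mf [M fM]] [mg [N gN]]; split; first exact: measurable_funD.
by exists (M + N) => x; rewrite (le_trans (ler_normD _ _))// lerD.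
Qed.

Lemma bmeasN f : bmeas f -> bmeas (fun x => - f x).
Proof.
move=> [mf [M fM]]; split; first exact: measurable_funN.
by exists M => x; rewrite normrN.
Qed.

Lemma bmeasB f g : bmeas f -> bmeas g -> bmeas (fun x => f x - g x).
Proof. by move=> bf bg; exact: (bmeasD bf (bmeasN bg)). Qed.

Lemma bmeasM f g : bmeas f -> bmeas g -> bmeas (fun x => f x * g x).
Proof.
move=> [mf [M fM]] [mg [N gN]]; split; first exact: measurable_funM.
by exists (M * N) => x; rewrite normrM ler_pM.
Qed.

Lemma bmeas_cst (c : R) : bmeas (fun _ : T => c).
Proof. by split; [exact: measurable_cst|exists `|c|]. Qed.

Lemma bmeasZ (c : R) f : bmeas f -> bmeas (fun x => c * f x).
Proof. by move=> bf; exact: (bmeasM (bmeas_cst c) bf). Qed.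

Lemma bmeas_sum (I : Type) (r : seq I) (F : I -> T -> R) :
  (forall i, bmeas (F i)) -> bmeas (fun x => \sum_(i <- r) F i x).
Proof.
move=> bF; elim: r => [|i r IH].
  rewrite (_ : (fun _ => _) = fun=> 0); first exact: bmeas_cst.
  by apply/funext => x; rewrite big_nil.
rewrite (_ : (fun _ => _) = fun x => F i x + \sum_(i <- r) F i x).
  exact: bmeasD.
by apply/funext => x; rewrite big_cons.
Qed.

Lemma bmeas_cos f : measurable_fun setT f -> bmeas (fun x => cos (f x)).
Proof.
move=> mf; split; last by exists 1 => x; exact: cos_max.
apply: measurableT_comp mf.
by apply: continuous_measurable_fun; exact: continuous_cos.
Qed.

Lemma bmeas_sin f : measurable_fun setT f -> bmeas (fun x => sin (f x)).
Proof.
move=> mf; split; last by exists 1 => x; exact: sin_max.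
apply: measurableT_comp mf.
by apply: continuous_measurable_fun; exact: continuous_sin.
Qed.

Lemma measurable_natr_bool (b : T -> bool) : measurable [set x | b x] ->
  measurable_fun setT (fun x => (b x)%:R : R).
Proof.
move=> mb; rewrite (_ : (fun _ => _) = \1_[set x | b x]).
  exact: measurable_indic.
by apply/funext => x; rewrite indicE/=; congr (_%:R); congr nat_of_bool;
  apply/idP/idP; rewrite inE.
Qed.

Lemma bmeas_bool (b : T -> bool) : measurable [set x | b x] ->
  bmeas (fun x => (b x)%:R : R).
Proof.
move=> mb; split; first exact: measurable_natr_bool.
by exists 1 => x; case: (b x); rewrite ?normr1 ?normr0.
Qed.

Lemma measurable_le_cst f (u : R) : measurable_fun setT f ->
  measurable [set x | f x <= u].
Proof.
move=> mf; have -> : [set x | f x <= u] = setT `&` f @^-1` `]-oo, u].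
  by rewrite setTI; apply/seteqP; split => x /=; rewrite in_itv.
exact: mf.
Qed.

Lemma measurable_gt_cst f (u : R) : measurable_fun setT f ->
  measurable [set x | u < f x].
Proof.
move=> mf; have -> : [set x | u < f x] = setT `&` f @^-1` `]u, +oo[.
  by rewrite setTI; apply/seteqP; split => x /=; rewrite in_itv/= andbT.
exact: mf.
Qed.

End bmeas.

Section Ex.
Context (R : realType) d (T : measurableType d) (P : probability T R).
Implicit Types (f g : T -> R).

Lemma bmeas_integrable f : bmeas f -> P.-integrable setT (EFin \o f).
Proof.
move=> [mf [M fM]]; apply: measurable_bounded_integrable => //.
  exact: (le_lt_trans (probability_le1 P measurableT) (ltry _)).
exists M; split; first exact: num_real.
by move=> x Mx y _; exact: le_trans (fM y) (ltW Mx).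
Qed.

Lemma EFin_Ex f : bmeas f -> (Ex P f)%:E = (\int[P]_w (f w)%:E)%E.
Proof.
by move=> bf; rewrite fineK//; apply: integrable_fin_num => //;
  exact: bmeas_integrable.
Qed.

Lemma ExD f g : bmeas f -> bmeas g -> Ex P (fun x => f x + g x) = Ex P f + Ex P g.
Proof. by move=> bf bg; apply: RintegralD => //; exact: bmeas_integrable. Qed.

Lemma ExB f g : bmeas f -> bmeas g -> Ex P (fun x => f x - g x) = Ex P f - Ex P g.
Proof. by move=> bf bg; apply: RintegralB => //; exact: bmeas_integrable. Qed.

Lemma ExZ c f : bmeas f -> Ex P (fun x => c * f x) = c * Ex P f.
Proof. by move=> bf; apply: RintegralZl => //; exact: bmeas_integrable. Qed.

Lemma Ex_cst c : Ex P (fun _ => c) = c.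
Proof.
by rewrite /Ex Rintegral_cst// (_ : fine _ = 1) ?mulr1//;
  have /= -> := probability_setT P.
Qed.

Lemma le_Ex f g : bmeas f -> bmeas g -> (forall x, f x <= g x) -> Ex P f <= Ex P g.
Proof. by move=> bf bg fg; apply: le_Rintegral => //; exact: bmeas_integrable. Qed.

Lemma Ex_ge0 f : (forall x, 0 <= f x) -> 0 <= Ex P f.
Proof. by move=> f0; apply: Rintegral_ge0. Qed.

Lemma Ex_sum (I : Type) (r : seq I) (F : I -> T -> R) :
  (forall i, bmeas (F i)) ->
  Ex P (fun x => \sum_(i <- r) F i x) = \sum_(i <- r) Ex P (F i).
Proof.
move=> bF; elim: r => [|i r IH].
  rewrite big_nil -[RHS]Ex_cst; congr Ex.
  by apply/funext => x; rewrite big_nil.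
rewrite big_cons -IH -ExD//; last exact: bmeas_sum.
by congr Ex; apply/funext => x; rewrite big_cons.
Qed.

Lemma Ex_bool (b : T -> bool) : measurable [set x | b x] ->
  Ex P (fun x => (b x)%:R) = fine (P [set x | b x]).
Proof.
move=> mb; rewrite /Ex /Rintegral -[in RHS](setIT [set x | b x]).
rewrite -integral_indic//; congr fine; apply: eq_integral => x _.
by rewrite indicE; congr (_%:R%:E); congr nat_of_bool; apply/idP/idP; rewrite inE.
Qed.

Lemma cvg_Ex (f_ : nat -> T -> R) f M :
  (forall n, measurable_fun setT (f_ n)) -> (forall n x, `|f_ n x| <= M) ->
  (forall x, f_ n x @[n --> \oo] --> f x) ->
  Ex P (f_ n) @[n --> \oo] --> Ex P f.
Proof.
move=> mf fM ff; apply: fine_cvg.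
have mlim : measurable_fun setT f.
  by apply: (measurable_fun_cvg mf) => x _; exact: ff.
have bfM x : `|f x| <= M.
  have := @closed_cvg _ R \oo _ (fun n => `|f_ n x|) [set y | y <= M]
    (@closed_le R M).
  apply; [by apply: nearW => n /=; exact: fM|by apply: cvg_norm; exact: ff].
rewrite fineK; last first.
  apply: integrable_fin_num => //; apply: bmeas_integrable; split => //.
  by exists M.
apply: (@dominated_cvg _ _ _ P setT _ _ _ (cst M%:E)) => //.
- by move=> n; exact/measurable_EFinP.
- by move=> x _; apply: cvg_EFin; [exact: nearW|exact: ff].
- exact: (bmeas_integrable (bmeas_cst _ M)).
- by move=> n x _; rewrite lee_fin.
Qed.

End Ex.

Section Fubini_bmeas.
Context (R : realType) d1 (T1 : measurableType d1) d2 (T2 : measurableType d2).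
Variables (P1 : probability T1 R) (P2 : probability T2 R).
Variable f : T1 * T2 -> R.
Hypothesis bf : bmeas f.

Lemma bmeas_section1 x : bmeas (fun y => f (x, y)).
Proof.
have [mf [M fM]] := bf; split; last by exists M.
exact: measurableT_comp mf _.
Qed.

Lemma bmeas_section2 y : bmeas (fun x => f (x, y)).
Proof.
have [mf [M fM]] := bf; split; last by exists M.
exact: measurableT_comp mf _.
Qed.

Let intf := bmeas_integrable (P1 \x P2)%E bf.

Lemma Ex_prod1 : Ex (P1 \x P2)%E f = Ex P1 (fun x => Ex P2 (fun y => f (x, y))).
Proof.
rewrite /Ex /Rintegral -(integral12_prod_meas1 intf); congr fine.
by apply: eq_integral => x _; exact/esym/(EFin_Ex _ (bmeas_section1 x)).
Qed.

Lemma Ex_prod2 : Ex (P1 \x P2)%E f = Ex P2 (fun y => Ex P1 (fun x => f (x, y))).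
Proof.
rewrite /Ex /Rintegral -(integral21_prod_meas1 intf); congr fine.
by apply: eq_integral => x _; exact/esym/(EFin_Ex _ (bmeas_section2 x)).
Qed.

Lemma bmeas_Ex1 : bmeas (fun x => Ex P2 (fun y => f (x, y))).
Proof.
split; last first.
  have [mf [M fM]] := bf; exists M => x.
  have bs := bmeas_section1 x.
  by rewrite ler_norml; apply/andP; split; [rewrite -(Ex_cst P2 (- M))|
      rewrite -(Ex_cst P2 M)]; apply: le_Ex => //; try exact: bmeas_cst;
    move=> y; have := fM (x, y); rewrite ler_norml => /andP[].
have := measurable_fubini_F intf => mF.
apply/measurable_EFinP; apply: eq_measurable_fun mF => x _.
by rewrite /fubini_F/= EFin_Ex//; exact: bmeas_section1.
Qed.

Lemma bmeas_Ex2 : bmeas (fun y => Ex P1 (fun x => f (x, y))).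
Proof.
split; last first.
  have [mf [M fM]] := bf; exists M => x.
  have bs := bmeas_section2 x.
  by rewrite ler_norml; apply/andP; split; [rewrite -(Ex_cst P1 (- M))|
      rewrite -(Ex_cst P1 M)]; apply: le_Ex => //; try exact: bmeas_cst;
    move=> y; have := fM (y, x); rewrite ler_norml => /andP[].
have := measurable_fubini_G intf => mF.
apply/measurable_EFinP; apply: eq_measurable_fun mF => x _.
by rewrite /fubini_G/= EFin_Ex//; exact: bmeas_section2.
Qed.

End Fubini_bmeas.

(** * The standard normal law *)

Section lebesgue_affine.
Context (R : realType).
Notation mu := (@lebesgue_measure R).
Variables (c d : R).
Hypothesis c0 : c != 0.

Let F (x : measurableTypeR R) : measurableTypeR R := c * x + d.

Let mF : measurable_fun setT F.
Proof. by apply: measurable_funD => //; exact: measurable_funM. Qed.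

Let nu : {measure set (measurableTypeR R) -> \bar R} :=
  mscale (NngNum (normr_ge0 c))
    (measure_function_pushforward__canonical__measure_function_Measure mu mF).

Let preimage_itvoc (a b : R) : mu (F @^-1` [set` `]a, b]]) =
  (if (a < b)%R then (`|c|^-1 * (b - a))%:E else 0)%E.
Proof.
have [cp|cn|/eqP] := ltgtP 0 c; last by rewrite eq_sym (negbTE c0).
  rewrite (_ : _ @^-1` _ = [set` `](a - d) / c, (b - d) / c]]); last first.
    apply/seteqP; split => x /=; rewrite !in_itv/= /F ltr_pdivrMr// ler_pdivlMr//
      ltrBlDr lerBrDr (mulrC x)//.
  rewrite lebesgue_measure_itv/= lte_fin ltr_pM2r ?invr_gt0// ltrBlDr subrK.
  case: ifP => // _; rewrite -EFinB -mulrBl gtr0_norm// mulrC; congr (_ * _)%:E.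
  by ring.
rewrite (_ : _ @^-1` _ = [set` `[(b - d) / c, (a - d) / c[]); last first.
  apply/seteqP; split => x /=; rewrite !in_itv/= /F andbC ltr_ndivlMr// ler_ndivrMr//
    ltrBlDr lerBrDr (mulrC x)//.
rewrite lebesgue_measure_itv/= lte_fin ltr_nM2r ?invr_lt0// ltrBlDr subrK.
case: ifP => // _; rewrite -EFinB -mulrBl ltr0_norm// invrN mulNr -mulrN mulrC.
by congr (_ * _)%:E; ring.
Qed.

(** Lebesgue measure is determined by its values on half-open intervals, where [nu] agrees with it.
    For c < 0 the preimage is half-open on the other side, which does not change its length. *)
Lemma lebesgue_measure_affine (A : set (measurableTypeR R)) : measurable A ->
  mu A = (`|c|%:E * mu (F @^-1` A))%E.
Proof.
have <- // : nu A = (`|c|%:E * mu (F @^-1` A))%E by [].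
apply: lebesgue_measure_unique => _ [[a b] _ <-]/=.
rewrite /nu /mscale /= /pushforward preimage_itvoc lebesgue_measure_itv/= lte_fin.
case: ifP => _; last by rewrite mule0.
by rewrite -EFinB -EFinM mulVKf// normr_eq0.
Qed.

Lemma ge0_integral_affine (f : R -> R) :
  measurable_fun setT f -> (forall x, 0 <= f x) ->
  (\int[mu]_x (f x)%:E = `|c|%:E * \int[mu]_x (f (c * x + d))%:E)%E.
Proof.
move=> mf f0; rewrite (eq_measure_integral nu); last first.
  by move=> A mA _; exact: lebesgue_measure_affine.
rewrite ge0_integral_mscale//=; last 2 first.
  exact/measurable_EFinP.
  by move=> x _; rewrite lee_fin.
rewrite ge0_integral_pushforward//; last 2 first.
  exact/measurable_EFinP.
  by move=> x _; rewrite lee_fin.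
Qed.

End lebesgue_affine.

Definition stdn (R : realType) : probability (measurableTypeR R) R := normal_prob 0 1.

Definition gpdf (R : realType) (x : R) : R := normal_pdf 0 1 x.

Section stdn.
Context (R : realType).
Notation mu := (@lebesgue_measure R).
Notation gam := (stdn R).
Implicit Types (f : R -> R).

Lemma gpdfE (x : R) : gpdf x = normal_peak 1 * expR (- x ^+ 2 / 2).
Proof. by rewrite /gpdf normal_pdfE ?oner_neq0// /normal_fun subr0 expr1n. Qed.

Lemma measurable_gpdf : measurable_fun setT (@gpdf R).
Proof. exact: measurable_normal_pdf. Qed.

Lemma gpdf_ge0 (x : R) : 0 <= gpdf x.
Proof. exact: normal_pdf_ge0. Qed.

(** The Radon-Nikodym derivative of [gam] and the density [gpdf] have the same integral over every
    measurable set, hence agree almost everywhere. *)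
Lemma ge0_integral_stdn f : measurable_fun setT f -> (forall x, 0 <= f x) ->
  (\int[gam]_x (f x)%:E = \int[mu]_x (f x * gpdf x)%:E)%E.
Proof.
move=> mf f0.
have dom : gam `<< mu by exact: normal_prob_dominates.
have mdn : measurable_fun setT (fun x : R => (gpdf x)%:E).
  by apply/measurable_EFinP; exact: measurable_gpdf.
have mEf : measurable_fun setT (fun x : R => (f x)%:E) by exact/measurable_EFinP.
rewrite -(Radon_Nikodym_SigmaFinite.change_of_variables dom)//.
have intRN := Radon_Nikodym_SigmaFinite.f_integrable dom.
apply: ae_eq_integral => //.
- by apply: emeasurable_funM => //; exact: measurable_int intRN.
- by apply/measurable_EFinP; apply: measurable_funM => //; exact: measurable_gpdf.
- under [X in ae_eq _ _ _ X]eq_fun do rewrite EFinM.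
  apply: ae_eqe_mul2l; apply: integral_ae_eq => //.
  by move=> E _ mE; rewrite -Radon_Nikodym_SigmaFinite.f_integral.
Qed.

Lemma normal_prob_scale (m s : R) (A : set (measurableTypeR R)) : 0 < s -> measurable A ->
  normal_prob m s A = gam [set z : R | A (s * z + m)].
Proof.
move=> s0 mA.
have mF : measurable_fun setT (fun x : measurableTypeR R => s * x + m : measurableTypeR R).
  by apply: measurable_funD => //; exact: measurable_funM.
have mFA : measurable [set z : R | A (s * z + m)].
  by rewrite -[X in measurable X]setTI; exact: mF.
have -> : gam [set z : R | A (s * z + m)] =
    (\int[gam]_x (\1_[set z : R | A (s * z + m)] x)%:E)%E.
  by rewrite integral_indic// setIT.
have mI : measurable_fun setT (\1_[set z : R | A (s * z + m)] : R -> R).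
  exact: measurable_indic.
rewrite (ge0_integral_stdn mI)//.
rewrite /normal_prob integral_mkcond.
transitivity (\int[mu]_x (\1_A x * normal_pdf m s x)%:E)%E.
  apply: eq_integral => x _; rewrite patchE indicE.
  by case: ifP; rewrite ?mul1r ?mul0r.
rewrite (ge0_integral_affine m (lt0r_neq0 s0))//; last 2 first.
- by apply: measurable_funM; [exact: measurable_indic|exact: measurable_normal_pdf].
- by move=> x; rewrite mulr_ge0// normal_pdf_ge0.
rewrite -ge0_integralZl//; last 2 first.
- apply/measurable_EFinP.
  apply: (measurableT_comp (f := fun x => \1_A x * normal_pdf m s x)) mF.
  by apply: measurable_funM; [exact: measurable_indic|exact: measurable_normal_pdf].
- by move=> x _; rewrite lee_fin mulr_ge0// normal_pdf_ge0.
apply: eq_integral => x _; rewrite -EFinM mulrCA; congr (_ * _)%:E.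
rewrite gpdfE normal_pdfE ?gt_eqF// mulrA gtr0_norm//; congr (_ * _).
  rewrite /normal_peak expr1n mul1r -mulrnAr sqrtrM ?sqr_ge0// sqrtr_sqr gtr0_norm//.
  by rewrite invfM mulrA mulfV ?gt_eqF// mul1r.
rewrite /normal_fun addrK exprMn -[s ^+ 2 *+ 2]mulr_natr invfM.
by congr expR; rewrite -mulrN -mulrA mulrCA [s ^+ 2 * _]mulrCA !mulrA; field; rewrite gt_eqF.
Qed.

(** The Cameron-Martin formula for a shift by t: substitute in the density and complete the
    square. *)
Lemma ge0_Ex_shift (t : R) f : measurable_fun setT f -> (forall x, 0 <= f x) ->
  (\int[gam]_z (f (z + t))%:E = \int[gam]_z (f z * expR (t * z - t ^+ 2 / 2))%:E)%E.
Proof.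
move=> mf f0.
have mft : measurable_fun setT (fun z : R => f (z + t)).
  by apply: measurableT_comp mf _; exact: measurable_funD.
have me : measurable_fun setT (fun z : R => expR (t * z - t ^+ 2 / 2)).
  by apply: measurableT_comp => //; apply: measurable_funD => //; exact: measurable_funM.
rewrite (ge0_integral_stdn mft)// (ge0_integral_stdn (measurable_funM mf me))//;
  last by move=> x; rewrite mulr_ge0// expR_ge0.
rewrite [RHS](ge0_integral_affine t (oner_neq0 R)); last 2 first.
- apply: measurable_funM; last exact: measurable_gpdf.
  exact: measurable_funM.
- by move=> x; rewrite mulr_ge0 ?gpdf_ge0// mulr_ge0// expR_ge0.
rewrite normr1 mul1e; apply: eq_integral => x _; congr (_%:E).
rewrite mul1r -mulrA; congr (_ * _); rewrite !gpdfE mulrCA -expRD.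
by congr (_ * expR _); field.
Qed.

Lemma ge0_Ex_opp f : measurable_fun setT f -> (forall x, 0 <= f x) ->
  (\int[gam]_z (f (- z))%:E = \int[gam]_z (f z)%:E)%E.
Proof.
move=> mf f0.
have mfo : measurable_fun setT (fun z : R => f (- z)) by exact: measurableT_comp.
rewrite !ge0_integral_stdn//.
have N10 : (-1 : R) != 0 by rewrite oppr_eq0 oner_neq0.
rewrite [RHS](ge0_integral_affine 0 N10); last 2 first.
- by apply: measurable_funM => //; exact: measurable_gpdf.
- by move=> x; rewrite mulr_ge0 ?gpdf_ge0.
rewrite normrN1 mul1e; apply: eq_integral => x _.
by rewrite mulN1r addr0 !gpdfE sqrrN.
Qed.

End stdn.

Section stdn_moments.
Context (R : realType).
Notation gam := (stdn R).
Implicit Types (f : R -> R) (s t z : R).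

Let measurable_expabs (c : R) : measurable_fun setT (fun z : R => expR (c * `|z|)).
Proof.
by apply: measurableT_comp => //; apply: measurable_funM.
Qed.

Let measurable_expM (c : R) : measurable_fun setT (fun z : R => expR (c * z)).
Proof. by apply: measurableT_comp => //; exact: measurable_funM. Qed.

Lemma stdn_mgf t : (\int[gam]_z (expR (t * z))%:E = (expR (t ^+ 2 / 2))%:E)%E.
Proof.
have := @ge0_Ex_shift R t (cst 1) (measurable_cst _) (fun=> ler01).
have -> : (\int[gam]_z (cst 1 (z + t) : R)%:E = 1)%E.
  rewrite (eq_integral (cst 1%E))// integral_cst//= mul1e; exact: probability_setT.
move=> H.
transitivity (\int[gam]_z ((expR (t ^+ 2 / 2))%:E *
    (cst 1 z * expR (t * z - t ^+ 2 / 2))%:E))%E.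
  by apply: eq_integral => x _; rewrite mul1r -EFinM -expRD addrC subrK.
rewrite ge0_integralZl//; first by rewrite -H mule1.
- apply/measurable_EFinP; apply: measurable_funM => //.
  by apply: measurableT_comp => //; apply: measurable_funD => //; exact: measurable_funM.
- by move=> x _; rewrite lee_fin mul1r expR_ge0.
Qed.

Lemma integrable_expabs (c : R) : gam.-integrable setT (fun z => (expR (c * `|z|))%:E).
Proof.
apply/integrableP; split.
  by apply/measurable_EFinP; exact: measurable_expabs.
apply: (@le_lt_trans _ _ (\int[gam]_z ((expR (c * z))%:E + (expR (- c * z))%:E))%E).
  apply: ge0_le_integral => //.
  - apply/measurable_EFinP; apply: measurableT_comp => //; exact: measurable_expabs.
  - by apply/measurable_EFinP/measurable_funD; exact: measurable_expM.
  move=> x _; rewrite -EFinD lee_fin /= ger0_norm ?expR_ge0//.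
  have [x0|x0] := lerP 0 x.
    by rewrite ger0_norm// lerDl expR_ge0.
  by rewrite ltr0_norm// mulrN mulNr lerDr expR_ge0.
rewrite ge0_integralD//.
- by rewrite !stdn_mgf -EFinD ltry.
- by apply/measurable_EFinP; exact: measurable_expM.
- by apply/measurable_EFinP; exact: measurable_expM.
Qed.

Lemma integrable_expabs_dom (c M : R) f : measurable_fun setT f ->
  (forall z, `|f z| <= M * expR (c * `|z|)) -> gam.-integrable setT (EFin \o f).
Proof.
move=> mf fM.
apply: (@le_integrable _ _ _ gam _ measurableT _ (fun z => (M * expR (c * `|z|))%:E)).
- exact/measurable_EFinP.
- by move=> x _; rewrite lee_fin (le_trans (fM x))// ler_norm.
- under eq_fun do rewrite EFinM.
  by apply: integrableZl => //; exact: integrable_expabs.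
Qed.

Let measurable_gexp t : measurable_fun setT (fun z : R => expR (t * z - t ^+ 2 / 2)).
Proof.
by apply: measurableT_comp => //; apply: measurable_funD => //; exact: measurable_funM.
Qed.

Let gexp_le t z : `|t| <= 1 -> expR (t * z - t ^+ 2 / 2) <= expR (1 * `|z|).
Proof.
move=> t1; rewrite ler_expR mul1r (@le_trans _ _ (t * z))//.
  by rewrite gerDl oppr_le0 divr_ge0// sqr_ge0.
by rewrite (le_trans (ler_norm _))// normrM ler_piMl.
Qed.

Let shift_le t z : `|t| <= 1 -> expR (1 * `|z + t|) <= expR 1 * expR (1 * `|z|).
Proof.
move=> t1; rewrite -expRD ler_expR !mul1r addrC (le_trans (ler_normD _ _))//.
by rewrite lerD2r.
Qed.

(** The signed case follows from [ge0_Ex_shift] for [f + h] and for [h], where [h] is the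
    exponential majorant of f. *)
Lemma Rintegral_stdn_shift (M : R) f t : `|t| <= 1 -> measurable_fun setT f ->
  (forall z, `|f z| <= M * expR (1 * `|z|)) ->
  \int[gam]_z f (z + t) = \int[gam]_z (f z * expR (t * z - t ^+ 2 / 2)).
Proof.
move=> t1 mf fM.
have M0 : 0 <= M.
  by have := fM 0; rewrite normr0 mulr0 expR0 mulr1; apply: le_trans; rewrite normr_ge0.
pose h z := M * expR (1 * `|z|); pose g z := f z + h z.
have mh : measurable_fun setT h by apply: measurable_funM => //; exact: measurable_expabs.
have mg : measurable_fun setT g by exact: measurable_funD.
have h0 z : 0 <= h z by rewrite mulr_ge0// expR_ge0.
have g0 z : 0 <= g z by have := fM z; rewrite ler_norml -/(h z) /g => /andP[]; lra.
have mt : measurable_fun setT (fun z : R => z + t) by exact: measurable_funD.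
have bnd (k : R -> R) : measurable_fun setT k -> (forall z, `|k z| <= h z) ->
    gam.-integrable setT (EFin \o (fun z => k (z + t))) /\
    gam.-integrable setT (EFin \o (fun z => k z * expR (t * z - t ^+ 2 / 2))).
  move=> mk kh; split.
    apply: (@integrable_expabs_dom 1 (M * expR 1)); first exact: measurableT_comp mk mt.
    move=> z; rewrite (le_trans (kh _))// /h -mulrA ler_wpM2l//; exact: shift_le.
  apply: (@integrable_expabs_dom 2 M); first exact: measurable_funM.
  move=> z; rewrite normrM (ger0_norm (expR_ge0 _)).
  rewrite (_ : 2 * `|z| = 1 * `|z| + 1 * `|z|); last by ring.
  by rewrite [X in _ <= _ * X]expRD mulrA ler_pM// ?normr_ge0 ?expR_ge0// gexp_le.
have [ih1 ih2] := bnd h mh (fun z => eq_ind_r (fun x => x <= h z) (lexx _) (ger0_norm (h0 z))).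
have [if1 if2] := bnd f mf fM.
have key (k : R -> R) : measurable_fun setT k -> (forall z, 0 <= k z) ->
    \int[gam]_z k (z + t) = \int[gam]_z (k z * expR (t * z - t ^+ 2 / 2)).
  by move=> mk k0; rewrite /Rintegral ge0_Ex_shift.
have := key g mg g0.
under [X in _ = X -> _]eq_Rintegral do rewrite /g mulrDl.
by rewrite /g !RintegralD// (key h)// => /addIr.
Qed.

(** Stein's identity without smoothness of f: the shift is moved to the weight exp(t z - t^2 / 2),
    whose derivative at t = 0 is z. Mean, variance and characteristic function are derived from
    it. *)
Lemma stein (M : R) f : measurable_fun setT f ->
  (forall z, `|f z| <= M * expR (1 * `|z|)) ->
  is_derive (0 : R) 1 (fun t => \int[gam]_z f (z + t)) (\int[gam]_z (z * f z)).
Proof.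
move=> mf fM.
have M0 : 0 <= M.
  by have := fM 0; rewrite normr0 mulr0 expR0 mulr1; apply: le_trans; rewrite normr_ge0.
pose F t := \int[gam]_z (f z * expR (t * z - t ^+ 2 / 2)).
(* One exponential bounds f, one bounds |z - t| for |t| <= 1, and one bounds the weight. *)
pose G z := M * expR (3 * `|z|).
have I0 : `]-1, 1[%classic (0 : R) by rewrite /= in_itv/= ltrN10 ltr01.
have int1 t : `]-1, 1[%classic t ->
    gam.-integrable setT (EFin \o (fun z => f z * expR (t * z - t ^+ 2 / 2))).
  move=> /=; rewrite in_itv/= -ltr_norml => /ltW t1.
  apply: (@integrable_expabs_dom 2 M); first exact: measurable_funM.
  move=> z; rewrite normrM (ger0_norm (expR_ge0 _)).
  rewrite (_ : 2 * `|z| = 1 * `|z| + 1 * `|z|); last by ring.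
  by rewrite [X in _ <= _ * X]expRD mulrA ler_pM// ?normr_ge0 ?expR_ge0// gexp_le.
have der t z : is_derive t 1 (fun t : R => f z * expR (t * z - t ^+ 2 / 2))
    (f z * ((z - t) * expR (t * z - t ^+ 2 / 2))).
  apply: is_derive_eq; rewrite /GRing.scale/=. by field.
have der1 t z : `]-1, 1[%classic t -> setT z ->
  derivable ((fun t z : R => f z * expR (t * z - t ^+ 2 / 2)) ^~ z) t 1.
  by move=> _ _; exact: ex_derive.
have val t z : partial1of2 (fun t z : R => f z * expR (t * z - t ^+ 2 / 2)) t z =
    f z * ((z - t) * expR (t * z - t ^+ 2 / 2)).
  by rewrite partial1of2E; exact: derive_val.
have G0 z : 0 <= G z by rewrite mulr_ge0// expR_ge0.
have iG : gam.-integrable setT (EFin \o G).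
  apply: (@integrable_expabs_dom 3 M).
    by apply: measurable_funM => //; exact: measurable_expabs.
  by move=> z; rewrite ger0_norm.
have Gub t z : `]-1, 1[%classic t -> setT z ->
    `|partial1of2 (fun t z : R => f z * expR (t * z - t ^+ 2 / 2)) t z| <= G z.
  move=> /=; rewrite in_itv/= -ltr_norml => /ltW t1 _.
  rewrite val !normrM (ger0_norm (expR_ge0 _)) /G.
  rewrite (_ : 3 * `|z| = 1 * `|z| + (`|z| + 1 * `|z|)); last by ring.
  rewrite [X in _ <= _ * X]expRD [leRHS]mulrA; apply: ler_pM => //.
  rewrite [leRHS]expRD; apply: ler_pM; rewrite ?expR_ge0 ?normr_ge0 ?gexp_le//.
  rewrite (le_trans (ler_normB _ _))// (le_trans _ (expR_ge1Dx _))// addrC lerD2r//.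
have dF := derivable_under_integral measurableT I0 int1 der1 G0 iG Gub.
have vF := differentiation_under_integral measurableT I0 int1 der1 G0 iG Gub.
have nF : {near (0 : R), F =1 (fun t => \int[gam]_z f (z + t))}.
  have : \forall t \near (0 : R), `|t| < 1.
    by apply: (@nbhs0_lt _ R^o 1); exact: ltr01.
  apply: filterS => t t1.
  by rewrite /F (@Rintegral_stdn_shift M)// ltW.
have dF' : is_derive (0 : R) 1 F (\int[gam]_z (z * f z)).
  apply: DeriveDef; first exact: dF.
  rewrite -derive1E vF; apply: eq_Rintegral => z _.
  by rewrite val subr0 mul0r expr0n/= mul0r subr0 expR0 mulr1 mulrC.
exact: near_eq_is_derive nF dF'.
Qed.

Lemma stdn_mean : \int[gam]_z z = 0.
Proof.
have := @stein 1 (cst 1) (measurable_cst _).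
rewrite (_ : (fun t => _) = cst 1); last first.
  by apply/funext => t; exact: Ex_cst.
move=> H; have {}H := H _.
have /H : forall z : R, `|cst 1 z| <= 1 * expR (1 * `|z|) :> R.
  by move=> z /=; rewrite normr1 !mul1r -expR0 ler_expR.
move=> /(@derive_val _ _ _ _ _ _ _); rewrite derive_cst => ->.
by apply: eq_Rintegral => z _; rewrite mulr1.
Qed.

Let abs_le_exp (z : R) : `|z| <= 1 * expR (1 * `|z|).
Proof. by rewrite !mul1r (le_trans _ (expR_ge1Dx _))// lerDr. Qed.

Lemma integrable_stdn_id : gam.-integrable setT (EFin \o idfun).
Proof.
apply: (@integrable_expabs_dom 1 1); first exact: measurable_id.
exact: abs_le_exp.
Qed.

Lemma stdn_var : \int[gam]_z (z ^+ 2) = 1.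
Proof.
have := @stein 1 idfun (@measurable_id _ _ _) abs_le_exp.
rewrite (_ : (fun t => _) = idfun); last first.
  apply/funext => t /=; rewrite RintegralD//; last 2 first.
    exact: integrable_stdn_id.
    exact: (bmeas_integrable gam (bmeas_cst _ t)).
  by rewrite stdn_mean add0r; exact: Ex_cst.
move=> /(@derive_val _ _ _ _ _ _ _); rewrite derive_id => ->.
by apply: eq_Rintegral => z _; rewrite expr2.
Qed.

Lemma Ex_stdn_opp f : bmeas f -> Ex gam (fun z => f (- z)) = Ex gam f.
Proof.
move=> bf; have [mf [M fM]] := bf.
have bfN : bmeas (fun z : R => f (- z)).
  by split; [exact: measurableT_comp mf _|exists M].
suff : Ex gam (fun z => f (- z) + M) = Ex gam (fun z => f z + M).
  by rewrite !ExD ?Ex_cst//; [exact: addIr|exact: bmeas_cst..].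
rewrite /Ex /Rintegral (@ge0_Ex_opp R (fun z => f z + M))//.
  exact: measurable_funD.
by move=> x; have := fM x; rewrite ler_norml => /andP[]; lra.
Qed.

Lemma stdn_sin s : Ex gam (fun z => sin (s * z)) = 0.
Proof.
have := @Ex_stdn_opp (fun z => sin (s * z)).
rewrite (_ : (fun z => sin (s * - z)) = (fun z => -1 * sin (s * z))); last first.
  by apply/funext => z; rewrite mulrN sinN mulN1r.
have b : bmeas (fun z : R => sin (s * z)) by apply: bmeas_sin; exact: measurable_funM.
by rewrite ExZ// => /(_ b); lra.
Qed.

(** The left side h(s) solves h'(s) = - s h(s): [stein] for the sine evaluates the integral of z sin
    (s z) that differentiation produces. Thus h(s) exp(s^2 / 2) is constant, with value 1 at 0. *)
Lemma stdn_cos s : Ex gam (fun z => cos (s * z)) = expR (- (s ^+ 2 / 2)).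
Proof.
pose h s := Ex gam (fun z => cos (s * z)).
have mM (c : R) : measurable_fun setT (fun z : R => c * z) by exact: measurable_funM.
have bc c : bmeas (fun z : R => cos (c * z)) by exact: bmeas_cos.
have bs c : bmeas (fun z : R => sin (c * z)) by exact: bmeas_sin.
have step1 c : \int[gam]_z (z * sin (c * z)) = c * h c.
  have := @stein 1 (fun z => sin (c * z)) (bs c).1.
  rewrite (_ : (fun t => _) = (fun t => sin (c * t) * h c)); last first.
    apply/funext => t; transitivity
      (Ex gam (fun z => cos (c * t) * sin (c * z) + sin (c * t) * cos (c * z))).
      by apply: eq_Rintegral => z _; rewrite mulrDr sinD; ring.
    rewrite ExD ?ExZ; [by rewrite stdn_sin mulr0 add0r|exact: bc|exact: bs|
      exact: bmeasZ (bs c)|exact: bmeasZ (bc c)].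
  move=> H; have {}H := H _.
  have /H : forall z : R, `|sin (c * z)| <= 1 * expR (1 * `|z|).
    move=> z; rewrite (le_trans (sin_max _))// !mul1r -[leLHS]expR0 ler_expR//.
  move=> /(@derive_val _ _ _ _ _ _ _) <-.
  have D : is_derive (0 : R) 1 (fun t => sin (c * t) * h c) (c * h c).
    apply: is_derive_eq; rewrite /GRing.scale/= ?mulr0 ?cos0; ring.
  exact: derive_val.
have step2 (c : R) : is_derive c 1 h (- (c * h c)).
  have I0 : `]c - 1, c + 1[%classic c.
    by rewrite /= in_itv/=; apply/andP; split; lra.
  have int1 t : `]c - 1, c + 1[%classic t ->
      gam.-integrable setT (EFin \o (fun z : R => cos (t * z))).
    by move=> _; exact: (bmeas_integrable gam (bc t)).
  have der t z : is_derive t 1 (fun t : R => cos (t * z)) (- (z * sin (t * z))).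
    apply: is_derive_eq; rewrite /GRing.scale/=; ring.
  have der1 t z : `]c - 1, c + 1[%classic t -> setT z ->
      derivable ((fun t z : R => cos (t * z)) ^~ z) t 1.
    by move=> _ _; exact: ex_derive.
  have val t z : partial1of2 (fun t z : R => cos (t * z)) t z = - (z * sin (t * z)).
    by rewrite partial1of2E; exact: derive_val.
  have G0 (z : R) : 0 <= `|z| by [].
  have iG : gam.-integrable setT (EFin \o (fun z => `|z|)).
    apply: (@integrable_expabs_dom 1 1); first exact: measurableT_comp.
    by move=> z; rewrite normr_id.
  have Gub t z : `]c - 1, c + 1[%classic t -> setT z ->
      `|partial1of2 (fun t z : R => cos (t * z)) t z| <= `|z|.
    by move=> _ _; rewrite val normrN normrM ler_piMr// sin_max.
  apply: DeriveDef.
    exact: (derivable_under_integral measurableT I0 int1 der1 G0 iG Gub).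
  rewrite -derive1E (differentiation_under_integral measurableT I0 int1 der1 G0 iG Gub).
  under eq_Rintegral do rewrite val -mulN1r.
  rewrite RintegralZl//; first by rewrite step1 mulN1r.
  apply: (@integrable_expabs_dom 1 1); first by apply: measurable_funM => //; exact: (bs c).1.
  by move=> z; rewrite (le_trans _ (abs_le_exp z))// normrM ler_piMr// sin_max.
pose g s := h s * expR (s ^+ 2 / 2).
have dg (c : R) : is_derive c 1 g 0.
  have D := step2 c; apply: is_derive_eq; rewrite /GRing.scale/=; by field.
have := is_derive_0_is_cst s 0 dg.
rewrite /g /h expr0n/= mul0r expR0 mulr1.
rewrite (_ : (fun z => cos (0 * z)) = cst 1); last first.
  by apply/funext => z; rewrite mul0r cos0.
rewrite Ex_cst => H; rewrite expRN.
by apply: (mulIf (lt0r_neq0 (expR_gt0 (s ^+ 2 / 2)))); rewrite H mulVf// gt_eqF ?expR_gt0.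
Qed.

End stdn_moments.

(** * Characteristic functions and boxes *)

Section standard_normal_df.
Context (R : realType).
Notation gam := (stdn R).
Notation Phi := (@standard_normal_df R).

Let measurable_le (x : R) : measurable [set z : measurableTypeR R | z <= x].
Proof. by apply: (@measurable_le_cst R _ (measurableTypeR R) idfun x); exact: measurable_id. Qed.

Let mid : measurable_fun setT (idfun : measurableTypeR R -> R).
Proof. exact: measurable_id. Qed.

Let X : {RV gam >-> R} := HB.pack (idfun : measurableTypeR R -> R)
  (isMeasurableFun.Build _ _ _ _ _ mid).

Lemma standard_normal_dfE x : Phi x = Ex gam (fun z => (z <= x)%R%:R).
Proof.
rewrite Ex_bool//; congr (fine (gam _)).
Qed.

Lemma distribution_function_normal : distribution_function Phi.
Proof.
have cdfE x : cdf X x = (Phi x)%:E by rewrite /standard_normal_df fineK ?fin_num_measure.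
split.
- by move=> x y xy; rewrite -lee_fin -!cdfE; exact: cdf_nondecreasing.
- move=> x; have := @cdf_right_continuous _ _ _ _ X x.
  by rewrite cdfE => /fine_cvgP[_]; apply: cvg_trans.
- have := @cvg_cdfNy0 _ _ _ _ X.
  by move/fine_cvgP => [_]; apply: cvg_trans.
- have := @cvg_cdfy1 _ _ _ _ X.
  by move/fine_cvgP => [_]; apply: cvg_trans.
Qed.

Lemma standard_normal_df_ge0 x : 0 <= Phi x.
Proof. by rewrite fine_ge0. Qed.

Lemma standard_normal_df_le1 x : Phi x <= 1.
Proof.
rewrite standard_normal_dfE -[leRHS](Ex_cst gam); apply: le_Ex.
- exact: bmeas_bool.
- exact: bmeas_cst.
- by move=> z; case: (z <= x)%R.
Qed.

Lemma bmeas_standard_normal_df : bmeas Phi.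
Proof.
split; last first.
  exists 1 => x; rewrite ger0_norm ?standard_normal_df_ge0//.
  exact: standard_normal_df_le1.
have := @cdf_measurable _ _ _ _ X.
rewrite (_ : cdf X = EFin \o Phi); last first.
  by apply/funext => x; rewrite /= /standard_normal_df fineK ?fin_num_measure.
by move/measurable_EFinP.
Qed.

(** Phi(a (u - y)) is the indicator of y <= u smoothed by a Gaussian kernel of width 1 / a, hence a
    mixture of bumps centred at the points x <= u. *)
Lemma standard_normal_df_scale (a u y : R) : 0 < a ->
  ((Phi (a * (u - y)))%:E =
   \int[lebesgue_measure]_x
     (a * normal_peak 1 * ((x <= u)%R%:R * expR (- ((a * (y - x)) ^+ 2 / 2))))%:E)%E.
Proof.
move=> a0; rewrite standard_normal_dfE EFin_Ex; last exact: bmeas_bool.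
have mI v : measurable_fun setT (fun z : R => (z <= v)%R%:R : R).
  by apply: measurable_natr_bool; exact: measurable_le.
rewrite (ge0_integral_stdn (mI _))//.
rewrite (ge0_integral_affine (- (a * y)) (lt0r_neq0 a0)); last 2 first.
- by apply: measurable_funM; [exact: mI|exact: measurable_gpdf].
- by move=> x; apply: mulr_ge0; [exact: ler0n|exact: (@gpdf_ge0 R)].
rewrite gtr0_norm// -ge0_integralZl//; last 3 first.
- apply/measurable_EFinP/measurable_funM.
    apply: measurable_natr_bool.
    apply: (@measurable_le_cst R _ _ (fun x : R => a * x + - (a * y))).
    by apply: measurable_funD => //; exact: measurable_funM.
  apply: measurableT_comp; first exact: measurable_gpdf.
  by apply: measurable_funD => //; exact: measurable_funM.
- by move=> x _; rewrite lee_fin; apply: mulr_ge0; [exact: ler0n|exact: (@gpdf_ge0 R)].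
- by rewrite lee_fin ltW.
apply: eq_integral => x _; rewrite -EFinM -mulrA; congr (a * _)%:E.
rewrite gpdfE mulrCA -mulrBr ler_pM2l// lerD2r; congr (_ * (_ * expR _)).
by field.
Qed.

(** The scale n^2 beats the shift 1 / n: the argument is at least n for y <= u, even at y = u, and
    tends to -oo for y > u. *)
Lemma cvg_smooth_indicator (u y : R) :
  Phi (n.+1%:R ^+ 2 * (u + n.+1%:R^-1 - y)) @[n --> \oo] --> ((y <= u)%R%:R : R).
Proof.
have [homoPhi _ PhiNy Phiy] := distribution_function_normal.
have ny : ((n.+1%:R : R) @[n --> \oo] --> +oo).
  apply/cvgryPge => A; near=> n; apply: (@le_trans _ _ n%:R); last by rewrite ler_nat.
  by near: n; exact: nbhs_infty_ger.
have nny : ((- n.+1%:R : R) @[n --> \oo] --> -oo) 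
  by apply/cvgrNyPle => A; near=> n; rewrite lerNl; near: n; exact: cvgry_ge.
have [yu|uy] := leP y u.
  apply: (@squeeze_cvgr _ _ _ _ (fun n => Phi n.+1%:R) (cst 1)).
  - near=> n; rewrite standard_normal_df_le1 andbT; apply: homoPhi.
    rewrite expr2 -mulrA ler_peMr// -(@ler_pM2l _ n.+1%:R^-1)// mulr1 mulKf ?pnatr_eq0//.
    by rewrite lerBrDl lerD2r.
  - exact: cvg_comp ny Phiy.
  - exact: cvg_cst.
apply: (@squeeze_cvgr _ _ _ _ (cst 0) (fun n => Phi (- n.+1%:R))).
- near=> n; rewrite standard_normal_df_ge0/=; apply: homoPhi.
  rewrite expr2 -mulrA -mulrN1 ler_pM2l// -(@ler_pM2l _ n.+1%:R^-1)// mulKf ?pnatr_eq0//.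
  rewrite mulrN1 lerBlDr -lerBlDl opprK.
  have n2 : 2 / (y - u) <= n.+1%:R by near: n; apply: cvgry_ge ny _.
  rewrite ler_pdivrMr ?subr_gt0// in n2.
  rewrite -(@ler_pM2l _ n.+1%:R)// mulrDr mulrDr mulfV ?pnatr_eq0//; lra.
- exact: cvg_cst.
- exact: cvg_comp nny PhiNy.
Unshelve. all: end_near. Qed.

End standard_normal_df.

(** * Uniqueness of laws from trigonometric integrals *)

Section fourier_uniqueness.
Context (R : realType).
Notation gam := (stdn R).
Notation Phi := (@standard_normal_df R).

Section one_space.
Context d (T : measurableType d) (P : probability T R).
Variables (C Y : T -> R).
Hypotheses (bC : bmeas C) (mY : measurable_fun setT Y).

Let bcos t : bmeas (fun w => C w * cos (t * Y w)).
Proof. by apply: bmeasM => //; apply: bmeas_cos; exact: measurable_funM. Qed.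

Let bsin t : bmeas (fun w => C w * sin (t * Y w)).
Proof. by apply: bmeasM => //; apply: bmeas_sin; exact: measurable_funM. Qed.

Let measurable_bump a x :
  measurable_fun setT (fun w => expR (- ((a * (Y w - x)) ^+ 2 / 2))).
Proof.
apply: measurableT_comp => //; apply: measurableT_comp => //.
apply: measurable_funM => //; apply: measurable_funX.
by apply: measurable_funM => //; exact: measurable_funB.
Qed.

Let bump a x : bmeas (fun w => C w * expR (- ((a * (Y w - x)) ^+ 2 / 2))).
Proof.
apply: bmeasM => //; split; first exact: measurable_bump.
exists 1 => w; rewrite ger0_norm ?expR_ge0// -[leRHS]expR0 ler_expR.
by rewrite oppr_le0 divr_ge0// sqr_ge0.
Qed.

(* A Gaussian bump is a mixture of cosines by [stdn_cos], so the trigonometric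
   integrals of C determine its integrals against bumps. *)
Lemma Ex_bump a x : Ex P (fun w => C w * expR (- ((a * (Y w - x)) ^+ 2 / 2))) =
  Ex gam (fun z => cos (z * a * x) * Ex P (fun w => C w * cos (z * a * Y w)) +
                   sin (z * a * x) * Ex P (fun w => C w * sin (z * a * Y w))).
Proof.
pose f (p : T * measurableTypeR R) := C p.1 * cos (p.2 * (a * (Y p.1 - x))).
have bf : bmeas f.
  apply: bmeasM.
    have [mC [M CM]] := bC; split; last by exists M.
    exact: measurableT_comp mC _.
  apply: bmeas_cos; apply: measurable_funM => //.
  apply: measurable_funM => //; apply: measurable_funB => //.
  exact: measurableT_comp mY _.
transitivity (Ex (P \x gam)%E f).
  rewrite Ex_prod1//; congr Ex; apply/funext => w.
  rewrite /f/= ExZ; last by apply: bmeas_cos; exact: measurable_funM.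
  rewrite -stdn_cos; congr (_ * Ex _ _); apply/funext => z.
  by rewrite [z * _]mulrC.
rewrite Ex_prod2//; congr Ex; apply/funext => z.
rewrite -!ExZ// -ExD; [|exact: bmeasZ..].
congr Ex; apply/funext => w; rewrite /f/= mulrA mulrBr cosB; ring.
Qed.

Hypothesis C0 : forall w, 0 <= C w.

(** Tonelli's theorem applied to [standard_normal_df_scale]; [C0] makes the integrand
    non-negative. *)
Lemma Ex_smooth (a u : R) : 0 < a ->
  ((Ex P (fun w => C w * Phi (a * (u - Y w))))%:E =
  \int[lebesgue_measure]_x
     (a * normal_peak 1 * ((x <= u)%R%:R *
       Ex P (fun w => C w * expR (- ((a * (Y w - x)) ^+ 2 / 2)))))%:E)%E.
Proof.
move=> a0.
have mx : measurable_fun setT (fun x : measurableTypeR R => (x <= u)%R%:R : R).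
  by apply: measurable_natr_bool; apply: (@measurable_le_cst R _ (measurableTypeR R) idfun u); exact: measurable_id.
have p0 : 0 <= a * normal_peak 1 by rewrite mulr_ge0 ?normal_peak_ge0// ltW.
pose f (p : T * measurableTypeR R) : R := C p.1 *
  (a * normal_peak 1 * ((p.2 <= u)%R%:R * expR (- ((a * (Y p.1 - p.2)) ^+ 2 / 2)))).
have f0 p : 0 <= f p by rewrite !mulr_ge0 ?expR_ge0 ?normal_peak_ge0// ltW.
have mf : measurable_fun setT f.
  apply: measurable_funM; first exact: measurableT_comp bC.1 _.
  apply: measurable_funM => //; apply: measurable_funM.
    exact: (measurableT_comp mx (@measurable_snd _ _ T (measurableTypeR R))).
  apply: measurableT_comp => //; apply: measurableT_comp => //.
  apply: measurable_funM => //; apply: measurable_funX.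
  apply: measurable_funM => //; apply: measurable_funB => //.
  exact: measurableT_comp mY _.
have bPhi : bmeas (fun w => C w * Phi (a * (u - Y w))).
  apply: bmeasM => //; have [mP [M PM]] := @bmeas_standard_normal_df R.
  split; last by exists M.
  apply: measurableT_comp mP _; apply: measurable_funM => //.
  exact: measurable_funB.
transitivity (\int[P]_w \int[lebesgue_measure]_x (f (w, x))%:E)%E.
  rewrite EFin_Ex//; apply: eq_integral => w _.
  rewrite EFinM standard_normal_df_scale// -ge0_integralZl//.
  - apply/measurable_EFinP; apply: measurable_funM => //; apply: measurable_funM => //.
    apply: measurableT_comp => //; apply: measurableT_comp => //.
    apply: measurable_funM => //; apply: measurable_funX.
    by apply: measurable_funM => //; exact: measurable_funB.
  - by move=> x _; rewrite lee_fin !mulr_ge0 ?expR_ge0 ?normal_peak_ge0// ltW.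
  - by rewrite lee_fin.
have mEf : measurable_fun setT (EFin \o f) by apply/measurable_EFinP.
rewrite (@fubini_tonelli _ _ _ _ _ P lebesgue_measure (EFin \o f) mEf)//.
apply: eq_integral => x _; rewrite -ExZ// -ExZ; last exact: bmeasZ.
rewrite EFin_Ex; last by do 2 apply: bmeasZ.
by apply: eq_integral => w _; rewrite /f/=; congr (_%:E); ring.
Qed.

Lemma cvg_Ex_smooth (u : R) :
  Ex P (fun w => C w * Phi (n.+1%:R ^+ 2 * (u + n.+1%:R^-1 - Y w))) @[n --> \oo] -->
  Ex P (fun w => C w * (Y w <= u)%R%:R).
Proof.
have [M CM] := bC.2.
apply: (@cvg_Ex _ _ _ P _ _ M).
- move=> n; apply: measurable_funM; first exact: bC.1.
  apply: measurableT_comp (@bmeas_standard_normal_df R).1 _.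
  by apply: measurable_funM => //; exact: measurable_funB.
- move=> n x; rewrite normrM (le_trans _ (CM x))// ler_piMr//.
  by rewrite ger0_norm ?standard_normal_df_ge0 ?standard_normal_df_le1.
- by move=> w; apply: cvgM; [exact: cvg_cst|exact: cvg_smooth_indicator].
Qed.

End one_space.

Context d1 (T1 : measurableType d1) (P1 : probability T1 R)
  d2 (T2 : measurableType d2) (P2 : probability T2 R).

(** Trigonometric integrals determine the integrals of bumps, these determine the smoothed
    indicators, and these converge to the indicator. The weights [C1] and [C2] serve to carry the
    constraints of a box that are already treated. *)
Lemma fourier_uniqueness (C1 Y1 : T1 -> R) (C2 Y2 : T2 -> R) :
  bmeas C1 -> bmeas C2 -> (forall w, 0 <= C1 w) -> (forall w, 0 <= C2 w) ->
  measurable_fun setT Y1 -> measurable_fun setT Y2 ->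
  (forall t, Ex P1 (fun w => C1 w * cos (t * Y1 w)) =
             Ex P2 (fun w => C2 w * cos (t * Y2 w))) ->
  (forall t, Ex P1 (fun w => C1 w * sin (t * Y1 w)) =
             Ex P2 (fun w => C2 w * sin (t * Y2 w))) ->
  forall u, Ex P1 (fun w => C1 w * (Y1 w <= u)%R%:R) =
            Ex P2 (fun w => C2 w * (Y2 w <= u)%R%:R).
Proof.
move=> bC1 bC2 C10 C20 mY1 mY2 hc hs u.
have c1 := cvg_Ex_smooth (P := P1) bC1 mY1 (u := u).
have c2 := cvg_Ex_smooth (P := P2) bC2 mY2 (u := u).
rewrite -(cvg_lim (@Rhausdorff R) c1) -(cvg_lim (@Rhausdorff R) c2).
congr (limn _).
apply/funext => n; apply: EFin_inj.
rewrite !Ex_smooth// ?exprn_gt0//; apply: eq_integral => x _.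
rewrite !Ex_bump//; congr (_ * (_ * Ex _ _)%R)%:E.
by apply/funext => z; rewrite hc hs.
Qed.

End fourier_uniqueness.

Definition lin (R : realType) (T I : Type) (X : I -> T -> R) (s : seq (R * I)) (w : T) : R :=
  \sum_(p <- s) p.1 * X p.2 w.

Definition box (R : realType) (T I : Type) (X : I -> T -> R) (l : seq (I * R)) (w : T) : bool :=
  all (fun p => X p.1 w <= p.2) l.

(** * A Cramer-Wold theorem for boxes *)

Section cramer_wold.
Context (R : realType) (I : Type).

Lemma measurable_lin d (T : measurableType d) (X : I -> T -> R) s :
  (forall k, measurable_fun setT (X k)) -> measurable_fun setT (lin X s).
Proof.
move=> mX; elim: s => [|p s IH].
  rewrite (_ : lin X [::] = cst 0); first exact: measurable_cst.
  by apply/funext => w; rewrite /lin big_nil.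
rewrite (_ : lin X (p :: s) = fun w => p.1 * X p.2 w + lin X s w).
  by apply: measurable_funD => //; exact: measurable_funM.
by apply/funext => w; rewrite /lin big_cons.
Qed.

Lemma lin_nil (T : Type) (X : I -> T -> R) w : lin X [::] w = 0.
Proof. by rewrite /lin big_nil. Qed.

Lemma lin_cons (T : Type) (X : I -> T -> R) p s w :
  lin X (p :: s) w = p.1 * X p.2 w + lin X s w.
Proof. by rewrite /lin big_cons. Qed.

Lemma measurable_box d (T : measurableType d) (X : I -> T -> R) l :
  (forall k, measurable_fun setT (X k)) -> measurable [set w | box X l w].
Proof.
move=> mX; elim: l => [|p l IH].
  by rewrite (_ : mkset _ = setT)//; apply/seteqP; split.
rewrite (_ : mkset _ = [set w | X p.1 w <= p.2] `&` [set w | box X l w]).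
  by apply: measurableI => //; exact: measurable_le_cst.
by apply/seteqP; split => w /= => [/andP[]|[H1 H2]]//; apply/andP.
Qed.

(* The weight 1_box (1 + cos) is non-negative, as [fourier_uniqueness] requires, and
   its trigonometric integrals are combinations of integrals of 1_box cos. *)
Lemma Ex_box_cos2 d (T : measurableType d) (P : probability T R) (X : I -> T -> R) l s th k t :
  (forall k, measurable_fun setT (X k)) ->
  let K s th := Ex P (fun w => (box X l w)%:R * cos (lin X s w + th)) in
  Ex P (fun w => (box X l w)%:R * (1 + cos (lin X s w + th)) * cos (t * X k w)) =
    K [:: (t, k)] 0 + (2^-1 * K ((t, k) :: s) th + 2^-1 * K ((- t, k) :: s) th) /\
  Ex P (fun w => (box X l w)%:R * (1 + cos (lin X s w + th)) * sin (t * X k w)) =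
    K [:: (t, k)] (- (pi / 2)) + (2^-1 * K ((t, k) :: s) (th - pi / 2) +
       2^-1 * K ((- t, k) :: s) (th + pi / 2)).
Proof.
move=> mX K.
have bK s' th' : bmeas (fun w => (box X l w)%:R * cos (lin X s' w + th')).
  apply: bmeasM; first by apply: bmeas_bool; exact: measurable_box.
  by apply: bmeas_cos; apply: measurable_funD => //; exact: measurable_lin.
split.
  rewrite /K -!ExZ// -ExD; [|exact: bmeasZ..].
  rewrite -ExD//; last by apply: bmeasD; exact: bmeasZ.
  congr Ex; apply/funext => w; rewrite !lin_cons /= lin_nil !addr0 mulNr -!addrA.
  rewrite (cosD (t * _)) (cosD (- _)) cosN sinN; by field.
rewrite /K -!ExZ// -ExD; [|exact: bmeasZ..].
rewrite -ExD//; last by apply: bmeasD; exact: bmeasZ.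
congr Ex; apply/funext => w; rewrite !lin_cons /= lin_nil !addr0 mulNr.
rewrite !addrA !cosBpihalf cosDpihalf -!addrA.
rewrite (sinD (t * _)) (sinD (- _)) cosN sinN; by field.
Qed.

Context d1 (T1 : measurableType d1) (P1 : probability T1 R)
  d2 (T2 : measurableType d2) (P2 : probability T2 R).

Theorem cramer_wold_box (X1 : I -> T1 -> R) (X2 : I -> T2 -> R) :
  (forall k, measurable_fun setT (X1 k)) -> (forall k, measurable_fun setT (X2 k)) ->
  (forall s th, Ex P1 (fun w => cos (lin X1 s w + th)) =
                Ex P2 (fun w => cos (lin X2 s w + th))) ->
  forall l, Ex P1 (fun w => (box X1 l w)%:R) = Ex P2 (fun w => (box X2 l w)%:R).
Proof.
move=> m1 m2 H l.
(* An arbitrary cosine factor is kept during the induction on the constraints: a new constraint on X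
   k requires the integrals of the previous weight against all cosines and sines of t X k. *)
suff : forall s th, Ex P1 (fun w => (box X1 l w)%:R * cos (lin X1 s w + th)) =
                    Ex P2 (fun w => (box X2 l w)%:R * cos (lin X2 s w + th)).
  move=> /(_ [::] 0).
  by congr (_ = _); congr Ex; apply/funext => w; rewrite lin_nil addr0 cos0 mulr1.
elim: l => [|[k u] l IH] s th.
  have e d (T : measurableType d) (P : probability T R) (X : I -> T -> R) :
    Ex P (fun w => (box X [::] w)%:R * cos (lin X s w + th)) =
    Ex P (fun w => cos (lin X s w + th)) by congr Ex; apply/funext => w; rewrite mul1r.
  by rewrite !e.
have bb1 : bmeas (fun w => (box X1 l w)%:R : R) by apply: bmeas_bool; exact: measurable_box.
have bb2 : bmeas (fun w => (box X2 l w)%:R : R) by apply: bmeas_bool; exact: measurable_box.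
have bc1 s' th' : bmeas (fun w => cos (lin X1 s' w + th')).
  by apply: bmeas_cos; apply: measurable_funD => //; exact: measurable_lin.
have bc2 s' th' : bmeas (fun w => cos (lin X2 s' w + th')).
  by apply: bmeas_cos; apply: measurable_funD => //; exact: measurable_lin.
have main s' th' : Ex P1 (fun w => (box X1 l w)%:R * (1 + cos (lin X1 s' w + th')) *
       (X1 k w <= u)%R%:R) =
    Ex P2 (fun w => (box X2 l w)%:R * (1 + cos (lin X2 s' w + th')) * (X2 k w <= u)%R%:R).
  apply: fourier_uniqueness => //.
  - by apply: bmeasM => //; apply: bmeasD => //; exact: bmeas_cst.
  - by apply: bmeasM => //; apply: bmeasD => //; exact: bmeas_cst.
  - move=> t; have [-> _] := Ex_box_cos2 P1 l s' th' k t m1.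
    by have [-> _] := Ex_box_cos2 P2 l s' th' k t m2; rewrite !IH.
  - move=> t; have [_ ->] := Ex_box_cos2 P1 l s' th' k t m1.
    by have [_ ->] := Ex_box_cos2 P2 l s' th' k t m2; rewrite !IH.
(* For the empty combination the factor 1 + cos is 2, so half of that integral removes the summand 1
   of the weight. *)
have split1 d (T : measurableType d) (P : probability T R) (X : I -> T -> R) :
    (forall k, measurable_fun setT (X k)) ->
    Ex P (fun w => (box X ((k, u) :: l) w)%:R * cos (lin X s w + th)) =
    Ex P (fun w => (box X l w)%:R * (1 + cos (lin X s w + th)) * (X k w <= u)%R%:R) -
    2^-1 * Ex P (fun w => (box X l w)%:R * (1 + cos (lin X [::] w + 0)) * (X k w <= u)%R%:R).
  move=> mX.
  have bC s' th' : bmeas (fun w => (box X l w)%:R * (1 + cos (lin X s' w + th')) *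
      (X k w <= u)%R%:R).
    apply: bmeasM; last by apply: bmeas_bool; exact: measurable_le_cst.
    apply: bmeasM; first by apply: bmeas_bool; exact: measurable_box.
    apply: bmeasD; first exact: bmeas_cst.
    by apply: bmeas_cos; apply: measurable_funD => //; exact: measurable_lin.
  rewrite -ExZ// -ExB//; last exact: bmeasZ.
  congr Ex; apply/funext => w; rewrite /= -mulnb natrM lin_nil addr0 cos0.
  by field.
by rewrite !split1// !main.
Qed.

End cramer_wold.

(** * Maxima of non-negatively correlated Gaussian families *)

Section same_law.
Context (R : realType) d1 (T1 : measurableType d1) (P1 : probability T1 R)
  d2 (T2 : measurableType d2) (P2 : probability T2 R).
Variables (Y1 : T1 -> R) (Y2 : T2 -> R).
Hypotheses (mY1 : measurable_fun setT Y1) (mY2 : measurable_fun setT Y2).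
Hypothesis law : forall B : set R, measurable B -> P1 (Y1 @^-1` B) = P2 (Y2 @^-1` B).

Lemma ge0_integral_same_law (f : R -> \bar R) : measurable_fun setT f ->
  (forall x, (0 <= f x)%E) -> (\int[P1]_w f (Y1 w) = \int[P2]_w f (Y2 w))%E.
Proof.
move=> mf f0.
have e1 := ge0_integral_pushforward mY1 P1 measurableT mf (fun x _ => f0 x).
have e2 := ge0_integral_pushforward mY2 P2 measurableT mf (fun x _ => f0 x).
rewrite !preimage_setT in e1 e2; rewrite -[LHS]e1 -[RHS]e2.
by apply: eq_measure_integral => B mB _; exact: law.
Qed.

Lemma integrable_same_law (f : R -> R) : measurable_fun setT f ->
  P1.-integrable setT (EFin \o (f \o Y1)) -> P2.-integrable setT (EFin \o (f \o Y2)).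
Proof.
move=> mf /integrableP[_ fi]; apply/integrableP; split.
  by apply/measurable_EFinP; exact: measurableT_comp.
rewrite -(@ge0_integral_same_law (fun x => `|(f x)%:E|%E))//.
by apply: measurableT_comp => //; exact/measurable_EFinP.
Qed.

Lemma Rintegral_same_law (f : R -> R) : measurable_fun setT f ->
  P1.-integrable setT (EFin \o (f \o Y1)) ->
  \int[P1]_w f (Y1 w) = \int[P2]_w f (Y2 w).
Proof.
move=> mf if1; have if2 := integrable_same_law mf if1.
have mEf : measurable_fun setT (EFin \o f) by exact/measurable_EFinP.
have e1 := integral_pushforward mY1 mEf if1 measurableT.
have e2 := integral_pushforward mY2 mEf if2 measurableT.
rewrite !preimage_setT in e1 e2.
rewrite /Rintegral; congr fine.
rewrite -[LHS]e1 -[RHS]e2.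
by apply: eq_measure_integral => B mB _; exact: law.
Qed.

Lemma Ex_same_law (f : R -> R) : bmeas f ->
  Ex P1 (fun w => f (Y1 w)) = Ex P2 (fun w => f (Y2 w)).
Proof.
move=> [mf [M fM]]; apply: Rintegral_same_law => //.
apply: bmeas_integrable; split; first exact: measurableT_comp.
by exists M => x; exact: fM.
Qed.

End same_law.

Definition gvar (R : realType) (I : Type) (c : I -> I -> R) (s : seq (R * I)) : R :=
  \sum_(p <- s) \sum_(q <- s) p.1 * q.1 * c p.2 q.2.

(** The law is the image of the standard normal law under multiplication by the standard deviation,
    a form that includes variance 0. *)
Definition gaussian_family (R : realType) d (T : measurableType d) (P : probability T R)
    (I : Type) (X : I -> T -> R) (c : I -> I -> R) : Prop :=
  [/\ forall k, measurable_fun setT (X k), forall k j, c k j = c j k &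
    forall s, 0 <= gvar c s /\ forall B : set R, measurable B ->
      P [set w | B (lin X s w)] = stdn R [set z : R | B (Num.sqrt (gvar c s) * z)]].

Section gvar.
Context (R : realType) (I : Type) (c : I -> I -> R).
Hypothesis csym : forall k j, c k j = c j k.

Lemma gvar_cons a k s :
  gvar c ((a, k) :: s) = a ^+ 2 * c k k + 2 * a * (\sum_(p <- s) p.1 * c p.2 k) + gvar c s.
Proof.
rewrite /gvar !big_cons/=.
under [X in _ + X = _]eq_bigr do rewrite big_cons/=.
rewrite big_split/= -expr2 !addrA; congr (_ + _); rewrite -addrA; congr (_ + _).
rewrite mulr2n mulrDl mul1r mulrDl !mulr_sumr; congr (_ + _); apply: eq_bigr => p _.
- by rewrite csym mulrA.
- by rewrite mulrA [p.1 * a]mulrC.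
Qed.

Lemma gvar_nil : gvar c [::] = 0.
Proof. by rewrite /gvar big_nil. Qed.

Lemma gvar1 a k : gvar c [:: (a, k)] = a ^+ 2 * c k k.
Proof. by rewrite gvar_cons big_nil gvar_nil mulr0 !addr0. Qed.

Lemma gvar2 a k b j : gvar c [:: (a, k); (b, j)] =
  a ^+ 2 * c k k + 2 * a * b * c k j + b ^+ 2 * c j j.
Proof. by rewrite gvar_cons gvar1 big_cons big_nil addr0/= csym !mulrA. Qed.

End gvar.

Section gaussian_family.
Context (R : realType) d (T : measurableType d) (P : probability T R)
  (I : Type) (X : I -> T -> R) (c : I -> I -> R).
Hypothesis gX : gaussian_family P X c.
Notation gam := (stdn R).
Notation Phi := (@standard_normal_df R).

Let mX k : measurable_fun setT (X k). Proof. by case: gX. Qed.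
Let csym k j : c k j = c j k. Proof. by case: gX. Qed.
Let mlin s : measurable_fun setT (lin X s). Proof. exact: measurable_lin. Qed.

Lemma Ex_lin s (f : R -> R) : bmeas f ->
  Ex P (fun w => f (lin X s w)) = Ex gam (fun z => f (Num.sqrt (gvar c s) * z)).
Proof.
move=> bf; have [_ _ /(_ s)[_ H]] := gX.
apply: (@Ex_same_law R _ _ P _ (measurableTypeR R) gam (lin X s)
  (fun z : R => Num.sqrt (gvar c s) * z)) => //.
exact: measurable_funM.
Qed.

Lemma Ex_cos_lin s th :
  Ex P (fun w => cos (lin X s w + th)) = cos th * expR (- (gvar c s / 2)).
Proof.
have [_ _ /(_ s)[v0 _]] := gX.
rewrite (Ex_lin s (f := fun y => cos (y + th))); last first.
  by apply: bmeas_cos; exact: measurable_funD.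
set a := Num.sqrt _.
have mM : measurable_fun setT (fun z : measurableTypeR R => a * z : R) by exact: measurable_funM.
transitivity (Ex gam (fun z => cos th * cos (a * z) - sin th * sin (a * z))).
  by congr Ex; apply/funext => z; rewrite cosD; ring.
rewrite ExB ?ExZ ?stdn_cos ?stdn_sin ?mulr0 ?subr0 ?sqr_sqrtr//;
  do ?[apply: bmeasZ]; do ?[exact: bmeas_cos|exact: bmeas_sin].
Qed.

Lemma Ex_le s u : Ex P (fun w => (lin X s w <= u)%R%:R) =
  Ex gam (fun z => (Num.sqrt (gvar c s) * z <= u)%R%:R).
Proof.
apply: (Ex_lin s (f := fun y => (y <= u)%R%:R)).
by apply: bmeas_bool; apply: (measurable_le_cst (f := idfun)); exact: measurable_id.
Qed.

Lemma Ex_gt s u : Ex P (fun w => (u < lin X s w)%R%:R) =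
  Ex gam (fun z => (u < Num.sqrt (gvar c s) * z)%R%:R).
Proof.
apply: (Ex_lin s (f := fun y => (u < y)%R%:R)).
by apply: bmeas_bool; apply: (measurable_gt_cst (f := idfun)); exact: measurable_id.
Qed.

Section decoupling.
Variable k0 : I.
Hypothesis ck0 : c k0 k0 = 1.

(* In the orthogonal decomposition X k = (X k - c k k0 X k0) + c k k0 X k0, the
   variable X k0 is replaced by an independent one. *)
Definition decoupled (k : I) (p : T * measurableTypeR R) : R :=
  X k p.1 - c k k0 * X k0 p.1 + c k k0 * p.2.

Lemma measurable_decoupled k : measurable_fun setT (decoupled k).
Proof.
apply: measurable_funD; last exact: measurable_funM.
by apply: measurable_funB; [|apply: measurable_funM => //]; exact: measurableT_comp (mX _) _.
Qed.

Lemma decoupled_k0 w z : decoupled k0 (w, z) = z.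
Proof. by rewrite /decoupled ck0 !mul1r subrr add0r. Qed.

(** By [cramer_wold_box] only linear combinations matter. With b the covariance of a combination and
    X k0, removing the X k0 component lowers the variance by b^2, and b times the independent
    variable restores it. *)
Lemma decoupled_box l :
  Ex P (fun w => (box X l w)%:R) = Ex (P \x gam)%E (fun p => (box decoupled l p)%:R).
Proof.
apply: cramer_wold_box => //; first exact: measurable_decoupled.
move=> s th; pose b := \sum_(p <- s) p.1 * c p.2 k0.
have linE p : lin decoupled s p = lin X ((- b, k0) :: s) p.1 + b * p.2.
  rewrite lin_cons/= /lin /b mulNr !mulr_suml -sumrN -!big_split/=.
  apply: eq_bigr => q _; rewrite /decoupled; ring.
have mlD : measurable_fun setT (lin decoupled s).
  by apply: measurable_lin; exact: measurable_decoupled.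
rewrite Ex_prod2; last by apply: bmeas_cos; exact: measurable_funD.
rewrite (_ : (fun y => Ex P (fun x => cos (lin decoupled s (x, y) + th))) =
  (fun y => cos (b * y + th) * expR (- (gvar c ((- b, k0) :: s) / 2)))); last first.
  apply/funext => y; rewrite -Ex_cos_lin; congr Ex; apply/funext => x.
  by rewrite (linE (x, y)) addrA.
rewrite Ex_cos_lin (gvar_cons csym) -/b ck0.
have mM : measurable_fun setT (fun z : measurableTypeR R => b * z : R) by exact: measurable_funM.
transitivity (Ex gam (fun z => expR (- (((- b) ^+ 2 * 1 + 2 * - b * b + gvar c s) / 2)) *
    (cos th * cos (b * z) - sin th * sin (b * z)))).
  rewrite ExZ; last first.
    by apply: bmeasB; apply: bmeasZ; [exact: bmeas_cos|exact: bmeas_sin].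
  rewrite ExB ?ExZ ?stdn_cos ?stdn_sin ?mulr0 ?subr0//;
    do ?[apply: bmeasZ]; do ?[exact: bmeas_cos|exact: bmeas_sin].
  rewrite mulrCA -expRD; congr (_ * expR _); by field.
by congr Ex; apply/funext => z; rewrite /= cosD mulrC; congr (_ * _); ring.
Qed.

End decoupling.

Hypothesis c1 : forall k, c k k = 1.
Hypothesis c0 : forall k j, 0 <= c k j.

Definition pmax (u : R) (l : seq I) : R :=
  Ex P (fun w => (box X [seq (k, u) | k <- l] w)%:R).

Lemma pmaxE u l : pmax u l = Ex P (fun w => (all (fun k => X k w <= u) l)%:R).
Proof. by congr Ex; apply/funext => w; rewrite /box all_map. Qed.

Lemma pmax1 u k : pmax u [:: k] = Phi u.
Proof.
rewrite standard_normal_dfE pmaxE.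
have := Ex_le [:: (1, k)] u; rewrite (gvar1 csym) c1 mulr1 expr1n sqrtr1.
rewrite (_ : (fun z => (1 * z <= u)%R%:R) = (fun z => (z <= u)%R%:R)); last first.
  by apply/funext => z; rewrite mul1r.
move=> <-; congr Ex; apply/funext => w.
by rewrite /= andbT lin_cons lin_nil /= mul1r addr0.
Qed.

Lemma chebyshev_association (B : R -> R) u : bmeas B -> {homo B : x y /~ x <= y} ->
  Ex gam B * Phi u <= Ex gam (fun z => B z * (z <= u)%R%:R).
Proof.
move=> bB homoB.
have bb : bmeas (fun z : measurableTypeR R => (z <= u)%R%:R : R).
  by apply: bmeas_bool; apply: (@measurable_le_cst R _ (measurableTypeR R) idfun u); exact: measurable_id.
have bc (a : R) : bmeas (fun z : measurableTypeR R => a) by exact: bmeas_cst.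
(* With B centred at B u, both factors change sign at u in the same direction, so their product is
   non-negative. *)
have : 0 <= Ex gam (fun z => (B z - B u) * ((z <= u)%R%:R - Phi u)).
  apply: Ex_ge0 => z; have P0 := standard_normal_df_ge0 u.
  have P1 := standard_normal_df_le1 u.
  case: (leP z u) => zu; first by rewrite mulr_ge0// subr_ge0// homoB.
  by rewrite mulr_le0// ?subr_le0 ?sub0r ?oppr_le0// homoB// ltW.
have -> : (fun z => (B z - B u) * ((z <= u)%R%:R - Phi u)) =
    (fun z => (B z * (z <= u)%R%:R - Phi u * B z) - (B u * (z <= u)%R%:R - B u * Phi u)).
  by apply/funext => z; ring.
rewrite !ExB ?ExZ//; do ?[exact: bmeasB|exact: bmeasZ|exact: bmeasM];
  last first.
  by apply: bmeasB; [exact: bmeasZ|exact: bc].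
  by apply: bmeasB; [exact: bmeasM|exact: bmeasZ].
by rewrite Ex_cst -standard_normal_dfE; lra.
Qed.

Section conditional.
Variables (k0 : I) (u : R).
Implicit Types z : R.

(** A version of the conditional probability of the box given X k0 = z. *)
Definition cond_prob (l : seq I) (z : R) : R :=
  Ex P (fun w => (box (decoupled k0) [seq (k, u) | k <- l] (w, z))%:R).

Let bbox l : bmeas (fun p => (box (decoupled k0) [seq (k, u) | k <- l] p)%:R : R).
Proof.
by apply: bmeas_bool; apply: measurable_box; exact: measurable_decoupled.
Qed.

Let bbox1 l z : bmeas (fun w => (box (decoupled k0) [seq (k, u) | k <- l] (w, z))%:R : R).
Proof. exact: (bmeas_section2 (bbox l) z). Qed.

Lemma bmeas_cond_prob l : bmeas (cond_prob l).
Proof. exact: bmeas_Ex2 P gam _ (bbox l). Qed.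

Lemma Ex_cond_prob l : Ex gam (cond_prob l) = pmax u l.
Proof. by rewrite /pmax (decoupled_box (c1 k0)) Ex_prod2. Qed.

Lemma Ex_cond_prob_le l :
  Ex gam (fun z => cond_prob l z * (z <= u)%R%:R) = pmax u (k0 :: l).
Proof.
rewrite /pmax (decoupled_box (c1 k0)) Ex_prod2//; congr Ex; apply/funext => z /=.
have -> : (fun x => ((decoupled k0 k0 (x, z) <= u) &&
      box (decoupled k0) [seq (k, u) | k <- l] (x, z))%:R : R) =
    (fun x => ((z <= u) && box (decoupled k0) [seq (k, u) | k <- l] (x, z))%:R).
  by apply/funext => x; rewrite decoupled_k0.
have [zu|zu] := leP z u; rewrite ?mulr1 ?mulr0//.
by rewrite Ex_cst.
Qed.

Let homo_decoupled k w z z' : z <= z' -> decoupled k0 k (w, z) <= decoupled k0 k (w, z').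
Proof. by move=> zz'; rewrite /decoupled/= lerD2l ler_wpM2l. Qed.

Lemma cond_prob_nonincreasing l : {homo cond_prob l : x y /~ x <= y}.
Proof.
move=> z z' zz'; apply: le_Ex => // w; rewrite ler_nat /box !all_map.
elim: l => //= k l IH.
case: (leP (decoupled k0 k (w, z)) u) => //= H.
by rewrite (le_trans (homo_decoupled k w zz') H).
Qed.

(** A union bound: a point that leaves the box as z grows breaks one of its constraints.
    Consequently the sum of the single probabilities minus the joint one is nonincreasing in z. *)
Lemma cond_prob_diff l z z' : z <= z' ->
  cond_prob l z - cond_prob l z' <= \sum_(k <- l) (cond_prob [:: k] z - cond_prob [:: k] z').
Proof.
move=> zz'.
rewrite -ExB//.
under [leRHS]eq_bigr do rewrite -ExB//.
rewrite -Ex_sum; last by move=> k; exact: bmeasB.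
apply: le_Ex; [exact: bmeasB|by apply: bmeas_sum => k; exact: bmeasB|].
move=> w; rewrite /box; elim: l => [|k l IH]; first by rewrite big_nil subrr.
rewrite big_cons/= andbT; move: IH; set S := \sum_(_ <- _) _.
have := homo_decoupled k w zz'.
case: (leP (decoupled k0 k (w, z')) u) => [H1|H1] H; last first.
  case: (leP (decoupled k0 k (w, z)) u) => //= H2 IH; rewrite subr0.
    have S0 : 0 <= S.
      apply: sumr_ge0 => j _; rewrite subr_ge0 ler_nat /= !andbT.
      have := homo_decoupled j w zz'.
      case: (leP (decoupled k0 j (w, z')) u) => // Hj Hj'.
      by rewrite (le_trans Hj' Hj).
    by case: (all _ _) => /=; lra.
  rewrite add0r; apply: sumr_ge0 => j _; rewrite subr_ge0 ler_nat /= !andbT.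
  have := homo_decoupled j w zz'.
  case: (leP (decoupled k0 j (w, z')) u) => // Hj Hj'.
  by rewrite (le_trans Hj' Hj).
by rewrite (le_trans H H1) /= subrr add0r.
Qed.

(** Both bounds are instances of [chebyshev_association]: the lower one for the conditional
    probability of the box, the upper one for [B], which is nonincreasing by [cond_prob_diff]. *)
Lemma pmax_cons l : 0 <= pmax u (k0 :: l) - pmax u l * Phi u <=
  \sum_(k <- l) (pmax u [:: k0; k] - Phi u ^+ 2).
Proof.
rewrite subr_ge0 -Ex_cond_prob_le -Ex_cond_prob; apply/andP; split.
  by apply: chebyshev_association; [exact: bmeas_cond_prob|exact: cond_prob_nonincreasing].
pose B z := (\sum_(k <- l) cond_prob [:: k] z) - cond_prob l z.
have bs : bmeas (fun z => \sum_(k <- l) cond_prob [:: k] z).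
  by apply: bmeas_sum => k; exact: bmeas_cond_prob.
have bB : bmeas B by apply: bmeasB => //; exact: bmeas_cond_prob.
have homoB : {homo B : x y /~ x <= y}.
  move=> z z' zz'; have := cond_prob_diff l zz'.
  by rewrite sumrB /B; lra.
have bb : bmeas (fun z : R => (z <= u)%R%:R : R).
  by apply: bmeas_bool; apply: (measurable_le_cst (f := idfun)); exact: measurable_id.
have := chebyshev_association u bB homoB.
rewrite (_ : (fun z => B z * _) = (fun z => (\sum_(k <- l) cond_prob [:: k] z * (z <= u)%R%:R)
    - cond_prob l z * (z <= u)%R%:R)); last first.
  by apply/funext => z; rewrite /B mulrBl mulr_suml.
have bcb j : bmeas (fun z => cond_prob j z * (z <= u)%R%:R).
  by apply: bmeasM => //; exact: bmeas_cond_prob.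
have bs2 : bmeas (fun z => \sum_(k <- l) cond_prob [:: k] z * (z <= u)%R%:R).
  by apply: bmeas_sum => k; exact: bcb.
rewrite (ExB gam bs (bmeas_cond_prob l)) (ExB gam bs2 (bcb l)).
rewrite (Ex_sum gam l (fun k => bmeas_cond_prob [:: k])).
rewrite (Ex_sum gam l (fun k => bcb [:: k])).
under eq_bigr do rewrite Ex_cond_prob pmax1.
under [X in _ <= X - _ -> _]eq_bigr do rewrite Ex_cond_prob_le.
rewrite mulrBl mulr_suml sumrB => H.
under [X in _ <= _ - X]eq_bigr do rewrite expr2.
by move: H; lra.
Qed.

End conditional.

Fixpoint pair_sum (u : R) (l : seq I) : R :=
  if l is k :: l' then \sum_(j <- l') (pmax u [:: k; j] - Phi u ^+ 2) + pair_sum u l' else 0.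

Lemma pmax_cov_ge0 u k j : 0 <= pmax u [:: k; j] - Phi u ^+ 2.
Proof. by have /andP[] := pmax_cons k u [:: j]; rewrite pmax1 expr2. Qed.

(** Peeling off one variable costs at most its covariances with the remaining ones, and the earlier
    error is only multiplied by Phi u <= 1. *)
Theorem pmax_bound u l : 0 <= pmax u l - Phi u ^+ size l <= pair_sum u l.
Proof.
elim: l => [|k l /andP[IH1 IH2]] /=.
  rewrite expr0 /pmax /= Ex_cst subrr lexx//.
have /andP[H1 H2] := pmax_cons k u l.
have P0 := standard_normal_df_ge0 u; have P1 := standard_normal_df_le1 u.
rewrite exprSr.
have -> : pmax u (k :: l) - Phi u ^+ size l * Phi u =
  (pmax u (k :: l) - pmax u l * Phi u) + Phi u * (pmax u l - Phi u ^+ size l) by ring.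
rewrite addr_ge0 ?mulr_ge0//=; apply: lerD => //.
by rewrite (le_trans _ IH2)// ler_piMl.
Qed.

(* If both X k and X j exceed u, then X k + X j exceeds 2 u. *)
Lemma pmax_cov_near (u : R) k j : 0 <= u ->
  pmax u [:: k; j] - Phi u ^+ 2 <=
  Ex gam (fun z => (2 * u < Num.sqrt (2 + 2 * c k j) * z)%R%:R).
Proof.
move=> u0.
have := Ex_gt [:: (1, k); (1, j)] (2 * u).
rewrite (gvar2 csym) !c1 expr1n !mulr1 (_ : 1 + 2 * c k j + 1 = 2 + 2 * c k j); last by ring.
move=> <-.
have bk i : bmeas (fun w => (X i w <= u)%R%:R : R) by apply: bmeas_bool; exact: measurable_le_cst.
have bg : bmeas (fun w => (2 * u < lin X [:: (1, k); (1, j)] w)%R%:R : R).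
  by apply: bmeas_bool; exact: measurable_gt_cst.
have H : pmax u [:: k; j] <= Ex P (fun w => ((X k w <= u)%R%:R + (X j w <= u)%R%:R - 1) +
    (2 * u < lin X [:: (1, k); (1, j)] w)%R%:R).
  rewrite pmaxE; apply: le_Ex.
  - have -> : (fun w => (all (fun i => X i w <= u) [:: k; j])%:R : R) =
      (fun w => (X k w <= u)%R%:R * (X j w <= u)%R%:R).
      by apply/funext => w; rewrite /= andbT -mulnb natrM.
    exact: bmeasM.
  - by apply: bmeasD => //; apply: bmeasB; [exact: bmeasD|exact: bmeas_cst].
  - move=> w; rewrite !lin_cons lin_nil /= !mul1r addr0 andbT.
    case: (leP (X k w) u) => h1; case: (leP (X j w) u) => h2 /=; try by case: (_ < _)%R => /=; lra.
    by rewrite (_ : (2 * u < _)) /=; lra.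
rewrite ExD// in H; last by apply: bmeasB; [exact: bmeasD|exact: bmeas_cst].
rewrite ExB ?ExD ?Ex_cst// in H; [|exact: bmeasD|exact: bmeas_cst].
have p1 i : Ex P (fun w => (X i w <= u)%R%:R) = Phi u.
  by rewrite -(pmax1 u i) pmaxE; congr Ex; apply/funext => w; rewrite /= andbT.
rewrite !p1 in H; have := sqr_ge0 (1 - Phi u); move: H; rewrite !expr2; lra.
Qed.

(** Given X j = z with u < z <= 2 u, X k has mean r z <= 2 r u and variance at most 1, so X k <= u
    has conditional probability at least Phi(u - 2 r u); r <= 1 / 2 keeps this argument
    non-negative, so that a smaller variance only helps. The event X j > 2 u is given up, at the
    cost 1 - Phi(2 u). *)
Lemma pmax_cov_far (u : R) k j : 0 <= u -> c k j <= 1 / 2 ->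
  pmax u [:: j; k] - Phi u ^+ 2 <=
  (1 - Phi u) * (Phi u - Phi (u - 2 * c k j * u)) + (1 - Phi (2 * u)).
Proof.
move=> u0 r2; set r := c k j in r2 *; have r0 : 0 <= r := c0 _ _.
set v0 := u - 2 * r * u.
have v00 : 0 <= v0.
  rewrite /v0 (_ : _ - _ = u * (1 - 2 * r)); last by ring.
  by rewrite mulr_ge0//; lra.
have P0 := @standard_normal_df_ge0 R; have P1 := @standard_normal_df_le1 R.
have condE z : z <= 2 * u -> Phi v0 <= cond_prob j u [:: k] z.
  move=> zu.
  have -> : cond_prob j u [:: k] z =
      Ex P (fun w => (lin X [:: (1, k); (- r, j)] w <= u - r * z)%R%:R).
    congr Ex; apply/funext => w.
    rewrite /= andbT !lin_cons lin_nil /decoupled/= mul1r addr0 -/r mulNr.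
    by rewrite lerBrDr.
  rewrite Ex_le (gvar2 csym) !c1 -/r standard_normal_dfE; apply: le_Ex.
  - by apply: bmeas_bool; apply: (@measurable_le_cst R _ (measurableTypeR R) idfun); exact: measurable_id.
  - by apply: bmeas_bool; apply: measurable_le_cst; exact: measurable_funM.
  move=> x; rewrite ler_nat; case: (leP x v0) => // xv.
  rewrite (_ : _ <= _)//; set q := Num.sqrt _.
  have q0 : 0 <= q by exact: sqrtr_ge0.
  have q1 : q <= 1.
    rewrite /q -[leRHS]sqrtr1 ler_wsqrtr//; have := sqr_ge0 r; rewrite expr2; lra.
  have h : v0 <= u - r * z.
    rewrite /v0 lerD2l lerN2; have := ler_wpM2l r0 zu; lra.
  apply: le_trans h; have [x0|x0] := lerP 0 x.
    by apply: le_trans xv; rewrite ler_piMl.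
  by apply: le_trans v00; rewrite mulr_ge0_le0// ltW.
have bA := bmeas_cond_prob j u [:: k].
have bb v : bmeas (fun z : R => (z <= v)%R%:R : R).
  by apply: bmeas_bool; apply: (measurable_le_cst (f := idfun)); exact: measurable_id.
have A0 z : 0 <= cond_prob j u [:: k] z by exact: Ex_ge0.
have H : Phi v0 * (Phi (2 * u) - Phi u) <= Phi u - pmax u [:: j; k].
  have bAb := bmeasM bA (bb u).
  have -> : Phi u - pmax u [:: j; k] =
      Ex gam (fun z => cond_prob j u [:: k] z - cond_prob j u [:: k] z * (z <= u)%R%:R).
    by rewrite (ExB gam bA bAb) Ex_cond_prob Ex_cond_prob_le pmax1.
  have -> : Phi v0 * (Phi (2 * u) - Phi u) =
      Ex gam (fun z => Phi v0 * ((z <= 2 * u)%R%:R - (z <= u)%R%:R)).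
    rewrite (ExZ gam _ (bmeasB (bb (2 * u)) (bb u))) (ExB gam (bb (2 * u)) (bb u)).
    by rewrite -!standard_normal_dfE.
  apply: le_Ex; [exact: (bmeasZ _ (bmeasB (bb _) (bb _)))|exact: (bmeasB bA bAb)|].
  move=> z; have [zu|zu] := leP z u.
    by rewrite (le_trans zu) ?subrr ?mulr0 ?mulr1 ?subrr//; lra.
  rewrite mulr0 !subr0; have [z2u|z2u] := leP z (2 * u); last by rewrite mulr0.
  by rewrite mulr1; exact: condE.
have := P0 (2 * u); have := P1 (2 * u); have := P0 u; have := P1 u.
have := P0 v0; have := P1 v0; move: H.
have : 0 <= (1 - Phi v0) * (1 - Phi (2 * u)) by rewrite mulr_ge0 ?subr_ge0.
set a := Phi v0; set b := Phi u; set e := Phi (2 * u); set m := pmax _ _.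
by move=> *; nra.
Qed.

End gaussian_family.

(** * Tails of the normal law *)

Definition ntail (R : realType) (u : R) : R := 1 - standard_normal_df u.

Section ntail.
Context (R : realType).
Notation gam := (stdn R).
Notation Phi := (@standard_normal_df R).
Notation Q := (@ntail R).
Implicit Types u v h : R.

Let bgt u : bmeas (fun z : R => (u < z)%R%:R : R).
Proof.
by apply: bmeas_bool; apply: (measurable_gt_cst (f := idfun)); exact: measurable_id.
Qed.

Let ble u : bmeas (fun z : R => (z <= u)%R%:R : R).
Proof.
by apply: bmeas_bool; apply: (measurable_le_cst (f := idfun)); exact: measurable_id.
Qed.

Lemma ntailE u : Q u = Ex gam (fun z => (u < z)%R%:R).
Proof.
rewrite /ntail standard_normal_dfE.
transitivity (Ex gam (fun z => 1 - (z <= u)%R%:R)).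
  by rewrite (ExB gam (bmeas_cst _ 1) (ble u)) Ex_cst.
by congr Ex; apply/funext => z; rewrite ltNge; case: (z <= u); rewrite /= ?subrr ?subr0.
Qed.

Lemma ntail_ge0 u : 0 <= Q u.
Proof. by rewrite subr_ge0 standard_normal_df_le1. Qed.

Lemma ntail_le1 u : Q u <= 1.
Proof. by rewrite gerBl standard_normal_df_ge0. Qed.

Lemma ntail_nonincreasing : {homo Q : u v /~ u <= v}.
Proof.
by move=> u v uv; rewrite lerD2l lerN2; have [+ _ _ _] := distribution_function_normal R; exact.
Qed.

(** A Cameron-Martin shift by h: on z > u the weight exp(- (h z + h^2 / 2)) is at most its value at
    u. *)
Lemma ntailD u h : 0 <= u -> 0 <= h -> Q (u + h) <= expR (- (u * h + h ^+ 2 / 2)) * Q u.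
Proof.
move=> u0 h0.
pose g z := (u + h < z)%R%:R * expR (- (h * z - h ^+ 2 / 2)) : R.
have me (a : R) : measurable_fun setT (fun z : R => expR (- (h * z - a))).
  apply: measurableT_comp => //; apply: measurableT_comp => //.
  by apply: measurable_funD => //; exact: measurable_funM.
have mg : measurable_fun setT g by apply: measurable_funM; [exact: (bgt _).1|exact: me].
have g0 z : 0 <= g z by rewrite mulr_ge0 ?expR_ge0.
have := ge0_Ex_shift h mg g0.
have -> : (\int[gam]_z (g z * expR (h * z - h ^+ 2 / 2))%:E = (Q (u + h))%:E)%E.
  rewrite ntailE (EFin_Ex gam (bgt _)); apply: eq_integral => z _.
  by rewrite /g -mulrA -expRD addNr expR0 mulr1.
move=> H; rewrite -lee_fin -H ntailE.
rewrite -(ExZ gam _ (bgt u)) (EFin_Ex gam (bmeasZ _ (bgt u))).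
apply: ge0_le_integral => //.
- by move=> z _; rewrite lee_fin.
- by apply/measurable_EFinP; apply: measurableT_comp mg _; exact: measurable_funD.
- by apply/measurable_EFinP; exact: (bmeasZ _ (bgt u)).1.
move=> z _; rewrite lee_fin /g ltrD2r mulrC.
case: (ltP u z) => uz; last by rewrite !mulr0.
rewrite !mulr1 ler_expR lerN2 mulrDr [X in _ <= X](_ : _ = h * z + h ^+ 2 / 2).
  by rewrite lerD2r mulrC ler_wpM2l// ltW.
by rewrite expr2; field.
Qed.

Lemma ntail_le_exp h : 0 <= h -> Q h <= expR (- (h ^+ 2 / 2)).
Proof.
move=> h0; have := ntailD (lexx 0) h0; rewrite add0r mul0r add0r => /le_trans; apply.
by rewrite ler_piMr ?expR_ge0 ?ntail_le1.
Qed.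

Lemma standard_normal_df_diff (m M : R) u v : u <= v ->
  (forall z, u < z <= v -> m <= gpdf z <= M) ->
  m * (v - u) <= Phi v - Phi u <= M * (v - u).
Proof.
move=> uv H.
have [<-|uv'] := eqVneq u v; first by rewrite !subrr !mulr0 lexx.
have {uv'}uv' : u < v by rewrite lt_neqAle uv'.
have mI : measurable `]u, v] by exact: measurable_itv.
have mu_uv : lebesgue_measure `]u, v] = (v - u)%:E.
  by rewrite lebesgue_measure_itv/= lte_fin uv' EFinB.
have -> : Phi v - Phi u = fine (\int[lebesgue_measure]_(z in `]u, v]) (gpdf z)%:E).
  rewrite !standard_normal_dfE -(ExB gam (ble v) (ble u)).
  have bI : bmeas (fun z : R => (u < z <= v)%R%:R : R).
    rewrite (_ : (fun _ => _) = (fun z : R => (u < z)%R%:R * (z <= v)%R%:R)).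
      exact: bmeasM.
    by apply/funext => z; rewrite -mulnb natrM.
  rewrite (_ : (fun _ => _) = (fun z : R => (u < z <= v)%R%:R)); last first.
    apply/funext => z; case: (leP z u) => zu /=.
      by rewrite (le_trans zu uv) subrr.
    by rewrite subr0.
  rewrite /Ex /Rintegral; congr fine.
  rewrite (ge0_integral_stdn bI.1)// [RHS]integral_mkcond.
  apply: eq_integral => z _; rewrite patchE mem_setE in_itv/=.
  by case: ifP => _; rewrite ?mul1r ?mul0r.
have fin : (\int[lebesgue_measure]_(z in `]u, v]) (gpdf z)%:E)%E \is a fin_num.
  apply: integrable_fin_num => //; apply: (integrableS measurableT) => //.
  exact: integrable_normal_pdf.
rewrite -!lee_fin fineK// !EFinM -mu_uv -!integral_cst//.
have mgp : measurable_fun `]u, v] (fun z : R => (gpdf z)%:E).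
  by apply/measurable_EFinP; apply: measurable_funTS; exact: measurable_gpdf.
have ic (a : R) : lebesgue_measure.-integrable `]u, v] (cst a%:E).
  apply: (@measurable_bounded_integrable _ _ R lebesgue_measure (cst a) `]u, v]) => //.
    exact: (eq_ind_r (fun x => (x < +oo)%E) (ltry _) mu_uv).
  by exists `|a|; split; rewrite ?num_real// => x ax y _ /=; exact: ltW.
have ig : lebesgue_measure.-integrable `]u, v] (fun z : R => (gpdf z)%:E).
  by apply: (integrableS measurableT) => //; exact: integrable_normal_pdf.
apply/andP; split; apply: le_integral => //= z; rewrite inE/= in_itv/= => zuv;
  by have /andP[] := H z zuv.
Qed.

Lemma gpdf_gt0 u : 0 < gpdf u.
Proof. by rewrite gpdfE mulr_gt0 ?expR_gt0// normal_peak_gt0 ?oner_neq0. Qed.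

Lemma gpdf_nonincreasing u v : 0 <= u <= v -> gpdf v <= gpdf u.
Proof.
move=> /andP[u0 uv]; rewrite !gpdfE ler_wpM2l ?normal_peak_ge0// ler_expR.
rewrite !mulNr lerN2 ler_wpM2r// lerXn2r// nnegrE//; exact: le_trans uv.
Qed.

Lemma ntail_diff_le u h : 0 <= h <= u -> Q (u - h) - Q u <= h * expR (u * h) * gpdf u.
Proof.
move=> /andP[h0 hu].
have uhu : u - h <= u by rewrite gerBl.
have := @standard_normal_df_diff 0 (gpdf (u - h)) (u - h) u uhu.
have H : forall z : R, u - h < z <= u -> 0 <= gpdf z <= gpdf (u - h).
  move=> z /andP[z1 z2]; rewrite gpdf_ge0/=; apply: gpdf_nonincreasing.
  by rewrite subr_ge0 hu ltW.
move=> /(_ H)/andP[_]; rewrite subKr /ntail => H1.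
apply: (@le_trans _ _ (gpdf (u - h) * h)); first by lra.
rewrite mulrC -mulrA ler_wpM2l// !gpdfE mulrCA ler_wpM2l ?normal_peak_ge0//.
rewrite -expRD ler_expR; have := sqr_ge0 h; rewrite !expr2; lra.
Qed.

(** A bound on Mills' ratio: between u and u + 1 / u the density decreases by at most the factor
    exp(1 + 1 / (2 u^2)) <= exp(3 / 2). *)
Lemma gpdf_le_ntail u : 1 <= u -> gpdf u <= expR (3 / 2) * u * Q u.
Proof.
move=> u1; have u0 : 0 < u by exact: lt_le_trans u1.
have iu0 : 0 < u^-1 by rewrite invr_gt0.
have uv : u <= u + u^-1 by rewrite lerDl ltW.
have := @standard_normal_df_diff (gpdf (u + u^-1)) (gpdf u) u (u + u^-1) uv.
have H z : u < z <= u + u^-1 -> gpdf (u + u^-1) <= gpdf z <= gpdf u.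
  by move=> /andP[z1 z2]; rewrite !gpdf_nonincreasing// ?(ltW z1) ?z2 ?(ltW (lt_trans u0 z1))// ltW.
move=> /(_ H)/andP[+ _]; rewrite (_ : u + u^-1 - u = u^-1) => [H1|]; last by ring.
have H2 : gpdf (u + u^-1) * u^-1 <= Q u.
  by apply: le_trans H1 _; rewrite /ntail lerD2r standard_normal_df_le1.
have H3 : gpdf u <= expR (3 / 2) * gpdf (u + u^-1).
  rewrite !gpdfE mulrCA ler_wpM2l ?normal_peak_ge0// -expRD ler_expR.
  have -> : 3 / 2 + - (u + u^-1) ^+ 2 / 2 = - u ^+ 2 / 2 + (1 - u^-1 ^+ 2) / 2.
    by field; rewrite gt_eqF.
  have iu1 : u^-1 <= 1 by rewrite invf_le1.
  by rewrite lerDl divr_ge0// subr_ge0 exprn_ile1// ltW.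
apply: (le_trans H3); rewrite -mulrA ler_wpM2l ?expR_ge0//.
by rewrite -ler_pdivrMl// mulrC.
Qed.

Lemma ntail_gt0 u : 1 <= u -> 0 < Q u.
Proof.
move=> u1; have := gpdf_le_ntail u1; have := gpdf_gt0 u.
move=> /lt_le_trans /[apply]; rewrite pmulr_rgt0// mulr_gt0 ?expR_gt0//.
exact: lt_le_trans u1.
Qed.

Lemma continuous_standard_normal_df : continuous Phi.
Proof.
pose p : R := normal_peak 1.
have p0 : 0 < p by rewrite normal_peak_gt0 ?oner_neq0.
have lip u v : u <= v -> `|Phi v - Phi u| <= p * (v - u).
  move=> uv; rewrite ger0_norm.
    have H (z : R) : u < z <= v -> 0 <= gpdf z <= p.
      move=> _; rewrite gpdf_ge0/= gpdfE ler_piMr ?(ltW p0)//.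
      by rewrite -expR0 ler_expR mulNr oppr_le0 divr_ge0 ?sqr_ge0.
    by have /andP[] := standard_normal_df_diff uv H.
  by rewrite subr_ge0; have [+ _ _ _] := distribution_function_normal R; exact.
move=> x; apply/cvgrPdist_le => e e0; near=> y.
have xy : `|x - y| <= e / p.
  by near: y; apply: cvgr_dist_le; [exact: cvg_id|exact: divr_gt0].
have [yx|xy'] := leP y x.
  rewrite (le_trans (lip _ _ yx))// mulrC -ler_pdivlMr//.
  by rewrite ger0_norm ?subr_ge0 in xy.
rewrite distrC (le_trans (lip _ _ (ltW xy')))// mulrC -ler_pdivlMr//.
by rewrite -[leLHS]ger0_norm ?subr_ge0 ?(ltW xy')// distrC.
Unshelve. all: end_near. Qed.

Lemma ntail_surj (q : R) : 0 < q < 1 -> exists u, Q u = q.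
Proof.
move=> /andP[q0 q1].
have [homoP _ Ny y] := distribution_function_normal R.
have [a Pa] : exists a, Phi a < 1 - q.
  have : \forall x \near -oo, Phi x < 1 - q by apply: (cvgr_lt 0) => //; rewrite subr_gt0.
  by move=> /filter_ex.
have [b Pb] : exists b, 1 - q < Phi b.
  have : \forall x \near +oo, 1 - q < Phi x by apply: (cvgr_gt 1) => //; lra.
  by move=> /filter_ex.
have ab : a <= b.
  have [//|ba] := leP a b; have := homoP _ _ (ltW ba).
  by move: Pa Pb; lra.
have [||c _ Pc] := @IVT R Phi a b (1 - q) ab.
- by apply: continuous_subspaceT; exact: continuous_standard_normal_df.
- by rewrite min_l ?max_r ?homoP// ?ltW.
by exists c; rewrite /ntail Pc subKr.
Qed.

Lemma ln_ntail_le u : 1 <= u -> u ^+ 2 <= - 2 * ln (Q u).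
Proof.
move=> u1; have u0 : 0 <= u by exact: le_trans u1.
have := ntail_le_exp u0; rewrite -(@ler_ln R) ?posrE ?expR_gt0 ?ntail_gt0//.
by rewrite expRK; lra.
Qed.

(* 1 / Q(u) <= exp (u^2 / 2 + o(u^2)) *)
Lemma ln_ntail_ge (th : R) : 0 < th ->
  exists C : R, forall u, 1 <= u -> - ln (Q u) <= (1 + th) * (u ^+ 2 / 2) + C.
Proof.
(* The term ln u from Mills' ratio is absorbed through ln y <= y at y = th u^2, which accounts for -
   ln th / 2. *)
move=> th0; exists (3 / 2 - ln (normal_peak 1) - ln th / 2) => u u1.
have u0 : 0 < u by exact: lt_le_trans u1.
have Q0 := ntail_gt0 u1.
have p0 : 0 < normal_peak 1 :> R by rewrite normal_peak_gt0 ?oner_neq0.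
have := gpdf_le_ntail u1.
rewrite -(@ler_ln R) ?posrE ?gpdf_gt0//; last by rewrite !mulr_gt0 ?expR_gt0.
rewrite gpdfE !lnM ?posrE ?mulr_gt0 ?expR_gt0// !expRK.
have : ln (th * u ^+ 2) <= th * u ^+ 2 by rewrite ltW// ln_sublinear// mulr_gt0 ?exprn_gt0.
rewrite lnM ?posrE ?exprn_gt0// lnXn// mulr2n.
set a := u ^+ 2; move=> *; lra.
Qed.

Lemma half_le_stdn s : 1 / 2 <= Ex gam (fun z => (s * z <= 0)%R%:R).
Proof.
have b1 : bmeas (fun z : R => (s * z <= 0)%R%:R : R).
  by apply: bmeas_bool; apply: measurable_le_cst; exact: measurable_funM.
have b2 : bmeas (fun z : R => (s * - z <= 0)%R%:R : R).
  apply: bmeas_bool; apply: measurable_le_cst; apply: measurable_funM => //.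
have := Ex_stdn_opp b1.
have : 1 <= Ex gam (fun z => (s * - z <= 0)%R%:R + (s * z <= 0)%R%:R).
  rewrite -[leLHS](Ex_cst gam); apply: le_Ex; [exact: bmeas_cst|exact: (bmeasD b2 b1)|move=> z].
  rewrite mulrN oppr_le0; case: (leP (s * z) 0) => h; first by rewrite lerDr.
  by rewrite (ltW h) addr0.
by rewrite (ExD gam b2 b1); lra.
Qed.

End ntail.

(** * Gaussian families on the grid *)

Definition nat_dist (a b : nat) : nat := (a - b) + (b - a).

Definition grid (n1 n2 : nat) : seq (nat * nat) :=
  [seq (i, j) | i <- iota 1 n1, j <- iota 1 n2].

Lemma size_grid n1 n2 : size (grid n1 n2) = (n1 * n2)%N.
Proof. by rewrite size_allpairs !size_iota. Qed.

Lemma uniq_grid n1 n2 : uniq (grid n1 n2).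
Proof.
apply: allpairs_uniq; rewrite ?iota_uniq// => -[a b] [c d] _ _ /= [-> ->] //.
Qed.

Lemma count_near (m a x n : nat) :
  (count (fun i => nat_dist a i <= m)%N (iota x n) <= (2 * m).+1)%N.
Proof.
rewrite -size_filter -[leqRHS](size_iota (a - m)).
apply: uniq_leq_size; first by rewrite filter_uniq// iota_uniq.
by move=> i; rewrite mem_filter !mem_iota /nat_dist; lia.
Qed.

Section near_pairs.
Context (R : realType).

Definition near_pair (m : nat) (k j : nat * nat) : bool :=
  ((nat_dist k.1 j.1 <= m) || (nat_dist k.2 j.2 <= m))%N.

Lemma sumr_const_size (V : nmodType) (I : Type) (s : seq I) (x : V) :
  \sum_(i <- s) x = x *+ size s.
Proof. by rewrite big_const_seq count_predT iter_addr addr0. Qed.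

Lemma sum_natr_count (T : Type) (p : pred T) (s : seq T) :
  \sum_(i <- s) (p i)%:R = (count p s)%:R :> R.
Proof.
elim: s => [|i s IH]; first by rewrite big_nil.
by rewrite big_cons IH /= natrD.
Qed.

Lemma sum_near_pair m k n1 n2 :
  \sum_(j <- grid n1 n2) (near_pair m k j)%:R <=
  (2 * m).+1%:R * (n1 + n2)%:R :> R.
Proof.
rewrite big_allpairs.
apply: (@le_trans _ _ (\sum_(i <- iota 1 n1) \sum_(j <- iota 1 n2)
    ((nat_dist k.1 i <= m)%N%:R + (nat_dist k.2 j <= m)%N%:R))).
  apply: ler_sum => i _; apply: ler_sum => j _; rewrite -natrD ler_nat /near_pair /=.
  by case: (_ <= m)%N; case: (_ <= m)%N.
under eq_bigr do rewrite big_split/= sumr_const_size size_iota sum_natr_count.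
rewrite big_split/= sumr_const_size size_iota sumrMnl sum_natr_count.
rewrite -!mulrnA -natrD -natrM ler_nat mulnDr addnC.
by apply: leq_add; rewrite leq_mul2r count_near orbT.
Qed.

End near_pairs.

Section pair_sum_bound.
Context (R : realType) d (T : measurableType d) (P : probability T R)
  (I : eqType) (X : I -> T -> R) (c : I -> I -> R).
Hypothesis gX : gaussian_family P X c.
Hypothesis c1 : forall k, c k k = 1.
Hypothesis c0 : forall k j, 0 <= c k j.
Notation Phi := (@standard_normal_df R).
Notation Q := (@ntail R).

(** The right side counts every pair twice; this is harmless since all covariances are
    non-negative. *)
Lemma pair_sum_le u l : uniq l ->
  pair_sum P X u l <=
  \sum_(k <- l) \sum_(j <- l | j != k) (pmax P X u [:: k; j] - Phi u ^+ 2).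
Proof.
have cov0 := pmax_cov_ge0 gX c1 c0 u.
elim: l => [|k l IH] /=; first by rewrite big_nil.
move=> /andP[kl ul]; rewrite big_cons big_cons eqxx /=; apply: lerD.
  rewrite le_eqVlt; apply/orP; left; apply/eqP.
  rewrite big_seq [RHS]big_seq_cond; apply: eq_bigl => j.
  by have [jl|//] := boolP (j \in l); apply/esym; apply: contraNneq kl => <-.
apply: (le_trans (IH ul)); apply: ler_sum => i _; rewrite big_cons.
by case: ifP => // _; rewrite lerDr.
Qed.

End pair_sum_bound.

Definition cgrid (R : realType) (e1 e2 : nat -> R) (k j : nat * nat) : R :=
  e1 (nat_dist k.1 j.1) * e2 (nat_dist k.2 j.2).

(* e1 and e2 stand for the restrictions of eta1 and eta2 to the natural numbers. *)
Record weak_decay (R : realType) (e1 e2 : nat -> R) (rho G : R) : Prop := WeakDecay {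
  wd10 : e1 0%N = 1;
  wd20 : e2 0%N = 1;
  wd1_ge0 : forall n, 0 <= e1 n;
  wd2_ge0 : forall n, 0 <= e2 n;
  wd1_ni : forall m n, (m <= n)%N -> e1 n <= e1 m;
  wd2_ni : forall m n, (m <= n)%N -> e2 n <= e2 m;
  wd1_rho : e1 1%N <= rho;
  wd2_rho : e2 1%N <= rho;
  wd_rho : 0 <= rho < 1 / 3;
  wd_G : 0 < G;
  wd1_lim : e1 n @[n --> \oo] --> 0;
  wd2_ln : forall n, (1 < n)%N -> e2 n * ln n%:R <= G }.

Section grid_bound.
Context (R : realType) (e1 e2 : nat -> R) (rho G : R).
Hypothesis W : weak_decay e1 e2 rho G.
Context d (T : measurableType d) (P : probability T R) (X : nat * nat -> T -> R).
Hypothesis gX : gaussian_family P X (cgrid e1 e2).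
Notation gam := (stdn R).
Notation Phi := (@standard_normal_df R).
Notation Q := (@ntail R).

Lemma cgrid1 k : cgrid e1 e2 k k = 1.
Proof. by rewrite /cgrid /nat_dist !subnn (wd10 W) (wd20 W) mulr1. Qed.

Lemma cgrid_ge0 k j : 0 <= cgrid e1 e2 k j.
Proof. by rewrite mulr_ge0 ?(wd1_ge0 W) ?(wd2_ge0 W). Qed.

Lemma cgrid_le_rho k j : k != j -> cgrid e1 e2 k j <= rho.
Proof.
move=> kj; rewrite /cgrid; have /andP[r0 _] := wd_rho W.
have [e|n1] := eqVneq k.1 j.1.
  have : (1 <= nat_dist k.2 j.2)%N.
    rewrite lt0n; apply: contra_neq kj; case: k e => a b /= ->; case: j => a' b' /=.
    by rewrite /nat_dist => h; congr pair; lia.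
  move=> /(wd2_ni W)/le_trans/(_ (wd2_rho W)) h.
  rewrite e /nat_dist subnn (wd10 W) mul1r//.
have : (1 <= nat_dist k.1 j.1)%N by move: n1; rewrite /nat_dist; lia.
move=> /(wd1_ni W)/le_trans/(_ (wd1_rho W)) h.
rewrite -[leRHS]mulr1 ler_pM ?(wd1_ge0 W) ?(wd2_ge0 W)//.
by rewrite -(wd20 W); apply: (wd2_ni W).
Qed.

Lemma cgrid_far m k j : ~~ near_pair m k j -> cgrid e1 e2 k j <= e1 m * e2 m.
Proof.
rewrite /near_pair negb_or -!ltnNge => /andP[h1 h2].
by rewrite ler_pM ?(wd1_ge0 W) ?(wd2_ge0 W)// ?(wd1_ni W) ?(wd2_ni W)// ltnW.
Qed.

(** This is exp(- x^2 / 2) at x = 2 u / sqrt(2 + 2 rho), the normalised level that X k + X j has to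
    exceed. *)
Definition near_bound (u : R) : R := expR (- (u ^+ 2 / (1 + rho))).

Definition far_bound (r u : R) : R := Q u * (Q (u - 2 * r * u) - Q u) + Q (2 * u).

Lemma cov_near u k j : 0 <= u -> k != j ->
  pmax P X u [:: k; j] - Phi u ^+ 2 <= near_bound u.
Proof.
move=> u0 kj; apply: (le_trans (pmax_cov_near gX cgrid1 k j u0)).
set c := cgrid _ _ _ _; have c0 : 0 <= c by exact: cgrid_ge0.
have /andP[r0 _] := wd_rho W.
have cr : c <= rho by exact: cgrid_le_rho.
have q2 : 0 < 2 + 2 * c by lra.
have q0 : 0 < Num.sqrt (2 + 2 * c) by rewrite sqrtr_gt0.
have -> : (fun z => (2 * u < Num.sqrt (2 + 2 * c) * z)%R%:R) =
    (fun z => (2 * u / Num.sqrt (2 + 2 * c) < z)%R%:R) :> (R -> R).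
  by apply/funext => z; rewrite ltr_pdivrMr// [z * _]mulrC.
rewrite -ntailE (le_trans (ntail_le_exp _))//.
  by rewrite divr_ge0 ?mulr_ge0 ?sqrtr_ge0.
rewrite ler_expR lerN2 [(_ / _) ^+ 2]exprMn exprVn sqr_sqrtr ?(ltW q2)//.
have h1 : 1 + c != 0 by rewrite gt_eqF//; lra.
have -> : 2 + 2 * c = 2 * (1 + c) by ring.
have -> : (2 * u) ^+ 2 / (2 * (1 + c)) / 2 = u ^+ 2 / (1 + c) by field; rewrite h1.
by rewrite ler_wpM2l ?sqr_ge0// lef_pV2 ?posrE ?lerD2l//; lra.
Qed.

Lemma cov_far m u k j : 0 <= u -> e1 m * e2 m <= 1 / 2 -> ~~ near_pair m k j ->
  pmax P X u [:: k; j] - Phi u ^+ 2 <= far_bound (e1 m * e2 m) u.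
Proof.
move=> u0 r2 /cgrid_far cr.
have csym : cgrid e1 e2 j k = cgrid e1 e2 k j by case: gX.
rewrite -csym in cr.
have := pmax_cov_far gX cgrid1 cgrid_ge0 u0 (le_trans cr r2).
move=> /le_trans; apply; rewrite /far_bound -/(Q u) -/(Q (2 * u)) lerD2r.
apply: ler_wpM2l; first exact: ntail_ge0.
have -> : Phi u - Phi (u - 2 * cgrid e1 e2 j k * u) =
  Q (u - 2 * cgrid e1 e2 j k * u) - Q u by rewrite /ntail; ring.
rewrite lerD2r; apply: ntail_nonincreasing.
by rewrite lerD2l lerN2 ler_wpM2r// ler_wpM2l.
Qed.

Lemma pair_sum_grid m u n1 n2 : 0 <= u -> e1 m * e2 m <= 1 / 2 ->
  pair_sum P X u (grid n1 n2) <=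
  (n1 * n2)%:R * ((2 * m).+1%:R * (n1 + n2)%:R) * near_bound u +
  (n1 * n2)%:R ^+ 2 * far_bound (e1 m * e2 m) u.
Proof.
move=> u0 r2; apply: (le_trans (pair_sum_le gX cgrid1 cgrid_ge0 u (uniq_grid n1 n2))).
have nb0 : 0 <= near_bound u by exact: expR_ge0.
have fb0 : 0 <= far_bound (e1 m * e2 m) u.
  rewrite addr_ge0 ?ntail_ge0// mulr_ge0 ?ntail_ge0// subr_ge0.
  apply: ntail_nonincreasing; rewrite gerBl !mulr_ge0 ?(wd1_ge0 W) ?(wd2_ge0 W)//.
have row k : \sum_(j <- grid n1 n2 | j != k) (pmax P X u [:: k; j] - Phi u ^+ 2) <=
    (2 * m).+1%:R * (n1 + n2)%:R * near_bound u +
    (n1 * n2)%:R * far_bound (e1 m * e2 m) u.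
  apply: (@le_trans _ _ (\sum_(j <- grid n1 n2)
      ((near_pair m k j)%:R * near_bound u + far_bound (e1 m * e2 m) u))).
    rewrite big_mkcond/=; apply: ler_sum => j _; case: ifP => [jk|_]; last first.
      by rewrite addr_ge0// mulr_ge0.
    case: (boolP (near_pair m k j)) => nkj.
      by rewrite mul1r (le_trans (cov_near u0 _))// ?lerDl// eq_sym.
    by rewrite mul0r add0r; exact: cov_far.
  rewrite big_split/= -mulr_suml sumr_const_size size_grid -[X in _ + X <= _]mulr_natl.
  by rewrite lerD2r ler_wpM2r// sum_near_pair.
apply: (@le_trans _ _ (\sum_(k <- grid n1 n2) ((2 * m).+1%:R * (n1 + n2)%:R * near_bound u +
    (n1 * n2)%:R * far_bound (e1 m * e2 m) u))).
  by apply: ler_sum => k _; exact: row.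
rewrite sumr_const_size size_grid -[leLHS]mulr_natl.
by rewrite le_eqVlt; apply/orP; left; apply/eqP; ring.
Qed.

End grid_bound.

(** * Boxes in a sector *)

Section sector_asymptotics.
Context (R : realType) (e1 e2 : nat -> R) (rho G : R).
Hypothesis W : weak_decay e1 e2 rho G.
Notation Phi := (@standard_normal_df R).
Notation Q := (@ntail R).

(* Near pairs contribute about Q(u)^kappa each, and a sectorial box with N points has
   N^(3/2 + o(1)) near pairs: this is where rho < 1 / 3, i.e. kappa > 3 / 2, is needed. *)
Let kappa := 2 / (1 + rho).
Let delta := (kappa - 3 / 2) / 4.

Let rho0 : 0 <= rho. Proof. by have /andP[] := wd_rho W. Qed.
Let rho3 : rho < 1 / 3. Proof. by have /andP[] := wd_rho W. Qed.

Let kappaE : kappa * (1 + rho) = 2.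
Proof. by rewrite /kappa divfK// gt_eqF//; move: rho0; lra. Qed.

Let delta_gt0 : 0 < delta.
Proof. by rewrite /delta; move: kappaE rho0 rho3; nra. Qed.

Let delta_le : delta <= 1 / 8.
Proof. by rewrite /delta; move: kappaE rho0 rho3; nra. Qed.

(** The gap kappa - 3 / 2 is 4 delta. One delta pays for the range m of nearness, one leaves the
    factor N^-delta, and the rest absorbs the factor 1 + delta in the comparison of ln N with u^2 /
    2. *)
Let kappa_delta : (3 / 2 + 2 * delta) * (1 + delta) <= kappa.
Proof.
have -> : kappa = 3 / 2 + 4 * delta by rewrite /delta; field.
by move: delta_gt0 delta_le; nra.
Qed.

(** Here N = exp L and v = u^2 / 2. There are at most 10 C N^(3/2 + delta) near pairs, and each
    contributes at most a constant times N^-(3/2 + 2 delta). *)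
Let near_term (C A L v : R) (n1 n2 m : nat) : 1 <= C -> 0 <= L -> A <= L ->
  (0 < n1)%N -> (0 < n2)%N ->
  n1%:R <= C * n2%:R -> n2%:R <= C * n1%:R -> (n1 * n2)%:R = expR L ->
  m%:R <= 2 * expR (delta * L) -> L - A <= (1 + delta) * v ->
  (n1 * n2)%:R * ((2 * m).+1%:R * (n1 + n2)%:R) * expR (- (kappa * v)) <=
  10 * C * expR ((3 / 2 + 2 * delta) * A) * expR (- (delta * L)).
Proof.
move=> C1 L0 AL n10 n20 n12 n21 NE mL Lv.
have d0 := delta_gt0.
have h1 : (2 * m).+1%:R <= 5 * expR (delta * L) :> R.
  have : 1 <= expR (delta * L) by rewrite -[leLHS]expR0 ler_expR mulr_ge0// ltW.
  by rewrite -natr1 natrM; lra.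
have h2 : (n1 + n2)%:R <= 2 * C * expR (L / 2).
  have eL2 : expR (L / 2) ^+ 2 = n1%:R * n2%:R :> R.
    by rewrite -natrM NE -expRM_natl; congr expR; field.
  rewrite -(@ler_pXn2r _ 2)// ?nnegrE ?mulr_ge0 ?expR_ge0//; last by lra.
  rewrite exprMn eL2 natrD.
  have a0 : 0 < n1%:R :> R by rewrite ltr0n.
  have b0 : 0 < n2%:R :> R by rewrite ltr0n.
  move: a0 b0 n12 n21; set a := n1%:R; set b := n2%:R => a0 b0 n12 n21.
  have ab0 : 0 < a * b by rewrite mulr_gt0.
  have : a * a <= C * (a * b) by rewrite mulrCA ler_wpM2l// ltW.
  have : b * b <= C * (a * b) by rewrite [a * b]mulrC mulrCA ler_wpM2l// ltW.
  have : C * (a * b) <= C ^+ 2 * (a * b) by rewrite ler_wpM2r ?(ltW ab0)// expr2 ler_peMr//; lra.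
  have : a * b <= C * (a * b) by rewrite ler_peMl// ltW.
  rewrite !expr2; lra.
have h3 : expR (- (kappa * v)) <= expR (- ((3 / 2 + 2 * delta) * (L - A))).
  rewrite ler_expR lerN2.
  have v0 : 0 <= v.
    have : 0 <= (1 + delta) * v by apply: le_trans Lv; rewrite subr_ge0.
    by rewrite pmulr_rge0//; lra.
  apply: (@le_trans _ _ ((3 / 2 + 2 * delta) * ((1 + delta) * v))).
    by apply: ler_wpM2l => //; lra.
  by rewrite mulrA ler_wpM2r.
rewrite NE.
apply: (@le_trans _ _ (expR L * ((5 * expR (delta * L)) * (2 * C * expR (L / 2))) *
    expR (- ((3 / 2 + 2 * delta) * (L - A))))).
  apply: ler_pM; rewrite ?expR_ge0 ?mulr_ge0//.
  apply: ler_wpM2l; first exact: expR_ge0.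
  by apply: ler_pM.
rewrite le_eqVlt; apply/orP; left; apply/eqP.
rewrite (_ : _ * _ = 10 * C * (expR L * expR (delta * L) * expR (L / 2) *
  expR (- ((3 / 2 + 2 * delta) * (L - A))))); last by ring.
rewrite -[RHS]mulrA -!expRD; congr (_ * expR _); by field.
Qed.

(** With h = 2 r u, [ntail_diff_le] and [gpdf_le_ntail] bound Q(u - h) - Q(u) by Q(u) times u h
    exp(u h + 3 / 2), where u h <= t <= 1. *)
Let far_term (K t r u N : R) : 1 <= u -> 0 <= K -> 0 < N -> N * Q u <= K -> 0 <= r -> 2 * r <= 1 ->
  2 * r * u ^+ 2 <= t -> t <= 1 ->
  N ^+ 2 * (Q u * (Q (u - 2 * r * u) - Q u)) <= K ^+ 2 * expR (5 / 2) * t.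
Proof.
move=> u1 K0 N0 NQ r0 r2 rt t1.
have u0 : 0 <= u by lra.
have Q0 := ntail_ge0 u.
set h := 2 * r * u.
have h0 : 0 <= h by rewrite !mulr_ge0.
have hu : h <= u by rewrite /h ler_piMl.
have uh : u * h <= t by apply: le_trans rt; rewrite /h expr2 le_eqVlt; apply/orP; left; apply/eqP; ring.
have uh0 : 0 <= u * h by rewrite mulr_ge0.
have d1 : Q (u - h) - Q u <= h * expR (u * h) * (expR (3 / 2) * u * Q u).
  apply: (le_trans (ntail_diff_le _)); first by rewrite h0.
  by rewrite ler_wpM2l ?mulr_ge0 ?expR_ge0// gpdf_le_ntail.
apply: (@le_trans _ _ (N ^+ 2 * (Q u * (h * expR (u * h) * (expR (3 / 2) * u * Q u))))).
  by rewrite ler_wpM2l ?sqr_ge0// ler_wpM2l.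
rewrite (_ : _ * _ = (N * Q u) ^+ 2 * (expR (u * h) * expR (3 / 2) * (u * h))); last by ring.
rewrite -[leRHS]mulrA; apply: ler_pM; rewrite ?sqr_ge0 ?mulr_ge0 ?expR_ge0//.
  by rewrite ler_pXn2r// nnegrE// mulr_ge0// ltW.
apply: ler_pM; rewrite ?mulr_ge0 ?expR_ge0//.
by rewrite -expRD ler_expR; lra.
Qed.

(** [ntailD] with h = u gives Q(2 u) <= exp(- 3 u^2 / 2) Q(u). One factor N is spent on N Q(u) <= K,
    and the exponential is about N^-3, more than enough for the other. *)
Let double_term (K A L u N : R) : 1 <= u -> 0 <= K -> N = expR L -> N * Q u <= K -> A <= L ->
  L - A <= (1 + delta) * (u ^+ 2 / 2) ->
  N ^+ 2 * Q (2 * u) <= K * expR (2 * A) * expR (- L).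
Proof.
move=> u1 K0 NE NQ AL Lv; have u0 : 0 <= u by lra.
have N0 : 0 <= N by rewrite NE expR_ge0.
have Q2 : Q (2 * u) <= expR (- (3 * (u ^+ 2 / 2))) * Q u.
  have := ntailD u0 u0; rewrite (_ : u + u = 2 * u); last by ring.
  by rewrite (_ : u * u + u ^+ 2 / 2 = 3 * (u ^+ 2 / 2))//; field.
apply: (@le_trans _ _ (N ^+ 2 * (expR (- (3 * (u ^+ 2 / 2))) * Q u))).
  by rewrite ler_wpM2l ?sqr_ge0.
rewrite (_ : _ * _ = (N * Q u) * (N * expR (- (3 * (u ^+ 2 / 2))))); last by ring.
rewrite -[leRHS]mulrA; apply: ler_pM; rewrite ?mulr_ge0 ?ntail_ge0 ?expR_ge0//.
rewrite NE -!expRD ler_expR.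
have := delta_le; have := delta_gt0; move: Lv; set v := u ^+ 2 / 2.
have v0 : 0 <= v by rewrite divr_ge0 ?sqr_ge0.
by move=> *; nra.
Qed.

Lemma grid_sum_small (C K eps eps' : R) : 1 <= C -> 0 < K -> 0 < eps -> 0 < eps' ->
  exists L0 : R, forall (n1 n2 : nat) u, (0 < n1)%N -> (0 < n2)%N ->
  L0 <= ln (n1 * n2)%:R -> n1%:R <= C * n2%:R -> n2%:R <= C * n1%:R ->
  1 <= u -> eps <= (n1 * n2)%:R * Q u <= K ->
  exists m, e1 m * e2 m <= 1 / 2 /\
    (n1 * n2)%:R * ((2 * m).+1%:R * (n1 + n2)%:R) * near_bound rho u +
    (n1 * n2)%:R ^+ 2 * far_bound (e1 m * e2 m) u <= eps'.
Proof.
move=> C1 K0 eps0 eps'0; have d0 := delta_gt0; have G0 := wd_G W.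
have [D HD] := @ln_ntail_ge R delta d0.
pose A := ln K + D.
(* [t0] is the level of 2 r u^2 at which [far_term] is at most eps' / 3. *)
pose t0 := Num.min 1 (eps' / (3 * K ^+ 2 * expR (5 / 2))).
have t00 : 0 < t0.
  by rewrite lt_min ltr01/= divr_gt0// !mulr_gt0 ?expR_gt0// exprn_gt0.
(* With e1 m <= s0, e2 m <= G / (delta L) and u^2 <= 4 L, the quantity 2 r u^2 is at most 8 s0 G /
   delta <= t0. *)
pose s0 := Num.min (1 / 2) (t0 * delta / (8 * G)).
have s00 : 0 < s0.
  by rewrite lt_min divr_gt0//= divr_gt0// mulr_gt0.
have [m0 Hm0] : exists m0 : nat, forall n, (m0 <= n)%N -> e1 n <= s0.
  have : \forall n \near \oo, e1 n <= s0 by apply: (cvgr_le 0) (wd1_lim W) _ s00.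
  by case=> m0 _ H; exists m0 => n mn; exact: H.
pose B1 := 30 * C * expR ((3 / 2 + 2 * delta) * A) / eps'.
pose B3 := 3 * K * expR (2 * A) / eps'.
have B10 : 0 <= B1 by rewrite divr_ge0 ?(ltW eps'0)// !mulr_ge0 ?expR_ge0//; lra.
have B30 : 0 <= B3 by rewrite divr_ge0 ?(ltW eps'0)// !mulr_ge0 ?expR_ge0//; lra.
have m00 : 0 <= m0%:R / delta by rewrite divr_ge0// ltW.
have B1d : 0 <= B1 / delta by rewrite divr_ge0// ltW.
exists (1 + `|A| + `|ln eps| + m0%:R / delta + B1 / delta + B3) => n1 n2 u n10 n20.
set N : R := (n1 * n2)%:R; set L := ln N => L0L n12 n21 u1 /andP[epsQ QK].
have N0 : 0 < N by rewrite ltr0n muln_gt0 n10.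
have NE : N = expR L by rewrite /L lnK.
have Q0 : 0 < Q u by rewrite ntail_gt0.
have nA := normr_ge0 A; have nE := normr_ge0 (ln eps).
have L0 : 1 <= L by lra.
have AL : A <= L by have := ler_norm A; lra.
have eL : - ln eps <= L by have := ler_norm (- ln eps); rewrite normrN; lra.
have mL : m0%:R <= delta * L by rewrite mulrC -ler_pdivrMr//; lra.
have B1L : B1 <= delta * L by rewrite mulrC -ler_pdivrMr//; lra.
have B3L : B3 <= L by lra.
have lnQ : - ln (Q u) >= L - ln K.
  have : ln (N * Q u) <= ln K by rewrite ler_ln ?posrE ?mulr_gt0.
  by rewrite lnM ?posrE// -/L; lra.
have Lv : L - A <= (1 + delta) * (u ^+ 2 / 2) by have := HD u u1; rewrite /A; lra.
have u2 : u ^+ 2 <= 4 * L.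
  have : ln eps <= ln (N * Q u) by rewrite ler_ln ?posrE ?mulr_gt0.
  rewrite lnM ?posrE// -/L; have := ln_ntail_le u1; lra.
(* m is about N^delta: small enough for few near pairs, and with ln m >= delta L large enough for e2
   m to be of order 1 / ln N. *)
pose m := (Num.truncn (expR (delta * L))).+1.
have e1L : 1 <= expR (delta * L) by rewrite -[leLHS]expR0 ler_expR mulr_ge0//; lra.
have eLm : expR (delta * L) <= m%:R by rewrite ltW// truncnS_gt.
have m2L : m%:R <= 2 * expR (delta * L).
  have : (Num.truncn (expR (delta * L)))%:R <= expR (delta * L).
    by rewrite truncn_le expR_ge0.
  by rewrite /m -natr1; lra.
have m1 : (1 < m)%N.
  by rewrite /m ltnS truncn_gt0.
have lnm : delta * L <= ln m%:R.
  by rewrite -[leLHS]expRK ler_ln// ?posrE ?expR_gt0 ?ltr0n.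
have m0m : (m0 <= m)%N.
  rewrite -(@ler_nat R) (le_trans mL)// (le_trans _ eLm)//.
  by rewrite (le_trans _ (expR_ge1Dx _))// lerDr.
have e1s := Hm0 _ m0m.
have e10 := wd1_ge0 W m; have e20 := wd2_ge0 W m.
have e21 : e2 m <= 1 by rewrite -(wd20 W); apply: (wd2_ni W).
have r12 : e1 m * e2 m <= 1 / 2.
  rewrite -[leRHS]mulr1 ler_pM// (le_trans e1s)// ge_min lexx//.
exists m; split => //.
have T1 : N * ((2 * m).+1%:R * (n1 + n2)%:R) * near_bound rho u <= eps' / 3.
  have -> : near_bound rho u = expR (- (kappa * (u ^+ 2 / 2))).
    rewrite /near_bound /kappa; congr (expR (- _)); field.
    by rewrite gt_eqF//; move: rho0; lra.
  apply: (le_trans (near_term C1 _ AL n10 n20 n12 n21 NE m2L Lv)); first by lra.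
  rewrite expRN ler_pdivrMr ?expR_gt0// mulrC.
  have : B1 <= expR (delta * L) by have := expR_ge1Dx (delta * L); lra.
  rewrite /B1 ler_pdivrMr//; lra.
have T2 : N ^+ 2 * (Q u * (Q (u - 2 * (e1 m * e2 m) * u) - Q u)) <= eps' / 3.
  apply: (@le_trans _ _ (K ^+ 2 * expR (5 / 2) * t0)).
    apply: far_term => //; rewrite ?(ltW K0)// ?mulr_ge0//.
    - by lra.
    - have u00 : 0 <= u by lra.
      have L0' : 0 < delta * L by rewrite mulr_gt0//; lra.
      have e2m : e2 m <= G / (delta * L).
        rewrite ler_pdivlMr// (le_trans _ (wd2_ln W m1))// ler_wpM2l//.
      have es : e1 m <= t0 * delta / (8 * G) by rewrite (le_trans e1s)// ge_min lexx orbT.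
      apply: (@le_trans _ _ (2 * (t0 * delta / (8 * G) * (G / (delta * L))) * (4 * L))).
        apply: ler_pM; rewrite ?mulr_ge0 ?sqr_ge0//.
        by apply: ler_wpM2l => //; exact: ler_pM.
      rewrite le_eqVlt; apply/orP; left; apply/eqP; field.
      by rewrite !gt_eqF//=; lra.
    - by rewrite ge_min lexx.
  have : t0 <= eps' / (3 * K ^+ 2 * expR (5 / 2)) by rewrite ge_min lexx orbT.
  rewrite ler_pdivlMr ?mulr_gt0 ?exprn_gt0 ?expR_gt0//; lra.
have T3 : N ^+ 2 * Q (2 * u) <= eps' / 3.
  apply: (le_trans (double_term u1 (ltW K0) NE QK AL Lv)).
  rewrite expRN ler_pdivrMr ?expR_gt0// mulrC.
  have : B3 <= expR L by have := expR_ge1Dx L; lra.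
  rewrite /B3 ler_pdivrMr//; lra.
by rewrite /far_bound mulrDr; lra.
Qed.

End sector_asymptotics.

Section sector.
Context (R : realType) (e1 e2 : nat -> R) (rho G : R).
Hypothesis W : weak_decay e1 e2 rho G.
Context d (T : measurableType d) (P : probability T R) (X : nat * nat -> T -> R).
Hypothesis gX : gaussian_family P X (cgrid e1 e2).
Notation Phi := (@standard_normal_df R).
Notation Q := (@ntail R).

Lemma pmax_nondecreasing l : {homo (pmax P X)^~ l : u v / u <= v}.
Proof.
move=> u v uv; have [mX _ _] := gX; rewrite !pmaxE.
have ma x : measurable [set w | all (fun k => X k w <= x) l].
  have := @measurable_box R _ _ _ X [seq (k, x) | k <- l] mX.
  by rewrite (_ : mkset _ = [set w | all (fun k => X k w <= x) l])//;
    apply/seteqP; split => w /=; rewrite /box all_map.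
apply: le_Ex; [exact: bmeas_bool|exact: bmeas_bool|move=> w].
rewrite ler_nat; case: (boolP (all (fun k => X k w <= u) l)) => // /allP H.
rewrite (_ : all _ _)//; apply/allP => k kl; exact: le_trans (H k kl) uv.
Qed.

Lemma pmax_le1 u l : pmax P X u l <= 1.
Proof.
have [mX _ _] := gX; rewrite /pmax -[leRHS](Ex_cst P); apply: le_Ex.
- by apply: bmeas_bool; exact: measurable_box.
- exact: bmeas_cst.
- by move=> w; case: box.
Qed.

(** Three ranges of x. If N Q(x) <= e, both terms are close to 1, by Bernoulli's inequality. If e <=
    N Q(x) <= K, the pair sum is small. Otherwise x lies below the level [xK] with N Q = K, and by
    monotonicity both terms are small, since exp(- K) = e. *)
Theorem sector_uniform (C eps : R) : 1 <= C -> 0 < eps ->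
  exists L0 : R, forall n1 n2 : nat, (0 < n1)%N -> (0 < n2)%N ->
  L0 <= ln (n1 * n2)%:R -> n1%:R <= C * n2%:R -> n2%:R <= C * n1%:R ->
  forall x, `|pmax P X x (grid n1 n2) - Phi x ^+ (n1 * n2)| <= eps.
Proof.
move=> C1 eps0.
wlog eps1 : eps eps0 / eps < 1.
  move=> H; have [|/(H eps eps0)//] := leP 1 eps.
  move=> e1'; have [||L0 HL] := H (1 / 2); [lra|lra|].
  exists L0 => n1 n2 n10 n20 h1 h2 h3 x; apply: (le_trans (HL _ _ n10 n20 h1 h2 h3 x)); lra.
pose e := eps / 2; pose K := - ln e.
have e0 : 0 < e by rewrite /e; lra.
have K0 : 0 < K by rewrite /K oppr_gt0 ln_lt0// e0/= /e; lra.
have eK : expR (- K) = e by rewrite /K opprK lnK.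
have [L0 HL] := grid_sum_small W C1 K0 e0 e0.
have Q1 : 0 < Q 1 by rewrite ntail_gt0.
exists (Num.max L0 (ln (K / Q 1) + 1)) => n1 n2 n10 n20.
rewrite ge_max => /andP[L0L L1L] n12 n21 x.
set N := (n1 * n2)%N in L0L L1L *.
have N0 : (0 < N)%N by rewrite muln_gt0 n10.
have NR0 : 0 < N%:R :> R by rewrite ltr0n.
have NK : K < N%:R * Q 1.
  rewrite -ltr_pdivrMr// -(@ltr_ln R) ?posrE ?divr_gt0//; lra.
have Qu1 u : N%:R * Q u <= K -> 1 <= u.
  move=> h; rewrite leNgt; apply/negP => u1.
  have := @ntail_nonincreasing R _ _ (ltW u1); rewrite -(ler_pM2l NR0); lra.
have size_g : size (grid n1 n2) = N by rewrite size_grid.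
have PS u : e <= N%:R * Q u <= K -> pmax P X u (grid n1 n2) - Phi u ^+ N <= e.
  move=> /[dup] h /andP[_ /Qu1 u1].
  have [m [r2 H]] := HL n1 n2 u n10 n20 L0L n12 n21 u1 h.
  have u0 : 0 <= u by lra.
  have /andP[_] := pmax_bound gX (cgrid1 W) (cgrid_ge0 W) u (grid n1 n2).
  rewrite size_g => /le_trans; apply.
  exact: le_trans (pair_sum_grid W gX n1 n2 u0 r2) H.
have Phi0 := @standard_normal_df_ge0 R x; have Phi1 := @standard_normal_df_le1 R x.
have /andP[D0 _] := pmax_bound gX (cgrid1 W) (cgrid_ge0 W) x (grid n1 n2).
rewrite size_g in D0; rewrite ger0_norm//.
have [small|big] := leP (N%:R * Q x) e.
  have bern : 1 - N%:R * Q x <= Phi x ^+ N.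
    have -> : Phi x = 1 - Q x by rewrite /ntail subKr.
    have : 0 <= Q x <= 1 by rewrite ntail_ge0 ntail_le1.
    elim: N {N0 NR0 L0L L1L NK Qu1 size_g PS D0 small} => [|n IH] /andP[q0 q1].
      by rewrite mul0r subr0 expr0.
    rewrite exprS -natr1 (@le_trans _ _ ((1 - Q x) * (1 - n%:R * Q x)))//.
      have : 0 <= n%:R * Q x * Q x by rewrite !mulr_ge0.
      by lra.
    by rewrite ler_wpM2l ?subr_ge0// IH// q0.
  by have := pmax_le1 x (grid n1 n2); rewrite /e in small *; lra.
have [mid|large] := leP (N%:R * Q x) K.
  by apply: (le_trans (PS x _)); rewrite ?mid ?(ltW big)// /e; lra.
have [xK HxK] : exists u, Q u = K / N%:R.
  apply: ntail_surj; rewrite divr_gt0//= ltr_pdivrMr// mul1r.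
  apply: (lt_le_trans NK); rewrite ler_piMr ?ler0n// ntail_le1//.
have NxK : N%:R * Q xK = K by rewrite HxK mulrC divfK// gt_eqF.
have xxK : x <= xK.
  rewrite leNgt; apply/negP => /ltW/(@ntail_nonincreasing R).
  by rewrite -(ler_pM2l NR0) NxK; lra.
have PxK : Phi xK ^+ N <= e.
  rewrite -eK -NxK.
  have -> : - (N%:R * Q xK) = (- Q xK) * N%:R by ring.
  rewrite expRM_natr ler_pXn2r ?nnegrE ?expR_ge0 ?standard_normal_df_ge0//.
  by apply: le_trans (expR_ge1Dx _); rewrite /ntail opprB addrC subrK.
have := PS xK; rewrite NxK lexx andbT => PSK.
have eK' : e <= K.
  have : ln (1 + (e - 1)) <= e - 1 by apply: le_ln1Dx; lra.
  by rewrite addrC subrK /K; move: eps1; rewrite /e; lra.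
have := PSK eK'; have := pmax_nondecreasing (grid n1 n2) xxK => /=.
have : 0 <= Phi x ^+ N by rewrite exprn_ge0.
by move: PxK; rewrite /e; lra.
Qed.

End sector.

(** * Elongated boxes *)

Section gvar_scale.
Context (R : realType) (I : Type) (c : I -> I -> R).

Lemma gvar_scale (t : R) s : gvar c [seq (t * p.1, p.2) | p <- s] = t ^+ 2 * gvar c s.
Proof.
rewrite /gvar big_map mulr_sumr; apply: eq_bigr => p _.
rewrite big_map mulr_sumr; apply: eq_bigr => q _ /=; ring.
Qed.

Lemma lin_scale (T : Type) (X : I -> T -> R) (t : R) s w :
  lin X [seq (t * p.1, p.2) | p <- s] w = t * lin X s w.
Proof. by rewrite /lin big_map mulr_sumr; apply: eq_bigr => p _ /=; rewrite mulrA. Qed.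

End gvar_scale.

Section clustering.
Context (R : realType) (I : eqType) (c : I -> I -> R).
Context d (T : measurableType d) (P : probability T R) (X : I -> T -> R).
Hypothesis gX : gaussian_family P X c.
Hypothesis c1 : forall k, c k k = 1.
Notation gam := (stdn R).
Notation Q := (@ntail R).

(* On the event lin X s <= 0, of probability at least 1 / 2, X k > u forces the residual
   of X k with respect to lin X s above u; its variance is at most 1 - b^2 / V. *)
Lemma pmax_clustering (s : seq (R * I)) (l : seq I) (b V u : R) : 0 < b -> 0 < V -> 0 <= u ->
  gvar c s <= V -> (forall k, k \in l -> b <= \sum_(p <- s) p.1 * c p.2 k) ->
  1 / 2 <= pmax P X u l + (size l)%:R * Q u * expR (- (b ^+ 2 / V / 2 * u ^+ 2)).
Proof.
move=> b0 V0 u0 gV Hb; have [mX csym gs] := gX.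
pose r := b ^+ 2 / V.
have r0 : 0 <= r by rewrite divr_ge0 ?sqr_ge0// ltW.
pose beta k := \sum_(p <- s) p.1 * c p.2 k.
pose t k := beta k / gvar c s.
pose res k := (1, k) :: [seq (- t k * p.1, p.2) | p <- s].
have res_var k : k \in l -> 0 < gvar c s /\ gvar c (res k) <= 1 - r.
  move=> kl; have bk : b <= beta k by exact: Hb.
  (* The variance of lin X s - beta k X k is gvar c s - beta k^2, and it is non-negative. *)
  have sv0 : 0 < gvar c s.
    have [] := gs ((- beta k, k) :: s); rewrite gvar_cons// -/(beta k) c1 mulr1 => + _.
    have : 0 < beta k ^+ 2 by rewrite exprn_gt0//; lra.
    by rewrite sqrrN expr2; lra.
  split => //; rewrite gvar_cons// c1 gvar_scale big_map expr1n mulr1.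
  rewrite (_ : \sum_(p <- s) _ = - t k * beta k); last first.
    by rewrite mulr_sumr; apply: eq_bigr => p _ /=; rewrite mulrA.
  rewrite [leLHS](_ : _ = 1 - beta k ^+ 2 / gvar c s); last first.
    by rewrite /t -/(beta k); field; rewrite gt_eqF.
  rewrite lerD2l lerN2 /r ler_pM ?sqr_ge0 ?invr_ge0 ?(ltW V0)//.
    by rewrite lerXn2r// nnegrE; lra.
  by rewrite lef_pV2.
have tail k : k \in l -> Ex P (fun w => (u < lin X (res k) w)%R%:R) <=
    Q u * expR (- (r / 2 * u ^+ 2)).
  move=> kl; have [_ v1] := res_var k kl; have [v0 _] := gs (res k).
  rewrite (Ex_gt gX).
  (* As sqrt(1 - r) <= 1 - r / 2 and (1 - r / 2)(1 + r / 2) <= 1, a residual above u forces z > u +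
     r u / 2. *)
  apply: (@le_trans _ _ (Q (u + r / 2 * u))).
    rewrite ntailE; apply: le_Ex.
    - by apply: bmeas_bool; apply: measurable_gt_cst; exact: measurable_funM.
    - by apply: bmeas_bool; apply: (@measurable_gt_cst R _ (measurableTypeR R) idfun); exact: measurable_id.
    move=> z; rewrite ler_nat; case: (leP z (u + r / 2 * u)) => zu; last by case: (_ < _)%R.
    rewrite ltNge (_ : _ <= u)//; set q := Num.sqrt _.
    have q0 : 0 <= q by exact: sqrtr_ge0.
    have r1 : r <= 1 by lra.
    have q1 : q <= 1 - r / 2.
      rewrite /q -[leRHS]ger0_norm; last by lra.
      by rewrite -sqrtr_sqr ler_wsqrtr//; have := sqr_ge0 r; rewrite !expr2; lra.
    apply: (@le_trans _ _ ((1 - r / 2) * (u + r / 2 * u))); last first.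
      have := mulr_ge0 (mulr_ge0 r0 r0) u0.
      by lra.
    have w0 : 0 <= u + r / 2 * u by have := mulr_ge0 r0 u0; lra.
    by apply: (le_trans (ler_wpM2l q0 zu)); rewrite ler_wpM2r.
  have h0 : 0 <= r / 2 * u by rewrite mulr_ge0// divr_ge0.
  apply: (le_trans (ntailD u0 h0)); rewrite mulrC ler_wpM2l ?ntail_ge0// ler_expR lerN2.
  rewrite (_ : u * _ = r / 2 * u ^+ 2); last by rewrite expr2; ring.
  by rewrite lerDl divr_ge0 ?sqr_ge0.
have bg k : bmeas (fun w => (u < lin X (res k) w)%R%:R : R).
  by apply: bmeas_bool; apply: measurable_gt_cst; exact: measurable_lin.
have bl : bmeas (fun w => (lin X s w <= 0)%R%:R : R).
  by apply: bmeas_bool; apply: measurable_le_cst; exact: measurable_lin.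
have bx l' : bmeas (fun w => (box X [seq (k, u) | k <- l'] w)%:R : R).
  by apply: bmeas_bool; exact: measurable_box.
have H : 1 / 2 <= Ex P (fun w => (box X [seq (k, u) | k <- l] w)%:R +
    \sum_(k <- l) (u < lin X (res k) w)%R%:R).
  apply: (@le_trans _ _ (Ex P (fun w => (lin X s w <= 0)%R%:R))).
    by rewrite (Ex_le gX); exact: half_le_stdn.
  apply: le_Ex => //; first by apply: bmeasD => //; exact: bmeas_sum.
  move=> w; case: (leP (lin X s w) 0) => ws; last first.
    by rewrite addr_ge0// sumr_ge0.
  have : forall k, k \in l -> u < X k w -> u < lin X (res k) w.
    move=> k kl uX; have [sv0 _] := res_var k kl.
    apply: (lt_le_trans uX); rewrite lin_cons/= mul1r lin_scale lerDl.
    rewrite mulr_le0// oppr_le0 /t divr_ge0// ?ltW//.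
    by have := Hb k kl; rewrite -/(beta k); lra.
  elim: (l) => [|k l' IH] Hl; first by rewrite /= lerDl big_nil.
  rewrite big_cons /=; case: (leP (X k w) u) => Xu /=.
    rewrite addrCA (le_trans (IH _)) ?lerDr// => k' kl'.
    by apply: Hl; rewrite inE kl' orbT.
  rewrite (Hl k (mem_head _ _) Xu) add0r lerDl; exact: sumr_ge0.
rewrite (ExD P (bx l)) in H; last exact: bmeas_sum.
rewrite (Ex_sum P l bg) in H; apply: (le_trans H); rewrite lerD2l -/r.
rewrite -mulrA; elim: (l) tail => [|k l' IH] tail; first by rewrite big_nil mul0r.
rewrite big_cons /= -natr1 mulrDl mul1r addrC lerD// ?tail ?mem_head//.
by apply: IH => k' kl'; apply: tail; rewrite inE kl' orbT.
Qed.

End clustering.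

Section box_clustering.
Context (R : realType) (e1 e2 : nat -> R) (rho G : R).
Hypothesis W : weak_decay e1 e2 rho G.
Hypothesis e1_ln : e1 n * ln n%:R @[n --> \oo] --> +oo.
Hypothesis e1_sq : \forall n \near \oo, e1 n <= 2 * e1 (n * n)%N.
Hypothesis e2_gt0 : forall n, 0 < e2 n.
Context d (T : measurableType d) (P : probability T R) (X : nat * nat -> T -> R).
Hypothesis gX : gaussian_family P X (cgrid e1 e2).
Notation Q := (@ntail R).

(* The average of X over q points of the first row, at mutual distance q *)
Let comb (q : nat) : seq (R * (nat * nat)) :=
  [seq (q%:R^-1, ((i * q)%N, 1%N)) | i <- iota 1 q].

(** The diagonal contributes 1 / q; distinct points are at distance at least q, so the other terms
    average to at most e1 q. *)
Let comb_var (q : nat) : (0 < q)%N -> gvar (cgrid e1 e2) (comb q) <= q%:R^-1 + e1 q.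
Proof.
move=> q0; have q0R : 0 < q%:R :> R by rewrite ltr0n.
rewrite /gvar big_map.
apply: (@le_trans _ _ (\sum_(i <- iota 1 q) (q%:R^-1 ^+ 2 + q%:R^-1 * e1 q))).
  rewrite big_seq [leRHS]big_seq; apply: ler_sum => i; rewrite mem_iota => iq.
  rewrite big_map (bigD1_seq i)/= ?iota_uniq ?mem_iota//; apply: lerD.
    by rewrite (cgrid1 W) mulr1 expr2.
  apply: (@le_trans _ _ (\sum_(j <- iota 1 q) q%:R^-1 ^+ 2 * e1 q)).
    rewrite big_mkcond/=; apply: ler_sum => j _; case: ifP => ji; last first.
      by rewrite mulr_ge0 ?sqr_ge0 ?(wd1_ge0 W).
    rewrite -expr2 ler_wpM2l ?sqr_ge0// /cgrid/= /nat_dist subnn (wd20 W) mulr1.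
    apply: (wd1_ni W); rewrite -!mulnBl -mulnDl leq_pmull//.
    by move: ji; lia.
  rewrite sumr_const_size size_iota -[leLHS]mulr_natl mulrA expr2 mulrA mulfV ?gt_eqF//.
  by rewrite mul1r.
rewrite sumr_const_size size_iota -[leLHS]mulr_natl le_eqVlt; apply/orP; left; apply/eqP.
by field; rewrite gt_eqF.
Qed.

Let comb_cov (q p : nat) k : (0 < q)%N -> k \in grid (q * q) (p * p) ->
  e1 (q * q)%N * e2 (p * p)%N <= \sum_(x <- comb q) x.1 * cgrid e1 e2 x.2 k.
Proof.
move=> q0 /allpairsP[[a b]/= [+ + ->]]; rewrite !mem_iota => ha hb.
have q0R : 0 < q%:R :> R by rewrite ltr0n.
rewrite big_map/=.
apply: (@le_trans _ _ (\sum_(i <- iota 1 q) q%:R^-1 * (e1 (q * q)%N * e2 (p * p)%N))).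
  by rewrite sumr_const_size size_iota -[leRHS]mulr_natl mulVKf// gt_eqF.
rewrite big_seq [leRHS]big_seq; apply: ler_sum => i; rewrite mem_iota => iq.
rewrite ler_wpM2l ?invr_ge0 ?ler0n// /cgrid/=.
apply: ler_pM; rewrite ?(wd1_ge0 W) ?(wd2_ge0 W)//.
  apply: (wd1_ni W); rewrite /nat_dist.
  have h1 : (i * q <= q * q)%N by rewrite leq_mul2r; lia.
  have h2 : (1 <= i * q)%N by rewrite muln_gt0; lia.
  by move: ha; lia.
by apply: (wd2_ni W); rewrite /nat_dist; lia.
Qed.

(** [pmax_clustering] with b = e1(q^2) E and V = 2 e1 q. The exponent is at least e1 q E^2 u^2 / 16
    with u^2 >= ln q, so it tends to infinity; once it exceeds ln(4 K), the exceedances cost at most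
    1 / 4 of the probability 1 / 2. *)
Theorem box_clustering (p : nat) (K : R) : (0 < p)%N -> 0 < K ->
  \forall q \near \oo, forall u, (q * q * (p * p))%:R * Q u = K ->
    1 / 4 <= pmax P X u (grid (q * q) (p * p)).
Proof.
move=> p0 K0; set E := e2 (p * p)%N; have E0 : 0 < E by exact: e2_gt0.
have [D HD] := @ln_ntail_ge R 1 ltr01.
have Q1 : 0 < Q 1 by rewrite ntail_gt0.
have lny : ln (n%:R : R) @[n --> \oo] --> +oo.
  apply/cvgryPge => A; near=> n.
  have n0 : 0 < n%:R :> R by rewrite ltr0n; near: n; exact: nbhs_infty_gt.
  rewrite -[leLHS]expRK ler_ln ?posrE ?expR_gt0//.
  by near: n; exact: nbhs_infty_ger.
near=> q => u NQ.
have q0 : (0 < q)%N by near: q; exact: nbhs_infty_gt.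
have q0R : 0 < q%:R :> R by rewrite ltr0n.
have lq1 : 1 <= ln (q%:R : R) by near: q; apply: cvgry_ge lny _.
have lqc : ln K + D <= ln (q%:R : R) by near: q; apply: cvgry_ge lny _.
have lqK : ln (K / Q 1) <= ln (q%:R : R) by near: q; apply: cvgry_ge lny _.
have el1 : 1 <= e1 q * ln q%:R by near: q; apply: cvgry_ge e1_ln _.
(* The constant 16: b^2 / V / 2 = e1(q^2)^2 E^2 / (4 e1 q), where e1(q^2) >= e1 q / 2. *)
have elK : 16 * `|ln (4 * K)| / E ^+ 2 <= e1 q * ln q%:R.
  by near: q; apply: cvgry_ge e1_ln _.
have esq : e1 q <= 2 * e1 (q * q)%N by near: q; exact: e1_sq.
have N0 : 0 < (q * q * (p * p))%:R :> R by rewrite ltr0n !muln_gt0 q0 p0.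
have p1R : 1 <= p%:R :> R by rewrite ler1n.
have lnN : 2 * ln q%:R <= ln (q * q * (p * p))%:R :> R.
  rewrite (_ : 2 * _ = ln (q%:R * q%:R)); last by rewrite lnM ?posrE//; ring.
  by rewrite ler_ln ?posrE ?mulr_gt0// -natrM ler_nat leq_pmulr// muln_gt0 p0.
have u1 : 1 <= u.
  rewrite leNgt; apply/negP => u1.
  have := @ntail_nonincreasing R _ _ (ltW u1) => Qu.
  have h : (q * q * (p * p))%:R <= K / Q 1.
    by rewrite ler_pdivlMr// -NQ ler_wpM2l// ltW.
  have := lnN; have : ln (q * q * (p * p))%:R <= ln (K / Q 1).
    by rewrite ler_ln ?posrE ?divr_gt0.
  by lra.
have Qu0 : 0 < Q u by rewrite ntail_gt0.
have u2 : ln q%:R <= u ^+ 2.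
  have := HD u u1; have : ln K = ln (q * q * (p * p))%:R + ln (Q u).
    by rewrite -NQ lnM ?posrE.
  by lra.
have e1q : 0 < e1 q.
  by have := wd1_ge0 W q; rewrite le_eqVlt => /predU1P[h|//]; move: el1; rewrite -h mul0r; lra.
have iq : q%:R^-1 <= e1 q.
  rewrite -[leLHS]mul1r ler_pdivrMr//; apply: (le_trans el1).
  by rewrite ler_wpM2l ?(ltW e1q)// ltW// ln_sublinear.
have b0 : 0 < e1 (q * q)%N * E by rewrite mulr_gt0//; lra.
have V0 : 0 < 2 * e1 q by lra.
have gV : gvar (cgrid e1 e2) (comb q) <= 2 * e1 q.
  by apply: (le_trans (comb_var q0)); lra.
have u0 : 0 <= u by lra.
have := @pmax_clustering R _ _ _ _ _ _ gX (cgrid1 W) (comb q) (grid (q * q) (p * p))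
  _ _ u b0 V0 u0 gV.
move=> /(_ (fun k => @comb_cov q p k q0)); rewrite size_grid NQ.
set X1 := expR _; suff X1s : K * X1 <= 1 / 4 by lra.
have step : ln (4 * K) <= (e1 (q * q)%N * E) ^+ 2 / (2 * e1 q) / 2 * u ^+ 2.
  apply: (@le_trans _ _ (e1 q * E ^+ 2 / 16 * u ^+ 2)).
    apply: (@le_trans _ _ (E ^+ 2 / 16 * (e1 q * ln q%:R))).
      move: elK; rewrite ler_pdivrMr ?exprn_gt0//; have := ler_norm (ln (4 * K)).
      by lra.
    rewrite (_ : _ * E ^+ 2 / 16 * _ = E ^+ 2 / 16 * (e1 q * u ^+ 2)); last by ring.
    by rewrite ler_wpM2l ?divr_ge0 ?sqr_ge0// ler_wpM2l// ltW.
  rewrite ler_wpM2r ?sqr_ge0//.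
  rewrite (_ : _ / _ / 2 = e1 (q * q)%N ^+ 2 * E ^+ 2 / (4 * e1 q)); last by field; rewrite gt_eqF.
  rewrite ler_pdivlMr ?mulr_gt0//.
  have : e1 q ^+ 2 <= (2 * e1 (q * q)%N) ^+ 2 by rewrite lerXn2r ?nnegrE//; lra.
  move=> /(ler_wpM2r (sqr_ge0 E)); rewrite !expr2; lra.
rewrite /X1 expRN ler_pdivrMr ?expR_gt0//.
have : 4 * K <= expR ((e1 (q * q)%N * E) ^+ 2 / (2 * e1 q) / 2 * u ^+ 2).
  by rewrite -[leLHS]lnK ?posrE ?mulr_gt0// ler_expR.
lra.
Unshelve. all: end_near. Qed.

End box_clustering.

(** * Convex sequences are covariance functions *)

Section nat_probability.
Context (R : realType) (w : nat -> R).
Hypothesis w0 : forall n, 0 <= w n.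
Hypothesis w1 : series w @ \oo --> (1 : R).

Definition nat_measure : set nat -> \bar R :=
  mseries (fun n => mscale (NngNum (w0 n)) (\d_n : {measure set nat -> \bar R})) 0.

HB.instance Definition _ := Measure.on nat_measure.

Lemma ge0_integral_nat_measure (f : nat -> R) : (forall n, 0 <= f n) ->
  (\int[nat_measure]_n (f n)%:E = \sum_(n <oo) (w n * f n)%:E)%E.
Proof.
move=> f0; rewrite /nat_measure ge0_integral_measure_series//; last first.
  by move=> n _; rewrite lee_fin.
apply: eq_eseriesr => n _.
rewrite ge0_integral_mscale//; last by move=> k _; rewrite lee_fin.
by rewrite integral_dirac// diracT mul1e EFinM.
Qed.

Lemma cvg_ge0_integral_nat_measure (f : nat -> R) (l : R) : (forall n, 0 <= f n) ->
  series (fun n => w n * f n) @ \oo --> l -> (\int[nat_measure]_n (f n)%:E = l%:E)%E.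
Proof.
move=> f0 H; rewrite ge0_integral_nat_measure//.
apply/cvg_lim => //.
rewrite (_ : (fun _ => _) = EFin \o series (fun n => w n * f n)); last first.
  by apply/funext => n; rewrite /= /series /= sumEFin.
by apply: cvg_EFin; [exact: nearW|exact: H].
Qed.

Lemma nat_measureT : nat_measure setT = 1%E.
Proof.
have := @cvg_ge0_integral_nat_measure (fun=> 1) 1 (fun=> ler01).
rewrite (_ : (fun n => w n * 1) = w); last by apply/funext => n; rewrite mulr1.
by move=> /(_ w1); rewrite integral_cst// mul1e.
Qed.

HB.instance Definition _ := Measure_isProbability.Build _ _ _ nat_measure nat_measureT.

Definition nat_probability : probability nat R := nat_measure.

Lemma bmeas_nat (f : nat -> R) (M : R) : (forall n, `|f n| <= M) -> bmeas f.
Proof. by move=> fM; split => //; exists M. Qed.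

Lemma Ex_nat_probability (f : nat -> R) (M l : R) : (forall n, `|f n| <= M) ->
  series (fun n => w n * f n) @ \oo --> l -> Ex nat_probability f = l.
Proof.
move=> fM H.
have bf := bmeas_nat fM.
suff : Ex nat_probability (fun n => f n + M) = l + M.
  by rewrite (ExD nat_probability bf (bmeas_cst _ M)) Ex_cst => /addIr.
have f0 n : 0 <= f n + M by have := fM n; rewrite ler_norml => /andP[]; lra.
rewrite /Ex /Rintegral (@cvg_ge0_integral_nat_measure _ (l + M))//.
rewrite (_ : series _ = series (fun n => w n * f n) \+ (fun n => M * series w n)); last first.
  apply/funext => n; rewrite /series /= mulr_sumr -big_split/=.
  by apply: eq_bigr => i _; rewrite mulrDr [w i * M]mulrC.
by apply: cvgD => //; rewrite -[X in _ --> X]mulr1; apply: cvgM => //; exact: cvg_cst.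
Qed.

End nat_probability.

Section density_probability.
Context (R : realType) (g : R -> R).
Notation mu := (@lebesgue_measure R).
Hypothesis mg : measurable_fun setT g.
Hypothesis g0 : forall x, 0 <= g x.
Hypothesis g1 : (\int[mu]_x (g x)%:E = 1)%E.

Definition density_measure (A : set (measurableTypeR R)) : \bar R :=
  (\int[mu]_(x in A) (g x)%:E)%E.

Let mEg : measurable_fun setT (EFin \o g). Proof. exact/measurable_EFinP. Qed.

Let ig : mu.-integrable setT (EFin \o g).
Proof.
apply/integrableP; split => //.
by under eq_integral do rewrite /= ger0_norm//; rewrite g1 ltry.
Qed.

Let density0 : density_measure set0 = 0%E.
Proof. by rewrite /density_measure integral_set0. Qed.

Let density_ge0 A : (0 <= density_measure A)%E.
Proof. by apply: integral_ge0 => x _; rewrite lee_fin. Qed.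

Let density_sigma_additive : semi_sigma_additive density_measure.
Proof.
move=> A mA tA mUA; rewrite /density_measure integral_bigcup//; last first.
  by apply: (integrableS _ _ (subsetT _) ig).
apply: is_cvg_ereal_nneg_natsum_cond => n _ _.
by apply: integral_ge0 => x _; rewrite lee_fin.
Qed.

HB.instance Definition _ := isMeasure.Build _ _ _ density_measure
  density0 density_ge0 density_sigma_additive.

Let densityT : density_measure setT = 1%E. Proof. exact: g1. Qed.

HB.instance Definition _ := Measure_isProbability.Build _ _ _ density_measure densityT.

Definition density_probability : probability (measurableTypeR R) R := density_measure.

Let dom : density_probability `<< mu.
Proof.
apply/null_content_dominatesP => A mA muA0.
by apply: null_set_integral => //; exact: measurable_funTS.
Qed.

Lemma ge0_integral_density (f : R -> R) : measurable_fun setT f -> (forall x, 0 <= f x) ->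
  (\int[density_probability]_x (f x)%:E = \int[mu]_x (f x * g x)%:E)%E.
Proof.
move=> mf f0.
have mEf : measurable_fun setT (fun x : R => (f x)%:E) by exact/measurable_EFinP.
rewrite -(Radon_Nikodym_SigmaFinite.change_of_variables dom)//.
have intRN := Radon_Nikodym_SigmaFinite.f_integrable dom.
apply: ae_eq_integral => //.
- by apply: emeasurable_funM => //; exact: measurable_int intRN.
- by apply/measurable_EFinP; exact: measurable_funM.
- under [X in ae_eq _ _ _ X]eq_fun do rewrite EFinM.
  apply: ae_eqe_mul2l; apply: integral_ae_eq => //.
  by move=> E _ mE; rewrite -Radon_Nikodym_SigmaFinite.f_integral.
Qed.

End density_probability.

(** * The Fejer law and its triangular characteristic function *)

Section triangular.
Context (R : realType).
Notation mu := (@lebesgue_measure R).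

(* At x = 0 the quotient is 0, which does not affect the integrals. *)
Definition fejer (a x : R) : R := (1 - cos (a * x)) / x ^+ 2.

Lemma fejer_ge0 a x : 0 <= fejer a x.
Proof. by rewrite divr_ge0 ?sqr_ge0// subr_ge0 cos_le1. Qed.

Lemma measurable_fejer a : measurable_fun setT (fejer a).
Proof.
apply: measurable_funM; last first.
  rewrite (_ : (fun x => _) = (fun x : R => (x ^+ 2) `^ (-1))); last first.
    by apply/funext => x; rewrite powR_inv1// sqr_ge0.
  by apply: (@measurableT_comp _ _ _ _ _ _ (fun y : R => y `^ (-1)) _ (fun x : R => x ^+ 2)); [exact: measurable_powR|exact: measurable_funX].
by apply: measurable_funB => //; apply: (bmeas_cos _).1; exact: measurable_funM.
Qed.

Lemma norm_sin_le (x : R) : `|sin x| <= `|x|.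
Proof.
wlog x0 : x / 0 < x => [H|].
  have [/H//|xn|<-] := ltgtP 0 x; last by rewrite sin0 normr0.
  by rewrite -normrN -sinN -[leRHS]normrN H// oppr_gt0.
have df (y : R) : y \in `]0, x[%R -> is_derive y 1 sin (cos y) by move=> _; exact: is_derive_sin.
have [|c _] := MVT x0 df.
  by apply: continuous_subspaceT; exact: continuous_sin.
rewrite sin0 !subr0 => ->; rewrite normrM ler_piMl//.
exact: cos_max.
Qed.

(** 1 - cos x is at most x^2 / 2 and at most 2; the majorant has a finite integral, computed from
    arctan. *)
Lemma fejer1_le (x : R) : fejer 1 x <= 4 * (oneDsqr x)^-1.
Proof.
have o0 : 0 < oneDsqr x by apply: lt_le_trans (oneDsqr_ge1 x).
have [->|x0] := eqVneq x 0.
  by rewrite /fejer expr0n/= invr0 mulr0 mulr_ge0// invr_ge0 ltW.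
have x2 : 0 < x ^+ 2 by rewrite exprn_even_gt0.
rewrite /fejer mul1r ler_pdivrMr// mulrAC ler_pdivlMr// /oneDsqr.
have c1 : 1 - cos x <= x ^+ 2 / 2.
  have -> : cos x = 1 - 2 * sin (x / 2) ^+ 2.
    have -> : cos x = cos ((x / 2) *+ 2) by congr cos; rewrite mulr2n; field.
    by rewrite cos_mulr2n cos2sin2 mulr2n; ring.
  have : sin (x / 2) ^+ 2 <= (x / 2) ^+ 2.
    by rewrite -[leLHS]real_normK ?num_real// -[leRHS]real_normK ?num_real// lerXn2r ?nnegrE// norm_sin_le.
  by rewrite !expr2; lra.
have c2 := cos_geN1 x; have c3 := cos_le1 x.
by move: c1 x2; set y := x ^+ 2 => *; nra.
Qed.

Lemma fejer_integral_fin : (\int[mu]_x (fejer 1 x)%:E < +oo)%E.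
Proof.
apply: (@le_lt_trans _ _ (\int[mu]_x (4 * (oneDsqr x)^-1)%:E)%E).
  apply: ge0_le_integral => //.
  - by move=> x _; rewrite lee_fin fejer_ge0.
  - by apply/measurable_EFinP; exact: measurable_fejer.
  - apply/measurable_EFinP; apply: measurable_funM => //.
    by apply: continuous_measurable_fun; exact: continuous_oneDsqrV.
  - by move=> x _; rewrite lee_fin fejer1_le.
have o0 (x : R) : 0 <= (oneDsqr x)^-1 by rewrite invr_ge0 (le_trans ler01)// oneDsqr_ge1.
under eq_integral do rewrite EFinM.
rewrite ge0_integralZl//; last first.
  by apply/measurable_EFinP; apply: continuous_measurable_fun; exact: continuous_oneDsqrV.
rewrite (@ge0_symfun_integralT R (fun x => (oneDsqr x)^-1))//; last 2 first.
- exact: continuous_oneDsqrV.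
- by move=> x; rewrite /= /oneDsqr sqrrN.
rewrite (_ : [set x : R | _] = [set` `[0%R, +oo[]); last first.
  by apply/seteqP; split => x /=; rewrite in_itv/= andbT.
by rewrite integral0y_oneDsqr -!EFinM ltry.
Qed.

(** The integral is pi; the argument keeps it abstract and works with its finiteness and
    positivity. *)
Definition fejer_cst : R := \int[mu]_x fejer 1 x.

Lemma integral_fejer a : (\int[mu]_x (fejer a x)%:E = (`|a| * fejer_cst)%:E)%E.
Proof.
have cE : (\int[mu]_x (fejer 1 x)%:E = fejer_cst%:E)%E.
  rewrite /fejer_cst fineK// ge0_fin_numE ?fejer_integral_fin//.
  by apply: integral_ge0 => x _; rewrite lee_fin fejer_ge0.
have [->|a0] := eqVneq a 0.
  rewrite normr0 mul0r; apply: integral0_eq => x _.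
  by rewrite /fejer mul0r cos0 subrr mul0r.
have := ge0_integral_affine 0 a0 (measurable_fejer 1) (fejer_ge0 1).
rewrite cE => H.
rewrite EFinM H muleA -EFinM -ge0_integralZl//.
- apply: eq_integral => x _; rewrite -EFinM /fejer mul1r addr0 exprMn [(a ^+ 2 * _)^-1]invfM.
  rewrite mulrA -expr2 real_normK ?num_real//; congr (_%:E).
  by rewrite [a ^+ 2 * _]mulrC -mulrA mulVKf ?expf_neq0.
- apply/measurable_EFinP; apply: (measurableT_comp (measurable_fejer 1)).
  by apply: measurable_funD => //; exact: measurable_funM.
- by move=> x _; rewrite lee_fin fejer_ge0.
Qed.

Lemma integrable_fejer a : mu.-integrable setT (EFin \o fejer a).
Proof.
apply/integrableP; split; first by apply/measurable_EFinP; exact: measurable_fejer.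
under eq_integral do rewrite /= ger0_norm ?fejer_ge0//.
by rewrite integral_fejer ltry.
Qed.

(** On the interval from pi / 2 to pi the numerator 1 - cos x is at least 1. *)
Lemma fejer_cst_gt0 : 0 < fejer_cst.
Proof.
have pi0 := @pi_gt0 R.
have h : 0 < (pi ^+ 2)^-1 * (pi / 2) :> R.
  by rewrite mulr_gt0 ?invr_gt0 ?exprn_gt0 ?divr_gt0.
apply: (lt_le_trans h).
have -> : fejer_cst = fine (\int[mu]_x (fejer 1 x)%:E) by [].
rewrite integral_fejer -lee_fin fineK// -integral_fejer.
have mI : measurable (`[pi / 2, pi]%classic : set (measurableTypeR R)) by exact: measurable_itv.
apply: (@le_trans _ _ (\int[mu]_(x in `[(pi / 2)%R, pi]) (fejer 1 x)%:E)%E); last first.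
  apply: ge0_subset_integral => //.
  - by apply/measurable_EFinP; exact: measurable_fejer.
  - by move=> x _; rewrite lee_fin fejer_ge0.
apply: (@le_trans _ _ (\int[mu]_(x in `[(pi / 2)%R, pi]) ((pi ^+ 2)^-1)%:E)%E).
  have muI : mu `[pi / 2, pi]%classic = (pi - pi / 2)%:E.
    by rewrite lebesgue_measure_itv/= lte_fin ifT//; lra.
  rewrite (integral_cst mu mI) [X in (_ <= _ * X)%E]muI.
  by rewrite -EFinM lee_fin ler_wpM2l ?invr_ge0 ?sqr_ge0//; lra.
apply: ge0_le_integral => //.
- by move=> x _; rewrite lee_fin invr_ge0 sqr_ge0.
- by apply/measurable_EFinP; apply: measurable_funTS; exact: measurable_fejer.
move=> x /=; rewrite in_itv/= => /andP[x1 x2]; rewrite lee_fin /fejer mul1r.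
have x0 : 0 < x by lra.
have cx : cos x <= 0.
  rewrite -cos_pihalf; have := x1; rewrite le_eqVlt => /predU1P[->//|x1'].
  by rewrite ltW// ltr_cos// in_itv/=; lra.
rewrite -[leLHS]mul1r; apply: ler_pM => //; first by rewrite invr_ge0 sqr_ge0.
  by lra.
by rewrite lef_pV2 ?posrE ?exprn_gt0// lerXn2r ?nnegrE//; lra.
Qed.

Definition fejer_density (x : R) : R := fejer_cst^-1 * fejer 1 x.

Let mfd : measurable_fun setT fejer_density.
Proof. by apply: measurable_funM => //; exact: measurable_fejer. Qed.

Let fd0 x : 0 <= fejer_density x.
Proof. by rewrite mulr_ge0 ?fejer_ge0// invr_ge0 ltW// fejer_cst_gt0. Qed.

Let fd1 : (\int[mu]_x (fejer_density x)%:E = 1)%E.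
Proof.
under eq_integral do rewrite EFinM.
rewrite ge0_integralZl//; last 3 first.
- by apply/measurable_EFinP; exact: measurable_fejer.
- by move=> x _; rewrite lee_fin fejer_ge0.
- by rewrite lee_fin invr_ge0 ltW// fejer_cst_gt0.
by rewrite integral_fejer normr1 mul1r -EFinM mulVf// gt_eqF// fejer_cst_gt0.
Qed.

Definition fejer_probability : probability (measurableTypeR R) R :=
  density_probability mfd fd0 fd1.

(** The product (1 - cos (t x))(1 - cos x) is a combination of the functions 1 - cos (a x) with a =
    t, 1, 1 + t, 1 - t. By [integral_fejer] its normalised integral is |t| + 1 - (|1 + t| + |1 - t|)
    / 2. *)
Lemma Ex_cos_fejer (t : R) :
  Ex fejer_probability (fun x => cos (t * x)) = Num.max 0 (1 - `|t|).
Proof.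
have c0 := fejer_cst_gt0.
have bt : bmeas (fun x : measurableTypeR R => cos (t * x) : R).
  by apply: bmeas_cos; exact: measurable_funM.
suff : Ex fejer_probability (fun x => 1 - cos (t * x)) = 1 - Num.max 0 (1 - `|t|).
  rewrite (ExB fejer_probability (bmeas_cst _ 1) bt) Ex_cst; lra.
have m1 : measurable_fun setT (fun x : R => 1 - cos (t * x)).
  exact: (bmeasB (bmeas_cst _ 1) bt).1.
have p1 (x : R) : 0 <= 1 - cos (t * x) by rewrite subr_ge0 cos_le1.
rewrite /Ex /Rintegral ge0_integral_density//.
have RI a : \int[mu]_x fejer a x = `|a| * fejer_cst by rewrite /Rintegral integral_fejer.
have iZ (k a : R) : mu.-integrable setT (EFin \o (fun x => k * fejer a x)).
  by under [EFin \o _]eq_fun do rewrite /= EFinM; apply: integrableZl => //; exact: integrable_fejer.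
have iD (f h : R -> R) : mu.-integrable setT (EFin \o f) -> mu.-integrable setT (EFin \o h) ->
    mu.-integrable setT (EFin \o (fun x => f x + h x)).
  by move=> i1 i2; under [EFin \o _]eq_fun do rewrite /= EFinD; exact: integrableD.
rewrite (_ : fine _ = \int[mu]_x ((fejer_cst^-1 * fejer t x + fejer_cst^-1 * fejer 1 x) +
   (- (fejer_cst^-1 / 2) * fejer (1 + t) x + - (fejer_cst^-1 / 2) * fejer (1 - t) x))); last first.
  rewrite /Rintegral; congr fine; apply: eq_integral => x _; congr (_%:E).
  rewrite /fejer_density /fejer (mulrDl 1 t) (mulrBl x 1 t) mul1r cosD cosB.
  set iv := (x ^+ 2)^-1; by field; rewrite gt_eqF.
rewrite RintegralD//; [|exact: iD..].
rewrite !RintegralD// !RintegralZl//; try exact: integrable_fejer.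
rewrite !RI normr1 mul1r.
have -> : fejer_cst^-1 * (`|t| * fejer_cst) + fejer_cst^-1 * fejer_cst +
  (- (fejer_cst^-1 / 2) * (`|1 + t| * fejer_cst) + - (fejer_cst^-1 / 2) * (`|1 - t| * fejer_cst)) =
  `|t| + 1 - (`|1 + t| + `|1 - t|) / 2 by field; rewrite gt_eqF.
have [t0|t0] := leP 0 t.
  rewrite (ger0_norm t0) (ger0_norm (_ : 0 <= 1 + t)); last by lra.
  have [t1|t1] := leP t 1.
    by rewrite ger0_norm ?max_r; lra.
  by rewrite ltr0_norm ?max_l; lra.
rewrite (ltr0_norm t0) (ger0_norm (_ : 0 <= 1 - t)); last by lra.
have [t1|t1] := leP (-1) t.
  by rewrite ger0_norm ?max_r; lra.
by rewrite ltr0_norm ?max_l; lra.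
Qed.

End triangular.

(** * Convex null sequences as mixtures of triangles *)

Section polya_sequence.
Context (R : realType) (e : nat -> R).
Hypothesis e0 : e 0%N = 1.
Hypothesis e_convex : forall n, e n.+1 + e n.+1 <= e n + e n.+2.
Hypothesis e_lim : e n @[n --> \oo] --> (0 : R).

Lemma convex_seq_diff_ni m n : (m <= n)%N -> e n - e n.+1 <= e m - e m.+1.
Proof.
elim: n => [|n IH]; first by rewrite leqn0 => /eqP->.
rewrite leq_eqVlt => /predU1P[->//|/IH]; have := e_convex n; lra.
Qed.

Lemma convex_seq_drop m n : (m <= n)%N -> (n - m)%:R * (e n - e n.+1) <= e m - e n.
Proof.
elim: n => [|n IH]; first by rewrite leqn0 => /eqP->; rewrite subnn mul0r subrr.
rewrite leq_eqVlt => /predU1P[->|mn]; first by rewrite subnn mul0r subrr.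
rewrite subSn// -natr1 mulrDl mul1r; have := IH mn.
have := e_convex n; have : 0 <= (n - m)%:R :> R by [].
set k := (n - m)%:R; nra.
Qed.

Lemma convex_seq_diff_ge0 k : 0 <= e k - e k.+1.
Proof.
have : e n - e n.+1 @[n --> \oo] --> (0 : R).
  by rewrite -[X in _ --> X](subrr 0); apply: cvgB => //; rewrite cvg_shiftS.
move=> /cvgr_to_le; apply; near=> n.
by apply: convex_seq_diff_ni; near: n; exact: nbhs_infty_ge.
Unshelve. all: end_near. Qed.

Lemma convex_seq_ni m n : (m <= n)%N -> e n <= e m.
Proof.
elim: n => [|n IH]; first by rewrite leqn0 => /eqP->.
rewrite leq_eqVlt => /predU1P[->//|/IH]; have := convex_seq_diff_ge0 n; lra.
Qed.

Lemma convex_seq_ge0 n : 0 <= e n.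
Proof.
apply: (cvgr_to_le e_lim); near=> m.
by apply: convex_seq_ni; near: m; exact: nbhs_infty_ge.
Unshelve. all: end_near. Qed.

(** The decrements are nonincreasing, so n / 2 times the last one is at most the drop from n / 2 to
    n, which vanishes in the limit. *)
Lemma cvg_convex_seq_diff : n%:R * (e n - e n.+1) @[n --> \oo] --> (0 : R).
Proof.
have half : n./2 @[n --> \oo] --> \oo.
  move=> A [N _ NA]; exists N.*2 => // n /= Nn; apply: NA => /=.
  by rewrite -(doubleK N) half_leq.
apply: (@squeeze_cvgr _ _ _ _ (fun=> 0) (fun n => 2 * (e n./2 - e n))).
- near=> n; rewrite mulr_ge0 ?convex_seq_diff_ge0//=.
  have h : (n./2 <= n)%N by lia.
  have nn : n%:R <= 2 * (n - n./2)%:R :> R.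
    by rewrite -natrM ler_nat; lia.
  have := convex_seq_drop h; have := convex_seq_diff_ge0 n; nra.
- exact: cvg_cst.
- have : 2 * (e n./2 - e n) @[n --> \oo] --> (2 * (0 - 0) : R).
    apply: cvgM; first exact: cvg_cst.
    by apply: cvgB => //; apply: cvg_comp half _.
  by rewrite subrr mulr0.
Unshelve. all: end_near. Qed.

(** The triangle with base k has as weight k times the second difference of e at k; the value 0 at k
    = 0 gives no mass to the degenerate triangle. *)
Definition polya_weight (k : nat) : R :=
  if k is k'.+1 then k%:R * (e k' + e k'.+2 - (e k'.+1 + e k'.+1)) else 0.

Lemma polya_weight_ge0 k : 0 <= polya_weight k.
Proof. by case: k => [//|k]; rewrite mulr_ge0// subr_ge0. Qed.

(** Double summation by parts, done by induction on M. The boundary terms vanish as M grows, by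
    [e_lim] and [cvg_convex_seq_diff]. *)
Lemma polya_sum n M : (n <= M)%N ->
  series (fun k => polya_weight k * Num.max 0 (1 - n%:R / k%:R)) M.+1 =
  e n - e M - (M - n)%:R * (e M - e M.+1).
Proof.
have T k : polya_weight k.+1 * Num.max 0 (1 - n%:R / k.+1%:R) =
    (k.+1 - n)%:R * (e k + e k.+2 - (e k.+1 + e k.+1)).
  rewrite /polya_weight mulrAC; congr (_ * _).
  have [nk|kn] := leqP n k.+1.
    rewrite natrB// max_r; first by field.
    by rewrite subr_ge0 ler_pdivrMr// mul1r ler_nat.
  rewrite (_ : (k.+1 - n)%N = 0%N); last by apply/eqP; rewrite subn_eq0 ltnW.
  by rewrite max_l ?mulr0// subr_le0 ler_pdivlMr// mul1r ler_nat ltnW.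
rewrite /series/= big_nat_recl// mul0r add0r.
under eq_bigr do rewrite T.
elim: M => [|M IH].
  by rewrite leqn0 => /eqP->; rewrite big_geq// subnn mul0r !subrr.
rewrite leq_eqVlt => /predU1P[->|nM].
  rewrite subnn mul0r !subrr big_nat big1// => k /andP[_ kM].
  by rewrite (_ : (k.+1 - _)%N = 0%N) ?mul0r//; apply/eqP; rewrite subn_eq0.
rewrite big_nat_recr//= IH//; rewrite subSn// -natr1; ring.
Qed.

Lemma cvg_polya_sum n :
  series (fun k => polya_weight k * Num.max 0 (1 - n%:R / k%:R)) @ \oo --> e n.
Proof.
rewrite -cvg_shiftS.
have H : e n - e M - (M%:R * (e M - e M.+1) - n%:R * (e M - e M.+1)) @[M --> \oo] --> e n.
  have D0 : e M - e M.+1 @[M --> \oo] --> (0 : R).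
    by rewrite -[X in _ --> X](subrr 0); apply: cvgB => //; rewrite cvg_shiftS.
  rewrite -[X in _ --> X]subr0 -[X in _ --> X - _]subr0 -[X in _ --> _ - X](subrr 0).
  apply: cvgB; first by apply: cvgB => //; exact: cvg_cst.
  apply: cvgB; first exact: cvg_convex_seq_diff.
  by rewrite -[X in _ --> X](mulr0 n%:R); apply: cvgM => //; exact: cvg_cst.
apply: cvg_trans H; apply: near_eq_cvg; near=> M.
have nM : (n <= M)%N by near: M; exact: nbhs_infty_ge.
by rewrite /= polya_sum// natrB// mulrBl.
Unshelve. all: end_near. Qed.

Lemma cvg_polya_weight : series polya_weight @ \oo --> (1 : R).
Proof.
rewrite -e0; have := @cvg_polya_sum 0%N.
by rewrite (_ : (fun k => _) = polya_weight)//; apply/funext => k; rewrite mul0r subr0 max_r ?mulr1.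
Qed.

Definition polya_scale : probability nat R :=
  nat_probability polya_weight_ge0 cvg_polya_weight.

Lemma Ex_polya_scale n :
  Ex polya_scale (fun k => Num.max 0 (1 - n%:R / k%:R)) = e n.
Proof.
apply: (@Ex_nat_probability _ _ _ _ _ 1); last exact: cvg_polya_sum.
move=> k; rewrite ger0_norm ?le_max ?lexx// ge_max ler01/= gerBl.
Qed.

End polya_sequence.

(** * A random phase with four values *)

Section quarter_phase.
Context (R : realType).

Let w (k : nat) : R := (k < 4)%N%:R / 4.

Let w_ge0 k : 0 <= w k. Proof. by rewrite divr_ge0. Qed.

Let sumw (f : nat -> R) :
  series (fun k => w k * f k) @ \oo --> (f 0%N + f 1%N + f 2%N + f 3%N) / 4.
Proof.
apply: cvg_near_cst; near=> n.
have n4 : (4 <= n)%N by near: n; exact: nbhs_infty_ge.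
rewrite /series/= (@big_cat_nat _ _ _ 4)//= [X in _ + X]big_nat [X in _ + X]big1; last first.
  by move=> k /andP[k4 _]; rewrite /w ltnNge k4 /= !mul0r.
rewrite big_nat_recr//= big_nat_recr//= big_nat_recr//= big_nat_recr//= big_geq// /w/=; by field.
Unshelve. all: end_near. Qed.

Let w1 : series w @ \oo --> (1 : R).
Proof.
have := @sumw (fun=> 1).
rewrite (_ : (fun k => w k * 1) = w); last by apply/funext => k; rewrite mulr1.
by rewrite (_ : _ / 4 = 1 :> R)//; field.
Qed.

Definition quarter_phase : probability nat R := nat_probability w_ge0 w1.

Lemma Ex_quarter_phase (f : nat -> R) (M : R) : (forall n, `|f n| <= M) ->
  Ex quarter_phase f = (f 0%N + f 1%N + f 2%N + f 3%N) / 4.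
Proof. by move=> fM; exact: (Ex_nat_probability _ _ fM (@sumw f)). Qed.

(** This is cos(x + j pi / 2). A phase uniform on the four quarter turns is enough to centre the
    process and to make its second moments stationary. *)
Definition phase (j : nat) (x : R) : R :=
  match j with 0%N => cos x | 1%N => - sin x | 2%N => - cos x | _ => sin x end.

Lemma phase_le1 j x : `|phase j x| <= 1.
Proof. by case: j => [|[|[|j]]] /=; rewrite ?normrN ?cos_max ?sin_max. Qed.

Lemma measurable_phase d (T : measurableType d) (f : T -> R) j :
  measurable_fun setT f -> measurable_fun setT (fun x => phase j (f x)).
Proof.
move=> mf; have c := (bmeas_cos mf).1; have s := (bmeas_sin mf).1.
by case: j => [|[|[|j]]] //=; exact: measurable_funN.
Qed.

Lemma Ex_phase x : Ex quarter_phase (fun j => phase j x) = 0.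
Proof. by rewrite (Ex_quarter_phase (M := 1))/= => [|j]; [field|exact: phase_le1]. Qed.

Lemma Ex_phaseM x y :
  Ex quarter_phase (fun j => phase j x * phase j y) = cos (x - y) / 2.
Proof.
rewrite (Ex_quarter_phase (M := 1))/= => [|j]; first by rewrite cosB; field.
by rewrite normrM mulr_ile1// phase_le1.
Qed.

End quarter_phase.

(** * Stationary processes and fields with prescribed covariance *)

Lemma measurable_fun_nat_param (R : realType) d (T : measurableType d)
    (N : T -> nat) (f : nat -> T -> R) : measurable_fun setT N ->
  (forall k, measurable_fun setT (f k)) -> measurable_fun setT (fun w => f (N w) w).
Proof.
move=> mN mf; have mNk k : measurable (N @^-1` [set k]).
  by rewrite -[_ @^-1` _]setTI; exact: mN.
rewrite (_ : setT = \bigcup_k N @^-1` [set k]); last first.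
  by apply/seteqP; split => // w _; exists (N w).
apply/(measurable_fun_bigcup _ mNk) => k.
apply: (eq_measurable_fun (f k)); last exact: measurable_funTS.
by move=> w; rewrite inE => <-.
Qed.

Lemma bmeas_Lfun2 (R : realType) d (T : measurableType d) (P : probability T R)
  (f : T -> R) : bmeas f -> f \in Lfun P 2%:E.
Proof.
move=> bf; rewrite inE/=; apply/andP; split; rewrite inE//=; first exact: bf.1.
rewrite /finite_norm unlock poweR_lty//.
rewrite (_ : (fun x => _) = (fun w => (f w * f w)%:E)).
  by rewrite -EFin_Ex ?ltry//; exact: bmeasM.
apply/funext => w.
by rewrite [LHS](_ : _ = (`|f w| `^ 2)%:E)// powR_mulrn// real_normK ?num_real.
Qed.

(* Polya's criterion: a convex sequence is a mixture of the triangles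
   (1 - n / k)^+, and each of these is the characteristic function of a scaled
   Fejer law. *)
Lemma polya_process (R : realType) (e : nat -> R) : e 0%N = 1 ->
  (forall n, e n.+1 + e n.+1 <= e n + e n.+2) -> e n @[n --> \oo] --> (0 : R) ->
  exists (d : measure_display) (T : measurableType d) (P : probability T R)
    (Y : int -> T -> R),
  [/\ forall n, bmeas (Y n), forall n, Ex P (Y n) = 0 &
      forall k l, Ex P (fun w => Y k w * Y l w) = e `|k - l|%N].
Proof.
move=> e0 ec el.
pose P1 := polya_scale e0 ec el; pose P2 := fejer_probability R.
pose T := (nat * measurableTypeR R * nat)%type.
(* The frequency is the Fejer variable divided by the random scale k, so that cos(n theta) averages
   to (1 - |n| / k)^+ for given k; sqrt 2 compensates the 1 / 2 of [Ex_phaseM]. *)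
pose Y (n : int) (w : T) : R := Num.sqrt 2 * phase w.2 (n%:~R * (w.1.2 / w.1.1%:R)).
have mnat (f : nat -> measurableTypeR R -> nat -> R) :
    (forall k j, measurable_fun setT (fun x => f k x j)) ->
    measurable_fun setT (fun w : T => f w.1.1 w.1.2 w.2).
  move=> mf; apply: (measurable_fun_nat_param (f := fun k (w : T) => f k w.1.2 w.2)).
    exact: measurableT_comp measurable_fst measurable_fst.
  move=> k; apply: (measurable_fun_nat_param (f := fun j (w : T) => f k w.1.2 j)) => //.
  move=> j; apply: (measurableT_comp (mf k j)).
  exact: measurableT_comp measurable_snd measurable_fst.
have bY n : bmeas (Y n).
  split.
    apply: measurable_funM => //; apply: (mnat (fun k x j => phase j (n%:~R * (x / k%:R)))) => k j.
    apply: measurable_phase; apply: measurable_funM => //.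
    by apply: measurable_funM.
  by exists (Num.sqrt 2) => w; rewrite normrM ger0_norm// ler_piMr// phase_le1.
exists _, T, ((P1 \x P2) \x quarter_phase R)%E, Y; split => //.
  move=> n; rewrite Ex_prod1//.
  rewrite (_ : (fun x => _) = fun=> 0) ?Ex_cst//; apply/funext => x.
  have b (a : R) : bmeas (fun j : nat => phase j a) by apply: (@bmeas_nat _ _ 1) => j; exact: phase_le1.
  have := ExZ (quarter_phase R) (Num.sqrt 2) (b (n%:~R * (x.2 / x.1%:R))).
  by rewrite Ex_phase mulr0.
move=> k l; have bYY := bmeasM (bY k) (bY l).
rewrite Ex_prod1//.
pose c (x : nat * measurableTypeR R) : R := cos ((k - l)%:~R / x.1%:R * x.2).
have cE x : Ex (quarter_phase R) (fun y => Y k (x, y) * Y l (x, y)) = c x.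
  rewrite (_ : (fun y => _) = fun y => 2 * (phase y (k%:~R * (x.2 / x.1%:R)) * phase y (l%:~R * (x.2 / x.1%:R)))).
    rewrite ExZ ?Ex_phaseM.
      by rewrite mulrCA divff// mulr1 /c; congr cos; rewrite intrB; ring.
    by apply: (@bmeas_nat _ _ 1) => j; rewrite normrM mulr_ile1// phase_le1.
  apply/funext => y; rewrite /Y/=.
  by rewrite mulrACA -expr2 sqr_sqrtr.
rewrite (_ : (fun x => Ex _ _) = c); last exact/funext.
rewrite Ex_prod1; last first.
  by have := bmeas_Ex1 (P1 \x P2)%E (quarter_phase R) bYY; under eq_fun do rewrite cE.
rewrite (_ : (fun x => Ex _ _) = fun K : nat => Num.max 0 (1 - `|k - l|%N%:R / K%:R)).
  by rewrite Ex_polya_scale.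
apply/funext => K; have /= -> := Ex_cos_fejer ((k - l)%:~R / K%:R : R).
congr (Num.max 0 (1 - _)).
by rewrite normrM -intr_norm normfV normr_nat -natr_absz.
Qed.

Lemma product_covariance (R : realType) (e1 e2 : nat -> R) (r : int * int -> R) :
  e1 0%N = 1 -> (forall n, e1 n.+1 + e1 n.+1 <= e1 n + e1 n.+2) ->
  e1 n @[n --> \oo] --> (0 : R) ->
  e2 0%N = 1 -> (forall n, e2 n.+1 + e2 n.+1 <= e2 n + e2 n.+2) ->
  e2 n @[n --> \oo] --> (0 : R) ->
  (forall i j, r (i, j) = e1 `|i|%N * e2 `|j|%N) -> covariance_function r.
Proof.
move=> e10 e1c e1l e20 e2c e2l rE.
have [d1 [T1 [P1 [Y1 [bY1 EY1 CY1]]]]] := polya_process e10 e1c e1l.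
have [d2 [T2 [P2 [Y2 [bY2 EY2 CY2]]]]] := polya_process e20 e2c e2l.
pose Y (k : int * int) (w : T1 * T2) : R := Y1 k.1 w.1 * Y2 k.2 w.2.
have bY k : bmeas (Y k).
  have [m1 [M1 B1]] := bY1 k.1; have [m2 [M2 B2]] := bY2 k.2; split.
    apply: measurable_funM; first by apply: measurableT_comp m1 _.
    by apply: measurableT_comp m2 _.
  by exists (M1 * M2) => w; rewrite normrM ler_pM.
have EY k : Ex (P1 \x P2)%E (Y k) = 0.
  rewrite Ex_prod1// (_ : (fun x => _) = fun=> 0) ?Ex_cst//; apply/funext => x.
  by rewrite (ExZ P2 (Y1 k.1 x) (bY2 k.2)) EY2 mulr0.
have CY k l : Ex (P1 \x P2)%E (fun w => Y k w * Y l w) = r (k - l).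
  rewrite (_ : k - l = (k.1 - l.1, k.2 - l.2)) // rE -CY1 -CY2.
  rewrite Ex_prod1; last exact: bmeasM.
  rewrite mulrC -ExZ; last exact: bmeasM.
  congr Ex; apply/funext => x; rewrite mulrC -ExZ; last exact: bmeasM.
  by congr Ex; apply/funext => y; rewrite /Y/=; ring.
pose P := (P1 \x P2)%E : probability (T1 * T2)%type R.
pose RY k : {RV P >-> R} := HB.pack (Y k) (@isMeasurableFun.Build _ _ _ _ (Y k) (bY k).1).
have L2 k : (Y k : _ -> R) \in Lfun P 2%:E.
  exact: bmeas_Lfun2.
have EP k : ('E_P[RY k] = 0)%E.
  by rewrite unlock; exact: etrans (esym (EFin_Ex P (bY k))) (congr1 EFin (EY k)).
exists _, (T1 * T2)%type, P, RY; split=> //.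
  by move=> k; rewrite !EP.
move=> k l; rewrite unlock !EP unlock.
rewrite -CY EFin_Ex; last exact: bmeasM.
apply: eq_integral => w _; congr (_%:E).
by rewrite [LHS](_ : _ = (Y k w - 0) * (Y l w - 0))// !subr0.
Qed.

(** * The polygonal factors *)

Section lnln_ratio_numerics.
Context (R : realType).

(** The inequality in nat is c / d <= (a / b)^2 cleared of denominators, so that each squaring is
    checked by integer arithmetic. *)
Lemma ratio_le_sqr (y : R) (k a b c d : nat) : 0 <= y ->
  (c * (b * b) <= a * a * d)%N -> (0 < b)%N -> (0 < d)%N ->
  a%:R / b%:R <= y ^+ k -> c%:R / d%:R <= y ^+ k.*2.
Proof.
move=> y0 abcd b0 d0 ax; have b0' : 0 < b%:R :> R by rewrite ltr0n.
apply: (@le_trans _ _ (a%:R / b%:R * (a%:R / b%:R))); last by rewrite -addnn exprD ler_pM.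
rewrite mulf_div ler_pdivrMr ?ltr0n// mulrAC ler_pdivlMr ?mulr_gt0//.
by rewrite -!natrM ler_nat.
Qed.

(* Nine squarings, each rounded down to a fraction with small terms. *)
Lemma pow512_ge_1 (y : R) : 0 <= y -> 859 / 861 <= y -> 404 / 1329 <= y ^+ 512.
Proof.
have A1 : (429 * (861 * 861) <= 859 * 859 * 431)%N by clear; lia.
have A2 : (107 * (431 * 431) <= 429 * 429 * 108)%N by clear; lia.
have A3 : (213 * (108 * 108) <= 107 * 107 * 217)%N by clear; lia.
have A4 : (1609 * (217 * 217) <= 213 * 213 * 1670)%N by clear; lia.
have A5 : (2731 * (1670 * 1670) <= 1609 * 1609 * 2942)%N by clear; lia.
have A6 : (81 * (2942 * 2942) <= 2731 * 2731 * 94)%N by clear; lia.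
have A7 : (2013 * (94 * 94) <= 81 * 81 * 2711)%N by clear; lia.
have A8 : (102 * (2711 * 2711) <= 2013 * 2013 * 185)%N by clear; lia.
have A9 : (404 * (185 * 185) <= 102 * 102 * 1329)%N by clear; lia.
move=> y0 h; have h0 : 859 / 861 <= y ^+ 1 by rewrite expr1.
have h1 := ratio_le_sqr y0 A1 isT isT h0.
have h2 := ratio_le_sqr y0 A2 isT isT h1.
have h3 := ratio_le_sqr y0 A3 isT isT h2.
have h4 := ratio_le_sqr y0 A4 isT isT h3.
have h5 := ratio_le_sqr y0 A5 isT isT h4.
have h6 := ratio_le_sqr y0 A6 isT isT h5.
have h7 := ratio_le_sqr y0 A7 isT isT h6.
have h8 := ratio_le_sqr y0 A8 isT isT h7.
have h9 := ratio_le_sqr y0 A9 isT isT h8.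
exact: h9.
Qed.

Lemma pow512_ge_2 (y : R) : 0 <= y -> 2795 / 2801 <= y -> 514 / 1541 <= y ^+ 512.
Proof.
have A1 : (698 * (2801 * 2801) <= 2795 * 2795 * 701)%N by clear; lia.
have A2 : (1393 * (701 * 701) <= 698 * 698 * 1405)%N by clear; lia.
have A3 : (1387 * (1405 * 1405) <= 1393 * 1393 * 1411)%N by clear; lia.
have A4 : (2034 * (1411 * 1411) <= 1387 * 1387 * 2105)%N by clear; lia.
have A5 : (2520 * (2105 * 2105) <= 2034 * 2034 * 2699)%N by clear; lia.
have A6 : (1747 * (2699 * 2699) <= 2520 * 2520 * 2004)%N by clear; lia.
have A7 : (744 * (2004 * 2004) <= 1747 * 1747 * 979)%N by clear; lia.
have A8 : (1337 * (979 * 979) <= 744 * 744 * 2315)%N by clear; lia.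
have A9 : (514 * (2315 * 2315) <= 1337 * 1337 * 1541)%N by clear; lia.
move=> y0 h; have h0 : 2795 / 2801 <= y ^+ 1 by rewrite expr1.
have h1 := ratio_le_sqr y0 A1 isT isT h0.
have h2 := ratio_le_sqr y0 A2 isT isT h1.
have h3 := ratio_le_sqr y0 A3 isT isT h2.
have h4 := ratio_le_sqr y0 A4 isT isT h3.
have h5 := ratio_le_sqr y0 A5 isT isT h4.
have h6 := ratio_le_sqr y0 A6 isT isT h5.
have h7 := ratio_le_sqr y0 A7 isT isT h6.
have h8 := ratio_le_sqr y0 A8 isT isT h7.
have h9 := ratio_le_sqr y0 A9 isT isT h8.
exact: h9.
Qed.

(* exp(-t) >= (1 - t / 512) ^ 512 *)
Lemma expR_le_of_pow512 (t a b : R) : 0 < b -> a <= 1 - t / 512 ->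
  (forall y, 0 <= y -> a <= y -> b <= y ^+ 512) -> expR t <= b^-1.
Proof.
move=> b0 at1 H.
have y0 := expR_gt0 (- (t / 512)).
have : b <= expR (- t).
  have -> : expR (- t) = expR (- (t / 512)) ^+ 512.
    by rewrite -expRM_natl; congr expR; field.
  apply: H; first exact: ltW.
  by apply: (le_trans at1); exact: expR_ge1Dx.
by move=> h; rewrite -[expR t]invrK -expRN lef_pV2 ?posrE ?expR_gt0.
Qed.

(** 3.29 lies just below ln 27, and 629 / 529 = 1 + 1 / (3.29 + 2) is the bound on ln 3.29 that
    [lnln_ratio_slope_ni] needs. *)
Lemma expR_bound_329 : expR (629 / 529) <= 329 / 100 :> R.
Proof.
apply: (@le_trans _ _ (404 / 1329)^-1); last by lra.
by apply: expR_le_of_pow512 pow512_ge_1; lra.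
Qed.

Lemma expR_bound_3 : expR (329 / 300) <= 3 :> R.
Proof.
apply: (@le_trans _ _ (514 / 1541)^-1); last by lra.
by apply: expR_le_of_pow512 pow512_ge_2; lra.
Qed.

Lemma ln27_ge : 329 / 100 <= ln 27 :> R.
Proof.
have -> : 27 = 3 ^+ 3 :> R by rewrite !exprS expr0; ring.
rewrite lnXn// -mulr_natl.
have : 329 / 300 <= ln 3 :> R by rewrite -ler_expR lnK ?posrE// expR_bound_3.
lra.
Qed.

Lemma ln329_ge : 629 / 529 <= ln (329 / 100) :> R.
Proof. by rewrite -ler_expR lnK ?posrE ?divr_gt0// expR_bound_329. Qed.

(* The derivative of -lnln_ratio at exp u is (ln u - 1) / (u ^ 2 exp u). *)
Lemma lnln_ratio_slope_ni (u v : R) : 329 / 100 <= u -> u <= v ->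
  (ln v - 1) / (expR v * v ^+ 2) <= (ln u - 1) / (expR u * u ^+ 2).
Proof.
move=> u0 uv; have up : 0 < u by lra.
have vp : 0 < v by lra.
pose A := ln u - 1; pose h := v - u.
have h0 : 0 <= h by rewrite /h; lra.
have A0 : 100 / 529 <= A.
  have : ln (329 / 100) <= ln u by rewrite ler_ln ?posrE ?divr_gt0.
  have := ln329_ge; rewrite /A; lra.
have Av : ln v - 1 <= A + h / u.
  have : ln (1 + h / u) <= h / u.
    by apply: le_ln1Dx; rewrite (lt_le_trans (_ : -1 < 0))// divr_ge0// ltW.
  have -> : 1 + h / u = v / u by rewrite /h; field; rewrite gt_eqF.
  by rewrite ln_div ?posrE// /A; lra.
have ev : expR u * (1 + h) <= expR v.
  have -> : v = u + h by rewrite /h; ring.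
  by rewrite expRD ler_wpM2l ?expR_ge0// expR_ge1Dx.
have e0 := expR_gt0 u; have e1 := expR_gt0 v.
(* (ln u - 1)(u + 2) >= 1 is exactly the condition for the derivative of (ln u - 1) / (exp(u) u^2)
   to be at most 0 at u; it holds from u = 3.29 on. *)
have key : 1 <= A * (u + 2) by nra.
rewrite ler_pdivrMr; last by rewrite mulr_gt0// exprn_gt0.
rewrite mulrAC ler_pdivlMr; last by rewrite mulr_gt0// exprn_gt0.
apply: (@le_trans _ _ (A * (expR u * (1 + h) * v ^+ 2))); last first.
  by rewrite ler_wpM2l// ?ler_wpM2r ?sqr_ge0//; lra.
apply: (@le_trans _ _ ((A + h / u) * (expR u * u ^+ 2))).
  by rewrite ler_wpM2r// mulr_ge0 ?sqr_ge0// ltW.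
have -> : A * (expR u * (1 + h) * v ^+ 2) = expR u * (A * (1 + h) * v ^+ 2) by ring.
have -> : (A + h / u) * (expR u * u ^+ 2) = expR u * (A * u ^+ 2 + h * u).
  by field; rewrite gt_eqF.
rewrite ler_wpM2l ?expR_ge0//.
have -> : v = u + h by rewrite /h; ring.
have AA : 0 <= A by lra.
have x1 : h * u <= (A * (u + 2)) * (h * u) by rewrite ler_peMl// mulr_ge0// ltW.
have x2 : 0 <= A * h ^+ 2 by rewrite mulr_ge0 ?sqr_ge0.
have x3 : 0 <= A * (h * (2 * u * h + h ^+ 2)).
  by rewrite !mulr_ge0// addr_ge0 ?sqr_ge0// !mulr_ge0// ltW.
move: x1 x2 x3; rewrite !expr2; lra.
Qed.

Lemma is_derive_lnln_ratio (x : R) : 1 < x ->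
  is_derive x 1 (@lnln_ratio R) ((1 - ln (ln x)) / (x * ln x ^+ 2)).
Proof.
move=> x1; have x0 : 0 < x by lra.
have l0 : 0 < ln x by exact: ln_gt0.
have d1 := is_derive1_ln x0.
have d2 : is_derive x 1 (@ln R \o @ln R) ((ln x)^-1 * x^-1).
  by apply: is_derive1_comp; exact: is_derive1_ln.
have d3 : is_derive x 1 (fun y : R => (ln y)^-1) (- (ln x) ^- 2 *: x^-1).
  by apply: is_deriveV; rewrite gt_eqF.
have := is_deriveM d2 d3.
move=> d4; apply: is_derive_eq.
rewrite /GRing.scale/=; by field; rewrite !gt_eqF.
Qed.

Lemma lnln_ratio_convex (n : nat) : (27 <= n)%N ->
  lnln_ratio n.+1%:R + lnln_ratio n.+1%:R <= lnln_ratio n%:R + lnln_ratio n.+2%:R :> R.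
Proof.
move=> n27; have n27' : 27 <= n%:R :> R by rewrite ler_nat.
have step (m : nat) : (27 <= m)%N -> exists2 c : R, m%:R < c < m.+1%:R &
    lnln_ratio m.+1%:R - lnln_ratio m%:R = - ((ln (ln c) - 1) / (expR (ln c) * ln c ^+ 2)).
  move=> m27; have m27' : 27 <= m%:R :> R by rewrite ler_nat.
  have mm : m%:R < m.+1%:R :> R by rewrite ltr_nat.
  have df (x : R) : x \in `]m%:R, m.+1%:R[%R ->
      is_derive x 1 (@lnln_ratio R) ((1 - ln (ln x)) / (x * ln x ^+ 2)).
    by rewrite in_itv/= => /andP[x1 _]; apply: is_derive_lnln_ratio; lra.
  have [|c cI ->] := MVT mm df.
    apply: continuous_in_subspaceT => x; rewrite inE/= in_itv/= => /andP[x1 _].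
    have x1' : 1 < x by lra.
    have [dx _] := is_derive_lnln_ratio x1'.
    exact/differentiable_continuous/derivable1_diffP.
  exists c; first by move: cI; rewrite in_itv.
  move: cI; rewrite in_itv/= => /andP[c1 _]; rewrite lnK ?posrE; last by lra.
  by rewrite -natrB// subSnn mulr1 -mulNr opprB.
have [c /andP[c1 c2] E1] := step n n27.
have [c' /andP[c1' c2'] E2] := step n.+1 (leqW n27).
have cc : ln c <= ln c' by rewrite ler_ln ?posrE//; lra.
have lc : 329 / 100 <= ln c.
  by rewrite (le_trans ln27_ge)// ler_ln ?posrE//; lra.
by have := lnln_ratio_slope_ni lc cc; lra.
Qed.

Lemma lnln_ratio_gt0 (x : R) : 27 <= x -> 0 < lnln_ratio x.
Proof.
move=> x27; have l : 329 / 100 <= ln x.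
  by rewrite (le_trans ln27_ge)// ler_ln ?posrE//; lra.
by rewrite divr_gt0 ?ln_gt0//; lra.
Qed.

Lemma lnln_ratio_le1 (x : R) : 27 <= x -> lnln_ratio x <= 1.
Proof.
move=> x27; have l : 329 / 100 <= ln x.
  by rewrite (le_trans ln27_ge)// ler_ln ?posrE//; lra.
by rewrite ler_pdivrMr ?mul1r ?ltW ?ln_sublinear//; lra.
Qed.

Lemma cvgy_ln_nat : ln n%:R @[n --> \oo] --> (+oo : set_system R).
Proof.
apply/cvgryPge => A; near=> n.
have n0 : expR A <= n%:R by near: n; exact: nbhs_infty_ger.
by rewrite -[A]expRK ler_ln ?posrE ?expR_gt0// (lt_le_trans _ n0)// expR_gt0.
Unshelve. all: end_near. Qed.

Lemma cvgy_lnln_nat : ln (ln n%:R) @[n --> \oo] --> (+oo : set_system R).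
Proof.
apply/cvgryPge => A; near=> n.
have n0 : expR A <= ln n%:R by near: n; exact: cvgry_ge cvgy_ln_nat _.
by rewrite -[A]expRK ler_ln ?posrE ?expR_gt0// (lt_le_trans _ n0)// expR_gt0.
Unshelve. all: end_near. Qed.

Lemma cvg_lnln_ratio : lnln_ratio n%:R @[n --> \oo] --> (0 : R).
Proof.
apply/cvgrPdist_le => eps eps0; near=> n.
have e2 : 0 < eps / 2 by rewrite divr_gt0.
have n27 : 27 <= n%:R :> R by near: n; exact: nbhs_infty_ger.
have l0 : 0 < ln n%:R :> R by rewrite ln_gt0//; lra.
have l1 : - ln (eps / 2) / (eps / 2) <= ln n%:R by near: n; exact: cvgry_ge cvgy_ln_nat _.
rewrite sub0r normrN ger0_norm ?ltW ?lnln_ratio_gt0// /lnln_ratio.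
rewrite ltr_pdivrMr//.
have := @ln_sublinear _ (eps / 2 * ln n%:R : R) (mulr_gt0 e2 l0).
rewrite lnM ?posrE//; move: l1; rewrite ler_pdivrMr//; lra.
Unshelve. all: end_near. Qed.

End lnln_ratio_numerics.

(** With a, b, c the three logarithms, n (n + 2) <= (n + 1)^2 gives a + c <= 2 b; then 4 a c <= (a +
    c)^2. *)
Lemma ln_inv_convex (R : realType) (n : nat) : (2 <= n)%N ->
  (ln n.+1%:R)^-1 + (ln n.+1%:R)^-1 <= (ln n%:R)^-1 + (ln n.+2%:R)^-1 :> R.
Proof.
move=> n2; have n2' : 2 <= n%:R :> R by rewrite ler_nat.
have n1 : n.+1%:R = n%:R + 1 :> R by rewrite natr1.
have n3 : n.+2%:R = n%:R + 2 :> R by rewrite -addn2 natrD.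
have a0 : 0 < ln n%:R :> R by rewrite ln_gt0//; lra.
have b0 : 0 < ln n.+1%:R :> R by rewrite ln_gt0//; lra.
have c0 : 0 < ln n.+2%:R :> R by rewrite ln_gt0//; lra.
have abc : ln n%:R + ln n.+2%:R <= ln n.+1%:R + ln n.+1%:R :> R.
  by rewrite -!lnM ?posrE ?ler_ln ?posrE ?mulr_gt0//; nra.
move: a0 b0 c0 abc; set a := ln n%:R; set b := ln n.+1%:R; set c := ln n.+2%:R => a0 b0 c0 abc.
have -> : b^-1 + b^-1 = 2 / b by ring.
have -> : a^-1 + c^-1 = (a + c) / (a * c) by field; rewrite !gt_eqF.
rewrite ler_pdivrMr// mulrAC ler_pdivlMr ?mulr_gt0//.
by have := sqr_ge0 (a - c); rewrite expr2; nra.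
Qed.

(** * Values of the polygonal functions at integers *)

Section polygonal.
Context (R : realType).

Lemma even_polygonal_line (p : nat -> R * R) (f : R -> R) (k : nat) (t : R) :
  even_polygonal p f -> 0 <= t <= 1 ->
  f ((1 - t) * (p k).1 + t * (p k.+1).1) = (1 - t) * (p k).2 + t * (p k.+1).2.
Proof.
move=> [_ H] t01.
suff [_ /= <-//] : [set z : R * R | 0 <= z.1 /\ z.2 = f z.1]
  (line_path (p k).1 (p k.+1).1 t, line_path (p k).2 (p k.+1).2 t) by [].
by rewrite H; exists k => //; exists t => //=.
Qed.

Lemma even_polygonal_node (p : nat -> R * R) (f : R -> R) (k : nat) :
  even_polygonal p f -> f (p k).1 = (p k).2.
Proof.
move=> H; have := @even_polygonal_line p f k 0 H.
by rewrite lexx ler01 subr0 !mul1r !mul0r !addr0; exact.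
Qed.

Lemma even_polygonal_abs (p : nat -> R * R) (f : R -> R) (i : int) :
  even_polygonal p f -> f i%:~R = f `|i|%N%:R.
Proof.
move=> [even _]; case: (leP 0 i) => i0.
  by rewrite -{1}(gez0_abs i0).
by rewrite -even -intrN -{1}(ltz0_abs i0).
Qed.

Section first_factor.
Context (g1 : R) (eta1 : R -> R).
Hypothesis P1 : even_polygonal (nodes1 g1) eta1.
Hypothesis g1_gt0 : 0 < g1.
Notation L n := (@lnln_ratio R n%:R).
Notation e1 := (fun n : nat => eta1 n%:R).

Lemma eta1_0 : e1 0%N = 1.
Proof. exact: (even_polygonal_node 0 P1). Qed.

(** The ordinate at 1 is chosen such that the edge from 1 to 28 prolongs the chord of [g1 * L]
    between 27 and 28; hence the formula of [eta1_large] holds from 27 on. *)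
Lemma eta1_small n : (1 <= n <= 28)%N ->
  e1 n = g1 * (27 * L 27 - 26 * L 28) - (n%:R - 1) * (g1 * (L 27 - L 28)).
Proof.
move=> /andP[n1 n28].
have n1' : 1 <= n%:R :> R by rewrite ler1n.
have n28' : n%:R <= 28 :> R by rewrite ler_nat.
have := @even_polygonal_line _ _ 1 ((n%:R - 1) / 27) P1.
rewrite (_ : 0 <= _ <= _); last by apply/andP; split; lra.
move=> /(_ isT) /=; rewrite -[(26 + 2)%N]/28%N.
have -> : (1 - (n%:R - 1) / 27) * 1 + (n%:R - 1) / 27 * 28 = n%:R :> R by field.
by move=> ->; field.
Qed.

Lemma eta1_large n : (27 <= n)%N -> e1 n = g1 * L n.
Proof.
rewrite leq_eqVlt => /predU1P[<-|n28]; first by rewrite eta1_small//; ring.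
have -> : n = (26 + (n - 28).+2)%N by lia.
exact: (even_polygonal_node (n - 28).+2 P1).
Qed.

Lemma eta1_lim : e1 n @[n --> \oo] --> (0 : R).
Proof.
have : g1 * L n @[n --> \oo] --> (g1 * 0 : R).
  by apply: cvgM; [exact: cvg_cst|exact: cvg_lnln_ratio].
rewrite mulr0; apply: cvg_trans; apply: near_eq_cvg; near=> n.
by rewrite eta1_large//; near: n; exact: nbhs_infty_ge.
Unshelve. all: end_near. Qed.

Lemma eta1_ln : e1 n * ln n%:R @[n --> \oo] --> (+oo : set_system R).
Proof.
apply/cvgryPge => A; near=> n.
have n27 : (27 <= n)%N by near: n; exact: nbhs_infty_ge.
have l0 : 0 < ln n%:R :> R by rewrite ln_gt0// ltr1n; lia.
rewrite eta1_large// /lnln_ratio -mulrA divfK ?gt_eqF// -ler_pdivrMl//.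
by near: n; exact: cvgry_ge (@cvgy_lnln_nat R) _.
Unshelve. all: end_near. Qed.

(** Squaring n doubles ln n and increases ln ln n, so the ratio loses at most a factor 2. *)
Lemma eta1_sq : \forall n \near \oo, e1 n <= 2 * e1 (n * n)%N.
Proof.
near=> n; have n27 : (27 <= n)%N by near: n; exact: nbhs_infty_ge.
have n0 : 0 < n%:R :> R by rewrite ltr0n; lia.
have l0 : 0 < ln n%:R :> R by rewrite ln_gt0// ltr1n; lia.
rewrite !eta1_large//; last by nia.
rewrite [leRHS]mulrCA ler_wpM2l ?(ltW g1_gt0)// /lnln_ratio natrM lnM ?posrE//.
move: l0; move: (ln n%:R) => u l0.
have -> : 2 * (ln (u + u) / (u + u)) = ln (u + u) / u.
  have -> : u + u = 2 * u by rewrite mulr_natl.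
  by rewrite mulrCA invfM mulVKf ?pnatr_eq0.
by rewrite ler_wpM2r ?invr_ge0 ?(ltW l0)// ler_ln ?posrE ?addr_gt0// lerDl ltW.
Unshelve. all: end_near. Qed.

Hypothesis g1_lt : g1 < 1 / 2.
Hypothesis eta1_1 : g1 * (27 * L 27 - 26 * L 28) < 1 / 3.

Lemma eta1_convex n : e1 n.+1 + e1 n.+1 <= e1 n + e1 n.+2.
Proof.
have [n27|n27] := leqP 27 n.
  rewrite !eta1_large ?leqW// -!(mulrDr g1) ler_wpM2l ?(ltW g1_gt0)//.
  exact: lnln_ratio_convex.
(* At the vertex 1, convexity reads e1 1 + g1 (L 27 - L 28) <= 1; the summands are below 1 / 3 and 1
   / 2. The remaining indices lie on one edge. *)
case: n n27 => [|n] n27.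
  rewrite eta1_0 !eta1_small//.
  have := @lnln_ratio_le1 R 27 (lexx _).
  have : 0 < L 28 by apply: lnln_ratio_gt0; rewrite ler_nat.
  have g0 : 0 <= g1 by exact: ltW.
  move=> a b; have : g1 * (L 27 - L 28) <= g1 * 1 by rewrite ler_wpM2l//; lra.
  by move: g1_lt eta1_1; lra.
rewrite !eta1_small//; try lia.
rewrite -!natr1; lra.
Qed.

End first_factor.

Section second_factor.
Context (g2 : R) (eta2 : R -> R).
Hypothesis P2 : even_polygonal (nodes2 g2) eta2.
Hypothesis g2_gt0 : 0 < g2.
Notation e2 := (fun n : nat => eta2 n%:R).

Lemma eta2_0 : e2 0%N = 1.
Proof. exact: (even_polygonal_node 0 P2). Qed.

Lemma eta2_1 : e2 1%N = g2 * (2 / ln 2 - 1 / ln 3).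
Proof. exact: (even_polygonal_node 1 P2). Qed.

(** The point 2 is the midpoint of the edge from 1 to 3, and the ordinate at 1 is chosen so that the
    value there is g2 / ln 2. *)
Lemma eta2_large n : (2 <= n)%N -> e2 n = g2 / ln n%:R.
Proof.
rewrite leq_eqVlt => /predU1P[<-|n3].
  have := @even_polygonal_line _ _ 1 (1 / 2) P2.
  rewrite (_ : 0 <= _ <= _); last by apply/andP; split; lra.
  move=> /(_ isT) /=.
  have l2 : ln 2 != 0 :> R by rewrite gt_eqF// ln_gt0//; lra.
  have l3 : ln 3 != 0 :> R by rewrite gt_eqF// ln_gt0//; lra.
  have -> : (1 - 1 / 2) * 1 + 1 / 2 * 3 = 2 :> R by field.
  by move=> ->; field; rewrite l2.
have := even_polygonal_node n.-1 P2.
by case: n n3 => [|[|[|n]]].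
Qed.

Lemma ln_nat_gt0 (n : nat) : (2 <= n)%N -> 0 < ln n%:R :> R.
Proof. by move=> n2; rewrite ln_gt0// ltr1n. Qed.

Lemma eta2_gt0 n : 0 < e2 n.
Proof.
case: n => [|[|n]]; first by rewrite eta2_0.
  rewrite eta2_1 mulr_gt0//.
  have l2 := @ln_nat_gt0 2 isT; have l3 := @ln_nat_gt0 3 isT.
  have : (ln 3)^-1 <= (ln 2)^-1 :> R by rewrite lef_pV2 ?posrE// ler_ln ?posrE//; lra.
  have : 0 < (ln 2)^-1 :> R by rewrite invr_gt0.
  by rewrite div1r; lra.
by rewrite eta2_large// divr_gt0// ln_nat_gt0.
Qed.

Hypothesis eta2_1_lt : e2 1%N < 1 / 3.

Lemma eta2_convex n : e2 n.+1 + e2 n.+1 <= e2 n + e2 n.+2.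
Proof.
case: n => [|[|n]].
- by have := eta2_gt0 2; rewrite eta2_0; move: eta2_1_lt; lra.
- by rewrite eta2_1 !eta2_large//; lra.
- by rewrite !eta2_large// -!mulrDr ler_wpM2l ?(ltW g2_gt0)// ln_inv_convex.
Qed.

Lemma eta2_lim : e2 n @[n --> \oo] --> (0 : R).
Proof.
apply/cvgrPdist_le => eps eps0; near=> n.
have n2 : (2 <= n)%N by near: n; exact: nbhs_infty_ge.
have l0 := ln_nat_gt0 n2.
rewrite sub0r normrN gtr0_norm ?eta2_gt0// eta2_large// ler_pdivrMr// mulrC -ler_pdivrMr//.
by near: n; exact: cvgry_ge (@cvgy_ln_nat R) _.
Unshelve. all: end_near. Qed.

End second_factor.

End polygonal.

Section decay.
Context (R : realType) (g1 g2 : R) (eta1 eta2 : R -> R).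
Hypothesis g1_gt : 1 / 4 < g1.
Hypothesis g2_gt0 : 0 < g2.
Hypothesis g12 : g1 * (27 * (ln (ln 27) / ln 27) - 26 * (ln (ln 28) / ln 28))
    < g2 * (2 / ln 2 - 1 / ln 3).
Hypothesis g12' : g2 * (2 / ln 2 - 1 / ln 3) < (1 - 2 * g1) / (1 + 2 * g1).
Hypothesis P1 : even_polygonal (nodes1 g1) eta1.
Hypothesis P2 : even_polygonal (nodes2 g2) eta2.

Lemma g1_gt0 : 0 < g1. Proof. by move: g1_gt; lra. Qed.

(** For positive g1, (1 - 2 g1) / (1 + 2 g1) < 1 / 3 is equivalent to g1 > 1 / 4. *)
Lemma eta2_1_lt : eta2 1 < 1 / 3.
Proof.
rewrite (eta2_1 P2); apply: (lt_trans g12').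
by rewrite ltr_pdivrMr; move: g1_gt; lra.
Qed.

Lemma eta1_1_lt : g1 * (27 * lnln_ratio 27 - 26 * lnln_ratio 28) < 1 / 3.
Proof. by apply: lt_trans eta2_1_lt; rewrite (eta2_1 P2). Qed.

Lemma g1_lt : g1 < 1 / 2.
Proof.
have : 0 < (1 - 2 * g1) / (1 + 2 * g1).
  by apply: lt_trans g12'; rewrite -(eta2_1 P2); exact: (eta2_gt0 P2 g2_gt0 1).
rewrite pmulr_lgt0 ?invr_gt0; move: g1_gt; lra.
Qed.

Lemma eta_weak_decay : weak_decay (fun n => eta1 n%:R) (fun n => eta2 n%:R) (eta2 1) g2.
Proof.
have c1 := eta1_convex P1 g1_gt0 g1_lt eta1_1_lt; have c2 := eta2_convex P2 g2_gt0 eta2_1_lt.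
have l1 := eta1_lim P1 g1_gt0; have l2 := eta2_lim P2 g2_gt0.
split.
- exact: eta1_0 P1.
- exact: eta2_0 P2.
- exact: (convex_seq_ge0 (e := fun n => eta1 n%:R)) c1 l1.
- exact: (convex_seq_ge0 (e := fun n => eta2 n%:R)) c2 l2.
- exact: (convex_seq_ni (e := fun n => eta1 n%:R)) c1 l1.
- exact: (convex_seq_ni (e := fun n => eta2 n%:R)) c2 l2.
- by rewrite (@eta1_small _ _ _ P1 1)// subrr mul0r subr0 (eta2_1 P2) ltW.
- by [].
- by rewrite ltW ?eta2_1_lt//; exact: (eta2_gt0 P2 g2_gt0 1).
- exact: g2_gt0.
- exact: l1.
- move=> n n2; rewrite (eta2_large P2)// divfK// gt_eqF//; exact: ln_nat_gt0.
Qed.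

End decay.

(** * Gaussian fields and phantom distribution functions *)

Section Rintegral_sum.
Context (R : realType) d (T : measurableType d) (P : probability T R).

Lemma integrable_RD (f h : T -> R) : P.-integrable setT (EFin \o f) ->
  P.-integrable setT (EFin \o h) -> P.-integrable setT (EFin \o (fun w => f w + h w)).
Proof.
by move=> fi hi; under [EFin \o _]eq_fun do rewrite /= EFinD; exact: integrableD.
Qed.

Lemma integrable_RZ c (f : T -> R) : P.-integrable setT (EFin \o f) ->
  P.-integrable setT (EFin \o (fun w => c * f w)).
Proof.
by move=> fi; under [EFin \o _]eq_fun do rewrite /= EFinM; exact: integrableZl.
Qed.

Lemma integrable_Rsum (J : Type) (s : seq J) (F : J -> T -> R) :
  (forall j, P.-integrable setT (EFin \o F j)) ->
  P.-integrable setT (EFin \o (fun w => \sum_(j <- s) F j w)).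
Proof.
move=> iF; elim: s => [|j s IH].
  under [EFin \o _]eq_fun do rewrite /= big_nil.
  exact: (bmeas_integrable P (bmeas_cst _ 0)).
under [EFin \o _]eq_fun do rewrite /= big_cons.
exact: (integrable_RD (iF j) IH).
Qed.

Lemma Rintegral_sum (J : Type) (s : seq J) (F : J -> T -> R) :
  (forall j, P.-integrable setT (EFin \o F j)) ->
  \int[P]_w (\sum_(j <- s) F j w) = \sum_(j <- s) \int[P]_w F j w.
Proof.
move=> iF; elim: s => [|j s IH].
  rewrite big_nil; under eq_Rintegral do rewrite big_nil.
  exact: (Ex_cst P 0).
rewrite big_cons; under eq_Rintegral do rewrite big_cons.
by rewrite RintegralD ?IH//; exact: integrable_Rsum.
Qed.

End Rintegral_sum.

Section affine_law.
Context (R : realType) d (T : measurableType d) (P : probability T R) (Y : T -> R).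
Notation gam := (stdn R).

Lemma normally_distributed_law : normally_distributed P Y ->
  exists m s : R, 0 <= s /\ forall B : set R, measurable B ->
    P (Y @^-1` B) = gam [set z : R | B (s * z + m)].
Proof.
move=> [m [s [s0 H]]]; exists m, s; split => // B mB; rewrite H//.
case: eqP => [->|/eqP s_neq0]; last by rewrite normal_prob_scale// lt_neqAle eq_sym s_neq0.
rewrite diracE; case: (pselect (B m)) => Bm.
  rewrite mem_set//= (_ : [set z : R | _] = setT) ?probability_setT//.
  by apply/seteqP; split => // z _ /=; rewrite mul0r add0r.
rewrite memNset//= (_ : [set z : R | _] = set0) ?measure0//.
by apply/seteqP; split => // z /=; rewrite mul0r add0r.
Qed.

Lemma centered_normal_law (v : R) : measurable_fun setT Y ->
  normally_distributed P Y -> P.-integrable setT (EFin \o Y) ->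
  P.-integrable setT (EFin \o (fun w => Y w ^+ 2)) ->
  \int[P]_w Y w = 0 -> \int[P]_w (Y w ^+ 2) = v ->
  0 <= v /\ forall B : set R, measurable B ->
    P [set w | B (Y w)] = gam [set z : R | B (Num.sqrt v * z)].
Proof.
move=> mY nY iY iY2 EY EY2.
have [m [s [s0 law]]] := normally_distributed_law nY.
have mA : measurable_fun setT (fun z : measurableTypeR R => s * z + m : R).
  by apply: measurable_funD => //; apply: measurable_funM => //; exact: measurable_id.
have iz : gam.-integrable setT (EFin \o (fun z : R => s * z)).
  exact: (integrable_RZ s (integrable_stdn_id R)).
have ic (c : R) : gam.-integrable setT (EFin \o (fun z : R => c)).
  exact: (bmeas_integrable gam (bmeas_cst _ c)).
have m0 : m = 0.
  have := Rintegral_same_law mY mA law (@measurable_id _ _ setT) iY.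
  have Es : \int[gam]_w (s * w) = 0.
    by have := RintegralZl s measurableT (integrable_stdn_id R); rewrite stdn_mean mulr0.
  by rewrite /= EY RintegralD// Es add0r => ->; exact/esym/(Ex_cst gam m).
have sv : s ^+ 2 = v.
  have := Rintegral_same_law mY mA law (@exprn_measurable R setT 2) iY2.
  rewrite EY2 => ->.
  transitivity (\int[gam]_w (s ^+ 2 * w ^+ 2)); last first.
    by apply: eq_Rintegral => w _; rewrite m0 addr0 exprMn.
  have i2 : gam.-integrable setT (EFin \o (fun z : R => z ^+ 2)).
    apply/integrableP; split; first by apply/measurable_EFinP; exact: exprn_measurable.
    under eq_integral do rewrite /= ger0_norm ?sqr_ge0//.
    (* An infinite integral would have real value 0, against [stdn_var]. *)
    have := stdn_var R; rewrite /Rintegral; case: (integral _ _ _) => [x|/=|/=] //; first by rewrite ltry.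
    by move=> /eqP; rewrite eq_sym oner_eq0.
  by have := RintegralZl (s ^+ 2) measurableT i2; rewrite stdn_var mulr1.
split; first by rewrite -sv sqr_ge0.
move=> B mB; rewrite [LHS](law B mB) -sv sqrtr_sqr ger0_norm// m0.
by congr (gam _); apply/seteqP; split => z /=; rewrite addr0.
Qed.

End affine_law.

Lemma gaussian_family_reindex (R : realType) d (T : measurableType d)
    (P : probability T R) (I J : Type) (phi : J -> I) (X : I -> T -> R) (c : I -> I -> R) :
  gaussian_family P X c ->
  gaussian_family P (X \o phi) (fun k l => c (phi k) (phi l)).
Proof.
move=> [mX cs H]; split=> [k|k l|s]; [exact: mX|exact: cs|].
pose s' := [seq (p.1, phi p.2) | p <- s].
have [v0 law] := H s'.
have <- : gvar c s' = gvar (fun k l => c (phi k) (phi l)) s.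
  rewrite /gvar big_map; apply: eq_bigr => p _; rewrite big_map//.
split => // B mB; rewrite -law//; congr (P _).
by apply/seteqP; split => w; rewrite /= /lin big_map.
Qed.

(** * A stationary Gaussian field as a Gaussian family *)

Section gaussian_field.
Context (R : realType) d (T : measurableType d) (P : probability T R).
Variables (X : int * int -> {RV P >-> R}) (r : int * int -> R).
Hypothesis sX : strictly_stationary X.
Hypothesis gX : gaussian_field X.
Hypothesis EX : forall k, ('E_P[X k] = 0)%E.
Hypothesis VX : forall k, ('V_P[X k] = 1)%E.
Hypothesis CX : forall k, ('E_P[fun w => (X k w * X (0, 0) w)%R] = (r k)%:E)%E.

Let mX k : measurable_fun setT (X k). Proof. exact: measurable_funPT. Qed.

Let int2 k : (\int[P]_w ((X k w) ^+ 2)%:E = 1)%E.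
Proof.
rewrite -(VX k) /variance unlock EX/= unlock; apply: eq_integral => w _; congr (_%:E).
by rewrite [RHS](_ : _ = (X k w - 0) * (X k w - 0))// subr0.
Qed.

Let mXM k l : measurable_fun setT (fun w => X k w * X l w).
Proof. exact: measurable_funM. Qed.

Let i2 k : P.-integrable setT (EFin \o (fun w => X k w ^+ 2)).
Proof.
apply/integrableP; split; first by apply/measurable_EFinP; exact: measurable_funX.
under eq_integral do rewrite /= ger0_norm ?sqr_ge0//.
by rewrite int2 ltry.
Qed.

Let iM k l : P.-integrable setT (EFin \o (fun w => X k w * X l w)).
Proof.
apply: (@le_integrable _ _ _ P setT measurableT _ (EFin \o (fun w => X k w ^+ 2 + X l w ^+ 2))).
- by apply/measurable_EFinP.
- move=> w _ /=; rewrite lee_fin normrM [leRHS]ger0_norm ?addr_ge0 ?sqr_ge0//.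
  rewrite -(@real_normK _ (X k w)) ?num_real// -(@real_normK _ (X l w)) ?num_real//.
  have := sqr_ge0 (`|X k w| - `|X l w|); have := sqr_ge0 (`|X k w| + `|X l w|).
  rewrite !expr2; lra.
- exact: (integrable_RD (i2 k) (i2 l)).
Qed.

Let i1 k : P.-integrable setT (EFin \o X k).
Proof.
apply: (@le_integrable _ _ _ P setT measurableT _ (EFin \o (fun w => X k w ^+ 2 + 1))).
- by apply/measurable_EFinP.
- move=> w _ /=; rewrite lee_fin [leRHS]ger0_norm ?addr_ge0 ?sqr_ge0//.
  rewrite -(@real_normK _ (X k w)) ?num_real//.
  have := sqr_ge0 (`|X k w| - 1); have := normr_ge0 (X k w).
  rewrite !expr2; lra.
- exact: (integrable_RD (i2 k) (bmeas_integrable P (bmeas_cst _ 1))).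
Qed.

(** [CX] only treats pairs with second index 0; strict stationarity shifts the pair (k - l, 0) by
    l. *)
Lemma field_covariance k l : \int[P]_w (X k w * X l w) = r (k - l).
Proof.
have -> : r (k - l) = \int[P]_w (X (k - l) w * X (0, 0) w).
  by rewrite /Rintegral; have := CX (k - l); rewrite unlock => ->.
pose t : 2.-tuple (int * int)%type := [tuple k - l; (0, 0)].
apply: (Rintegral_same_law (mXM k l) (mXM _ _) _ (@measurable_id _ _ setT)); last exact: iM.
move=> B mB.
have mA : measurable [set u : 2.-tuple R | B (tnth u ord0 * tnth u ord_max)].
  rewrite -[X in measurable X]setTI.
  have mf : measurable_fun setT (fun u : 2.-tuple R => tnth u ord0 * tnth u ord_max).
    by apply: measurable_funM; exact: measurable_tnth.
  exact: mf.
have := sX t l mA.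
rewrite (_ : [set w | _] = (fun w => X k w * X l w) @^-1` B); last first.
  apply/seteqP; split => w /=; rewrite !tnth_mktuple/= !(tnth_nth (0, 0))/=.
    by rewrite subrK add0r.
  by rewrite subrK add0r.
rewrite (_ : [set w | _] = (fun w => X (k - l) w * X (0, 0) w) @^-1` B) //.
by apply/seteqP; split => w /=; rewrite !tnth_mktuple/= !(tnth_nth (0, 0)).
Qed.

Lemma gaussian_field_family :
  gaussian_family P (fun k => X k : T -> R) (fun k l => r (k - l)).
Proof.
split => [//|k l|s].
  by rewrite -!field_covariance; apply: eq_Rintegral => w _; rewrite mulrC.
have ilin : P.-integrable setT (EFin \o lin (fun k => X k : T -> R) s).
  by apply: (@integrable_Rsum _ _ _ P _ s (fun p w => p.1 * X p.2 w)) => p; exact: (integrable_RZ _ (i1 _)).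
have lin2 w : lin (fun k => X k : T -> R) s w ^+ 2 =
    \sum_(p <- s) \sum_(q <- s) (p.1 * q.1) * (X p.2 w * X q.2 w).
  rewrite expr2 /lin big_distrl/=; apply: eq_bigr => p _.
  by rewrite big_distrr/=; apply: eq_bigr => q _; rewrite mulrACA.
have i22 p q : P.-integrable setT (EFin \o (fun w => (p.1 * q.1) * (X p.2 w * X q.2 w))).
  exact: (integrable_RZ _ (iM _ _)).
apply: centered_normal_law => //.
- exact: measurable_lin.
- have := @gX (size s) (fun i => (tnth (in_tuple s) i).1) (fun i => (tnth (in_tuple s) i).2).
  congr (normally_distributed P); apply/funext => w.
  by rewrite /lin (big_tnth _ _ s).
- under [EFin \o _]eq_fun do rewrite /= lin2.
  by apply: integrable_Rsum => p; exact: integrable_Rsum.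
- rewrite Rintegral_sum; last by move=> p; exact: (integrable_RZ _ (i1 _)).
  rewrite big1// => p _; rewrite RintegralZl//.
  by rewrite /Rintegral; have := EX p.2; rewrite unlock => ->; rewrite mulr0.
- under eq_Rintegral do rewrite lin2.
  rewrite Rintegral_sum; last by move=> p; exact: integrable_Rsum.
  apply: eq_bigr => p _; rewrite Rintegral_sum//.
  by apply: eq_bigr => q _; rewrite RintegralZl// field_covariance.
Qed.

End gaussian_field.

(** * Maxima of the field and phantom distances *)

Section field_max.
Context (R : realType).

Lemma bigmax_seq_le (J : Type) (s : seq J) (x0 u : R) (F : J -> R) :
  (\big[Num.max/x0]_(j <- s) F j <= u) = (x0 <= u) && all (fun j => F j <= u) s.
Proof.
elim: s => [|j s IH]; first by rewrite big_nil andbT.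
by rewrite big_cons ge_max IH /= andbCA.
Qed.

Definition quadrant (T : Type) (X : int * int -> T -> R) (k : nat * nat) : T -> R :=
  X (k.1%:Z, k.2%:Z).

Lemma field_max_le (T : Type) (X : int * int -> T -> R) (n1 n2 : nat) (w : T) (u : R) :
  (0 < n1)%N -> (0 < n2)%N ->
  (field_max X (n1, n2) w <= u) = all (fun k => quadrant X k w <= u) (grid n1 n2).
Proof.
move=> n10 n20; rewrite /field_max bigmax_seq_le /index_iota !subSS !subn0.
have -> : all (fun k => quadrant X k w <= u) (grid n1 n2) =
    all (fun i => all (fun j => X (i%:Z, j%:Z) w <= u) (iota 1 n2)) (iota 1 n1).
  rewrite /grid; elim: (iota 1 n1) => [//|i s IH].
  by rewrite /= all_cat all_map -IH.
have -> : all (fun i => \big[Num.max/X (1, 1) w]_(j <- iota 1 n2) X (i%:Z, j%:Z) w <= u) (iota 1 n1) =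
    all (fun i => (X (1, 1) w <= u) && all (fun j => X (i%:Z, j%:Z) w <= u) (iota 1 n2)) (iota 1 n1).
  by apply: eq_all => i; rewrite bigmax_seq_le.
apply/andP/idP => [[_ /allP H]|/allP H].
  by apply/allP => i /H /andP[].
(* The default value of the iterated maxima is itself a variable of the box. *)
have h11 : X (1, 1) w <= u.
  have i1 : (1 \in iota 1 n1)%N by rewrite mem_iota; lia.
  have j1 : (1 \in iota 1 n2)%N by rewrite mem_iota; lia.
  by have /allP/(_ _ j1) := H _ i1.
by split => //; apply/allP => i /H ->; rewrite h11.
Qed.

Context d (T : measurableType d) (P : probability T R).
Variable X : int * int -> {RV P >-> R}.

Lemma field_max_pmax (n1 n2 : nat) (u : R) : (0 < n1)%N -> (0 < n2)%N ->
  fine (P [set w | field_max (fun k => X k : T -> R) (n1, n2) w <= u]) =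
  pmax P (quadrant (fun k => X k : T -> R)) u (grid n1 n2).
Proof.
move=> n10 n20; rewrite pmaxE Ex_bool.
  by congr (fine (P _)); apply/seteqP; split => w /=; rewrite field_max_le.
have mq k : measurable_fun setT (quadrant (fun k => X k : T -> R) k) by exact: measurable_funPT.
have := measurable_box [seq (k, u) | k <- grid n1 n2] mq.
by congr measurable; apply/seteqP; split => w; rewrite /= /box all_map.
Qed.

Variable G : R -> R.

Lemma phantom_distance_le (n : nat * nat) (eps : R) :
  (forall x, `|fine (P [set w | field_max (fun k => X k : T -> R) n w <= x]) -
    G x ^+ (n.1 * n.2)| <= eps) ->
  0 <= phantom_distance P (fun k => X k : T -> R) G n <= eps.
Proof.
move=> H; apply/andP; split.
  apply: le_trans (ub_le_sup _ _); [|by exists eps => _ [x _ <-]; exact: H|by exists 0].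
  exact: normr_ge0.
by apply: ge_sup; [by eexists; exists 0|move=> _ [x _ <-]; exact: H].
Qed.

Lemma distribution_function_bounds : distribution_function G -> forall x, 0 <= G x <= 1.
Proof.
move=> [hG _ Ny y] x; apply/andP; split.
  apply: (cvgr_to_le Ny); near=> z; apply: hG; near: z; exact: nbhs_ninfty_le (num_real _).
apply: (cvgr_to_ge y); near=> z; apply: hG; near: z; exact: nbhs_pinfty_ge (num_real _).
Unshelve. all: end_near. Qed.

Lemma le_phantom_distance (n1 n2 : nat) (x : R) : distribution_function G ->
  (0 < n1)%N -> (0 < n2)%N ->
  `|pmax P (quadrant (fun k => X k : T -> R)) x (grid n1 n2) - G x ^+ (n1 * n2)| <=
  phantom_distance P (fun k => X k : T -> R) G (n1, n2).
Proof.
move=> dG n10 n20; rewrite -field_max_pmax//; apply: ub_le_sup; last by exists x.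
exists 2 => _ [y _ <-] /=; rewrite field_max_pmax//.
have /andP[G0 G1] := distribution_function_bounds dG y.
have g0 : 0 <= G y ^+ (n1 * n2) by exact: exprn_ge0.
have g1 : G y ^+ (n1 * n2) <= 1 by exact: exprn_ile1.
have p0 : 0 <= pmax P (quadrant (fun k => X k : T -> R)) y (grid n1 n2) by exact: Ex_ge0.
have p1 : pmax P (quadrant (fun k => X k : T -> R)) y (grid n1 n2) <= 1.
  rewrite -[leRHS](Ex_cst P 1); apply: le_Ex; last by move=> w; case: box.
    by apply: bmeas_bool; apply: measurable_box => k; exact: measurable_funPT.
  exact: bmeas_cst.
by rewrite ler_norml; apply/andP; split; lra.
Qed.

End field_max.

(** * Sectorial phantom and absence of a global one *)

Section phantom.
Context (R : realType) (e1 e2 : nat -> R) (rho G0 : R).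
Hypothesis W : weak_decay e1 e2 rho G0.
Context d (T : measurableType d) (P : probability T R).
Variable X : int * int -> {RV P >-> R}.
Notation X' := (fun k => X k : T -> R).
Hypothesis gX : gaussian_family P (quadrant X') (cgrid e1 e2).
Notation Phi := (@standard_normal_df R).
Notation Q := (@ntail R).

Lemma sectorial_phantom_normal : sectorial_phantom_df P X Phi.
Proof.
split; first exact: distribution_function_normal.
move=> psi [psi0 psioo _ _ _] [C [C1 sec]]; split; first exact: distribution_function_normal.
apply/cvgrPdist_le => eps eps0.
(* Both sides of a box lie between j / C and C j, so their ratio is at most C^2. *)
have CC1 : 1 <= C * C by nra.
have [L0 HL] := sector_uniform W gX CC1 eps0.
near=> n.
have n0 : (0 < n)%N by near: n; exact: nbhs_infty_gt.
have [p1 p2] := psi0 n n0.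
have [j [j0 [/andP[j1 j1'] /andP[j2 j2']]]] : exists j : nat, (0 < j)%N /\
  C^-1 * j%:R <= (psi n).1%:R <= C * j%:R /\
      C^-1 * j%:R <= (psi n).2%:R <= C * j%:R by near: n.
have large : expR L0 <= (psi n).1%:R.
  near: n; apply: (psioo (fun x : nat * nat => is_true (expR L0 <= x.1%:R))).
  exists ([set n : nat | expR L0 <= n%:R], setT) => /=.
    by split; [exact: nbhs_infty_ger|exact: filterT].
  by move=> [a b] [].
have C0 : 0 < C by lra.
move: j1 j2; rewrite !ler_pdivrMl// => j1 j2.
have /andP[d0 d1] : 0 <= phantom_distance P X' Phi (psi n) <= eps.
  apply: phantom_distance_le => x.
  case: (psi n) p1 p2 j1 j2 j1' j2' large => a b /= p1 p2 j1 j2 j1' j2' large.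
  rewrite field_max_pmax//; apply: HL => //.
  - rewrite -[L0]expRK ler_ln ?posrE ?expR_gt0 ?ltr0n ?muln_gt0 ?p1//.
    by rewrite (le_trans large)// ler_nat leq_pmulr.
  - by rewrite -mulrA (le_trans j1')// ler_wpM2l// ltW.
  - by rewrite -mulrA (le_trans j2')// ler_wpM2l// ltW.
by rewrite sub0r normrN ger0_norm.
Unshelve. all: end_near. Qed.

Hypothesis e1_ln : e1 n * ln n%:R @[n --> \oo] --> +oo.
Hypothesis e1_sq : \forall n \near \oo, e1 n <= 2 * e1 (n * n)%N.
Hypothesis e2_gt0 : forall n, 0 < e2 n.

(* The boxes (q^2, p^2) and (qp, qp) have the same number of points, so a phantom
   distribution function would give them nearly the same maxima. *)
Lemma no_phantom_df : ~ exists G : R -> R, phantom_df P X G.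
Proof.
move=> [G [dG]] /cvgrPdist_le/(_ (1 / 100) ltac:(lra))[[A B] /= [[N1 _ HA] [N2 _ HB]] AB].
have close n1 n2 : (N1 <= n1)%N -> (N2 <= n2)%N -> (0 < n1)%N -> (0 < n2)%N -> forall x,
    `|pmax P (quadrant X') x (grid n1 n2) - G x ^+ (n1 * n2)| <= 1 / 100.
  move=> h1 h2 n10 n20 x.
  apply: (le_trans (le_phantom_distance X x dG n10 n20)).
  have := AB (n1, n2) (conj (HA _ h1) (HB _ h2)).
  rewrite /= sub0r normrN; apply: le_trans; exact: ler_norm.
(* For q >= p this makes p^2, q^2 and q p all at least N1 and N2. *)
pose p := (N1 + N2).+1; have p0 : (0 < p)%N by [].
(* The sector with constant 1 suffices, as the comparison box is a square. *)
have [L0 HL] := @sector_uniform _ _ _ _ _ W _ _ _ _ gX 1 (1 / 100) (lexx 1) ltac:(lra).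
have [q [qp q16 qL qc]] : exists q : nat, [/\ (p <= q)%N, (16 <= q)%N, expR L0 <= q%:R &
  forall u, (q * q * (p * p))%:R * Q u = 15 -> 1 / 4 <= pmax P (quadrant X') u (grid (q * q) (p * p))].
  have : \forall q \near \oo, [/\ (p <= q)%N, (16 <= q)%N, expR L0 <= q%:R &
     forall u, (q * q * (p * p))%:R * Q u = 15 -> 1 / 4 <= pmax P (quadrant X') u (grid (q * q) (p * p))].
    near=> q; split; [near: q; exact: nbhs_infty_ge|near: q; exact: nbhs_infty_ge|near: q; exact: nbhs_infty_ger|].
    near: q; exact: (box_clustering W e1_ln e1_sq e2_gt0 gX p0).
  by move=> /filter_ex.
have q0 : (0 < q)%N by lia.
have N15 : (15 < q * q * (p * p))%N by nia.
have N0 : 0 < (q * q * (p * p))%:R :> R by rewrite ltr0n; lia.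
have [|u Qu] := @ntail_surj R (15 / (q * q * (p * p))%:R).
  by rewrite divr_gt0//= ltr_pdivrMr// mul1r ltr_nat.
have b1 := qc u.
have {b1} : 1 / 4 <= pmax P (quadrant X') u (grid (q * q) (p * p)).
  by apply: b1; rewrite Qu mulrC divfK// gt_eqF.
have c1 := close (q * q)%N (p * p)%N ltac:(rewrite /p; nia) ltac:(rewrite /p; nia) ltac:(nia) ltac:(nia) u.
have c2 := close (q * p)%N (q * p)%N ltac:(rewrite /p; nia) ltac:(rewrite /p; nia) ltac:(nia) ltac:(nia) u.
have c3 : `|pmax P (quadrant X') u (grid (q * p) (q * p)) - Phi u ^+ (q * p * (q * p))| <= 1 / 100.
  apply: HL; rewrite ?muln_gt0 ?q0 ?mul1r//.
  rewrite -[L0]expRK ler_ln ?posrE ?expR_gt0 ?ltr0n ?muln_gt0 ?q0//.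
  by rewrite (le_trans qL)// ler_nat -mulnA leq_pmulr// !muln_gt0 p0 q0.
have NE : (q * p * (q * p) = q * q * (p * p))%N by rewrite mulnACA.
(* N Q(u) = 15 gives Phi(u)^N <= exp(- 15), and exp 15 >= 1 + 15. *)
have c4 : Phi u ^+ (q * p * (q * p)) <= 1 / 16.
  rewrite NE.
  have -> : Phi u = 1 - Q u by rewrite /ntail; ring.
  have Q1 : Q u <= 1 by exact: ntail_le1.
  apply: (@le_trans _ _ (expR (- Q u) ^+ (q * q * (p * p)))).
    by rewrite lerXn2r ?nnegrE ?expR_ge0 ?subr_ge0// expR_ge1Dx.
  rewrite -expRM_natl Qu mulrN mulrC divfK ?gt_eqF// expRN.
  rewrite div1r lef_pV2 ?posrE ?expR_gt0//.
  by apply: le_trans (expR_ge1Dx _); lra.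
(* The gap 1 / 4 - 1 / 16 exceeds the three errors of 1 / 100. *)
move: c1 c2 c3 c4; rewrite NE !ler_norml => /andP[? ?] /andP[? ?] /andP[? ?]; lra.
Unshelve. all: end_near. Qed.

End phantom.

Lemma nat_dist_absz (a b : nat) : nat_dist a b = `|a%:Z - b%:Z|%N.
Proof. by rewrite /nat_dist; lia. Qed.

Theorem mainTheorem6 (R : realType) (g1 g2 : R) (eta1 eta2 : R -> R)
  (r : int * int -> R) :
  0 < g1 -> 0 < g2 ->
  1 / 4 < g1 ->
  g1 * (27 * (ln (ln 27) / ln 27) - 26 * (ln (ln 28) / ln 28))
    < g2 * (2 / ln 2 - 1 / ln 3) ->
  g2 * (2 / ln 2 - 1 / ln 3) < (1 - 2 * g1) / (1 + 2 * g1) ->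
  even_polygonal (nodes1 g1) eta1 ->
  even_polygonal (nodes2 g2) eta2 ->
  (forall i j : int, r (i, j) = eta1 i%:~R * eta2 j%:~R) ->
  covariance_function r /\
  forall (d : measure_display) (T : measurableType d) (P : probability T R)
    (X : int * int -> {RV P >-> R}),
    strictly_stationary X ->
    gaussian_field X ->
    (forall k, 'E_P[X k] = 0)%E ->
    (forall k, 'V_P[X k] = 1)%E ->
    (forall k, 'E_P[fun w => (X k w * X (0, 0) w)%R] = (r k)%:E)%E ->
    sectorial_phantom_df P X (@standard_normal_df R) /\
    ~ (exists G : R -> R, phantom_df P X G).
Proof.
move=> g10 g20 g1_gt g12 g12' P1 P2 rE.
have rabs i j : r (i, j) = eta1 `|i|%N%:R * eta2 `|j|%N%:R.
  by rewrite rE (even_polygonal_abs _ P1) (even_polygonal_abs _ P2).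
have h1 := eta1_1_lt g1_gt g12 g12' P2.
have h2 := eta2_1_lt g1_gt g12' P2.
have h3 := g1_lt g1_gt g20 g12' P2.
split.
  apply: (product_covariance (e1 := fun n => eta1 n%:R) (e2 := fun n => eta2 n%:R)) => //.
  - exact: eta1_0 P1.
  - exact: eta1_convex P1 g10 h3 h1.
  - exact: eta1_lim P1 g10.
  - exact: eta2_0 P2.
  - exact: eta2_convex P2 g20 h2.
  - exact: eta2_lim P2 g20.
move=> d T P X sX gX EX VX CX.
have W := eta_weak_decay g1_gt g20 g12 g12' P1 P2.
have gf : gaussian_family P (quadrant (fun k => X k : T -> R))
    (cgrid (fun n => eta1 n%:R) (fun n => eta2 n%:R)).
  have := gaussian_family_reindex (fun k : nat * nat => (k.1%:Z, k.2%:Z))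
    (gaussian_field_family sX gX EX VX CX).
  congr (gaussian_family P); apply/funext => k; apply/funext => l.
  rewrite [X in r X](_ : _ = (k.1%:Z - l.1%:Z, k.2%:Z - l.2%:Z))// rabs /cgrid.
  by rewrite !nat_dist_absz.
split.
  exact: (sectorial_phantom_normal W gf).
apply: (no_phantom_df W gf).
- exact: eta1_ln P1 g10.
- exact: eta1_sq P1 g10.
- exact: eta2_gt0 P2 g20.
Qed.
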